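(* Let $\alpha>0$ and $m>-1$ with $\alpha>m$, and let $\lambda$ satisfy $0<\lambda<\frac{2(\alpha-m)}{1+m}$. Then there is $n_0=n_0(\lambda,\alpha,m)>0$ such that for every $n\in(0,n_0)$ the following hold: $(\alpha,m,n)$ satisfies $-\alpha+m+n<0$; $\lambda$ satisfies $0<\lambda<\frac{2(\alpha-m-n)(1+m)}{(1+m+n)^2}$; and system (S) (with these parameters) admits a heteroclinic orbit $\chi(\eta)=(p,q,r,s)(\eta)$, $\eta\in\mathbb{R}$, with $\chi(\eta)\to M_0$ as $\eta\to-\infty$, $\chi(\eta)\to M_1$ as $\eta\to+\infty$, and $$e^{-2\eta}\big(\chi(\eta)-M_0\big)\to\kappa X_{01}\quad\text{as }\eta\to-\infty$$ for some constant $\kappa\neq 0$.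
   Context: Parameters: $\alpha>0$, $m>-1$, $n>0$, $\lambda>0$. Set $D=1+2\alpha-m-n$, $a=\frac{2+2\alpha-n}{D}+\frac{2(1+\alpha)}{D}\lambda$, $b=\frac{1+m}{D}+\frac{1+m+n}{D}\lambda$. System (S) for $(p,q,r,s)(\eta)$, with $\dot{}=d/d\eta$: $\dot p=p\big(\tfrac1\lambda(r-a)+2-\lambda pr-q\big)$, $\dot q=q(1-\lambda pr-q)+bpr$, $n\dot r=r\Big(\tfrac{\alpha-m-n}{\lambda(1+\alpha)}(r-a)+\lambda pr+q+\tfrac{\alpha}{\lambda}r\big(s-\tfrac{1+m+n}{1+\alpha}\big)+\tfrac{n\alpha}{\lambda(1+\alpha)}\Big)$, $\dot s=s\Big(\tfrac{\alpha-m-n}{\lambda(1+\alpha)}(r-a)+\lambda pr+q-\tfrac1\lambda r\big(s-\tfrac{1+m+n}{1+\alpha}\big)-\tfrac{n}{\lambda(1+\alpha)}\Big)$. Equilibria: $M_0=(0,0,r_0,s_0)$ with $r_0=a$, $s_0=\frac{1+m+n}{1+\alpha}-\frac{n}{(1+\alpha)r_0}$; $M_1=(0,1,r_1,s_1)$ with $r_1=a-\frac{1+\alpha}{\alpha-m-n}\lambda$, $s_1=\frac{1+m+n}{1+\alpha}-\frac{n}{(1+\alpha)r_1}$. $X_{01}=(1,\,br_0,\,y_1,\,z_1)^T$, where $y_1=-(\lambda+b)r_0\frac{\frac{1+\alpha}{\lambda}r_0+\frac{2}{s_0}}{\Delta_1}$, $z_1=-(\lambda+b)r_0\frac{\frac{n}{r_0}(\frac1\lambda+2)}{\Delta_1}$,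 $\Delta_1=\frac{1-s_0}{\lambda}\big(\frac{1+\alpha}{\lambda}r_0+\frac2{s_0}\big)-\frac{n}{r_0}\big(\frac1\lambda+2\big)\big(\frac{r_0}{\lambda}+\frac2{s_0}\big)$; it is an eigenvector of the Jacobian of (S) at $M_0$ for the eigenvalue $2$. *)

(* Defs.v *)
From Stdlib Require Import Reals Lra.
Open Scope R_scope.

Definition Dp (al m n : R) : R := 1 + 2*al - m - n.
Definition ap (al m n lam : R) : R :=
  (2 + 2*al - n) / Dp al m n + (2*(1+al)) / Dp al m n * lam.
Definition bp (al m n lam : R) : R :=
  (1 + m) / Dp al m n + (1 + m + n) / Dp al m n * lam.

(* Right-hand sides of system (S). The r-equation reads n r' = fr, so r' = fr / n. *)
Definition fp (al m n lam p q r s : R) : R :=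
  p * ((1/lam) * (r - ap al m n lam) + 2 - lam*p*r - q).
Definition fq (al m n lam p q r s : R) : R :=
  q * (1 - lam*p*r - q) + bp al m n lam * p * r.
Definition fr (al m n lam p q r s : R) : R :=
  r * ((al - m - n) / (lam*(1+al)) * (r - ap al m n lam) + lam*p*r + q
       + (al/lam) * r * (s - (1+m+n)/(1+al)) + (n*al)/(lam*(1+al))).
Definition fs (al m n lam p q r s : R) : R :=
  s * ((al - m - n) / (lam*(1+al)) * (r - ap al m n lam) + lam*p*r + q
       - (1/lam) * r * (s - (1+m+n)/(1+al)) - n/(lam*(1+al))).

(* Equilibria M0 = (0,0,r0,s0), M1 = (0,1,r1,s1). *)
Definition r0 (al m n lam : R) : R := ap al m n lam.
Definition s0 (al m n lam : R) : R :=
  (1+m+n)/(1+al) - n / ((1+al) * r0 al m n lam).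
Definition r1 (al m n lam : R) : R :=
  ap al m n lam - (1+al)/(al-m-n) * lam.
Definition s1 (al m n lam : R) : R :=
  (1+m+n)/(1+al) - n / ((1+al) * r1 al m n lam).

(* Eigenvector X01 = (1, b r0, y1, z1). *)
Definition Delta1 (al m n lam : R) : R :=
  let r0 := r0 al m n lam in let s0 := s0 al m n lam in
  (1 - s0)/lam * ((1+al)/lam * r0 + 2/s0)
  - n/r0 * (1/lam + 2) * (r0/lam + 2/s0).
Definition y1 (al m n lam : R) : R :=
  let r0 := r0 al m n lam in let s0 := s0 al m n lam in
  - (lam + bp al m n lam) * r0 * (((1+al)/lam * r0 + 2/s0) / Delta1 al m n lam).
Definition z1 (al m n lam : R) : R :=
  let r0 := r0 al m n lam in
  - (lam + bp al m n lam) * r0 * ((n/r0 * (1/lam + 2)) / Delta1 al m n lam).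

Definition tends_minf (f : R -> R) (l : R) : Prop :=
  forall eps, 0 < eps -> exists T, forall eta, eta < T -> Rabs (f eta - l) < eps.
Definition tends_pinf (f : R -> R) (l : R) : Prop :=
  forall eps, 0 < eps -> exists T, forall eta, T < eta -> Rabs (f eta - l) < eps.

Definition solves_S (al m n lam : R) (p q r s : R -> R) : Prop :=
  forall eta,
    derivable_pt_lim p eta (fp al m n lam (p eta) (q eta) (r eta) (s eta)) /\
    derivable_pt_lim q eta (fq al m n lam (p eta) (q eta) (r eta) (s eta)) /\
    derivable_pt_lim r eta (fr al m n lam (p eta) (q eta) (r eta) (s eta) / n) /\
    derivable_pt_lim s eta (fs al m n lam (p eta) (q eta) (r eta) (s eta)).

(* Main.v *)
(** For small n the variable r is fast and repelling: along a bounded orbit it stays within O(n) of the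
    slow manifold r (c + lam p) = c a - q, where c = (al - m - n) / (lam (1 + al)).

    Once r(.) is prescribed, the substitution u = q / p, v = 1 / p, y = r^n / s, rho = 1 / r turns (S) into
    a chain of linear scalar equations. Each has exactly one solution with the right behaviour at infinity:
    bounded at -oo for u and y, v = e^(-2t) / kap + O(1) at -oo, and bounded at +oo for rho, whose equation
    is repelling. So r |-> 1 / rho is a well-defined operator, after clamping p and q in the equation of rho
    to make it globally defined. For small n and kap it is a contraction in the weight e^(2t) + e^(K t), with
    K large, on the functions r with |r - a| <= C e^(2t). Its fixed point leaves M0 at the rate e^(2t).

    A linear barrier shows that this orbit is O(n)-close to the slow manifold, so (p, q) solves a perturbation
    of a planar quadratic system. This bounds p and q, so that the clamps are inactive. The function
    z = p - c + (c + 1 / lam) q / 2, which vanishes on the p-nullcline, is strictly increasing where |z| is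
    small, so the orbit crosses this strip at most once. If z stayed negative, p would grow exponentially;
    hence z is eventually positive, p -> 0, and then q -> 1.

    The limits of r and s at +oo, and the eigenvector asymptotics at -oo, follow from a small-gain argument
    for a repelling and an attracting linear equation coupled by O(n) terms. *)
Require Import Defs.
From Stdlib Require Import Reals Lra Psatz ClassicalEpsilon.
From Coquelicot Require Import Coquelicot.
Open Scope R_scope.

(** The limit n -> 0 is singular, so all estimates have to be uniform in n. With [be] = (1 + al) /
    lam, [ze] = al / lam, [ga] = (1 + m + n) / lam, [Bm] = (m + n) / lam, eps = n / (1 + al) and k =
    c a - ze eps, the equation of r reads n r' = r (- (k - q) + r (lam p + ze s - Bm)). Hence 1 / r
    is repelling at the rate (k - q) / n as long as q stays below k. The room for this comes from
    the bound on lam: at n = 0 it says exactly b < 1, which gives c a > 1 and c a b < c a, so that a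
    clamp Q fits strictly between max (1, c a b) and c a. The variable s = r^n / y responds to r
    with a gain O(n) only, because the two effects of r on ln y cancel near s = ga / be. The
    response of p and q is not small in n: a large K tames it for late times and a small kap for t
    <= 1 / 2. Taking kap small costs nothing, since (S) is autonomous and a time shift rescales kap.
    The constants P, Q, g, rl, rh, K, kap and del are all chosen from the coefficients at n = 0; n
    comes last. *)

Lemma is_derive_cont (f : R -> R) (x l : R) : is_derive f x l -> continuity_pt f x.
Proof.
  intros H. apply derivable_continuous_pt. exists l. now apply is_derive_Reals.
Qed.

(** * Tactics for signs, monotonicity and derivatives *)

Ltac pos :=
  first [ assumption | lra | apply exp_pos | apply Rabs_pos
        | apply Rmult_lt_0_compat; pos | apply Rdiv_lt_0_compat; pos
        | apply Rplus_lt_0_compat; pos | apply Rinv_0_lt_compat; pos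
        | apply Rmult_le_pos; pos | apply Rdiv_le_0_compat; pos
        | apply Rplus_le_le_0_compat; pos | left; apply Rinv_0_lt_compat; pos | left; apply exp_pos ].

Ltac mono :=
  first [ lra | apply Rmult_le_compat_l; [pos | mono] | apply Rmult_le_compat_r; [pos | mono]
        | apply Rmult_le_compat; [pos | pos | mono | mono] ].

Ltac note H := let M := fresh "M" in assert (M := H).
Ltac min_bounds x y := note (Rmin_l x y); note (Rmin_r x y).
Ltac max_bounds x y := note (Rmax_l x y); note (Rmax_r x y).

Section DeriveRules.
Variables (f g : R -> R) (x a b : R).
Hypotheses (Hf : is_derive f x a) (Hg : is_derive g x b).

Lemma derive_add : is_derive (fun y => f y + g y) x (a + b).
Proof. now apply (is_derive_plus f g). Qed.

Lemma derive_sub : is_derive (fun y => f y - g y) x (a - b).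
Proof. now apply (is_derive_minus f g). Qed.

Lemma derive_neg : is_derive (fun y => - f y) x (- a).
Proof. now apply (is_derive_opp f). Qed.

Lemma derive_mul : is_derive (fun y => f y * g y) x (a * g x + f x * b).
Proof. apply (is_derive_mult f g); auto. intros; apply Rmult_comm. Qed.

Lemma derive_exp_comp : is_derive (fun y => exp (f y)) x (a * exp (f x)).
Proof. apply (is_derive_comp exp f); auto. apply is_derive_exp. Qed.

Lemma derive_ln_comp : 0 < f x -> is_derive (fun y => ln (f y)) x (a * / f x).
Proof. intros H. apply (is_derive_comp ln f); auto. now apply is_derive_ln. Qed.

Lemma derive_inv_comp : f x <> 0 -> is_derive (fun y => / f y) x (- a / (f x) ^ 2).
Proof. intros H. now apply is_derive_inv. Qed.

Lemma derive_cst (c : R) : is_derive (fun _ => c) x 0.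
Proof. apply @is_derive_const. Qed.

Lemma derive_var : is_derive (fun y => y) x 1.
Proof. apply @is_derive_id. Qed.

Lemma derive_change (a' : R) : a = a' -> is_derive f x a'.
Proof. now intros <-. Qed.
End DeriveRules.

(* The branches match syntactically: plain unification against these rules diverges in Coquelicot's hierarchy. *)
Ltac derive_step tac :=
  lazymatch goal with
  | |- is_derive (fun _ => ?c) _ _ => apply (derive_cst _ c)
  | |- is_derive (fun y => y) _ _ => apply derive_var
  | |- is_derive (fun y => @?f y + @?g y) _ _ => apply (derive_add f g); derive_step tac
  | |- is_derive (fun y => @?f y - @?g y) _ _ => apply (derive_sub f g); derive_step tac
  | |- is_derive (fun y => - @?f y) _ _ => apply (derive_neg f); derive_step tac
  | |- is_derive (fun y => @?f y * @?g y) _ _ => apply (derive_mul f g); derive_step tac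
  | |- is_derive (fun y => @?f y / @?g y) _ _ =>
      apply (derive_mul f (fun y => / g y)); derive_step tac
  | |- is_derive (fun y => exp (@?f y)) _ _ => apply (derive_exp_comp f); derive_step tac
  | |- is_derive (fun y => ln (@?f y)) _ _ => apply (derive_ln_comp f); [derive_step tac|]
  | |- is_derive (fun y => / @?f y) _ _ => apply (derive_inv_comp f); [derive_step tac|]
  | |- is_derive ?F ?x _ =>
      first [ match goal with H : forall _, is_derive ?G _ _ |- _ => unify F G; apply H end
            | match goal with H : is_derive ?G ?y _ |- _ => unify F G; unify x y; apply H end
            | tac ]
  end.

Ltac derive_by tac := eapply derive_change; [derive_step tac|].

(** * Differential inequalities on half-lines *)

Lemma derive_nondecreasing (f df : R -> R) (x y : R) :
  x <= y -> (forall z, x <= z <= y -> is_derive f z (df z)) ->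
  (forall z, x <= z <= y -> 0 <= df z) -> f x <= f y.
Proof.
  intros Hxy Hd Hp.
  destruct (MVT_gen f x y df) as [z [Hz E]].
  - intros z Hz. rewrite Rmin_left, Rmax_right in Hz by lra. apply Hd; lra.
  - intros z Hz. rewrite Rmin_left, Rmax_right in Hz by lra.
    eapply is_derive_cont, Hd; lra.
  - rewrite Rmin_left, Rmax_right in Hz by lra.
    assert (0 <= df z) by (apply Hp; lra). nra.
Qed.

Lemma derive_nonincreasing (f df : R -> R) (x y : R) :
  x <= y -> (forall z, x <= z <= y -> is_derive f z (df z)) ->
  (forall z, x <= z <= y -> df z <= 0) -> f y <= f x.
Proof.
  intros Hxy Hd Hp.
  enough (- f x <= - f y) by lra.
  apply (derive_nondecreasing (fun z => - f z) (fun z => - df z)); auto.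
  - intros z Hz. apply (is_derive_opp f z (df z)). auto.
  - intros z Hz. specialize (Hp z Hz). lra.
Qed.

(** The crossing point is the supremum of the points of [x, y] where f < w. By continuity f < w is
    impossible there, since points just to the right would qualify, and so is f > w, since points
    just to the left would not. *)
Lemma last_crossing (f : R -> R) (x y w : R) :
  x <= y -> (forall z, x <= z <= y -> continuity_pt f z) -> f x < w -> w < f y ->
  exists z, x <= z <= y /\ f z = w /\ forall z', z <= z' <= y -> w <= f z'.
Proof.
  intros Hxy Hc Hx Hy.
  set (E := fun z => x <= z <= y /\ f z < w).
  destruct (completeness E) as [s [Hub Hlub]].
  - exists y. intros z [Hz _]; lra.
  - exists x. split; [lra|auto].
  - assert (Hxs : x <= s) by (apply Hub; split; [lra|auto]).
    assert (Hsy : s <= y) by (apply Hlub; intros z [Hz _]; lra).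
    assert (Hge : forall z, s < z <= y -> w <= f z).
    { intros z Hz. destruct (Rle_lt_dec w (f z)) as [|Hlt]; auto.
      assert (z <= s) by (apply Hub; split; [lra|auto]). lra. }
    assert (Heq : f s = w).
    { destruct (Rtotal_order (f s) w) as [Hlt|[Heq|Hgt]]; auto.
      - assert (s < y) by (destruct (Rle_lt_or_eq_dec s y Hsy); auto; subst; lra).
        destruct (Hc s (conj Hxs Hsy) (w - f s)) as [d [Hd Hd']]; [lra|].
        set (z := s + Rmin (d/2) (y - s)).
        assert (Hm : 0 < Rmin (d/2) (y - s)) by (apply Rmin_pos; lra).
        assert (Hm1 := Rmin_l (d/2) (y - s)). assert (Hm2 := Rmin_r (d/2) (y - s)).
        assert (Hz : s < z <= y) by (unfold z; lra).
        specialize (Hge z Hz).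
        assert (Hd2 : Rabs (f z - f s) < w - f s).
        { apply (Hd' z). split. split. exact I. lra. simpl. unfold R_dist. rewrite Rabs_right; unfold z; lra. }
        apply Rabs_def2 in Hd2. lra.
      - destruct (Hc s (conj Hxs Hsy) (f s - w)) as [d [Hd Hd']]; [lra|].
        exfalso. enough (s <= s - d / 2) by lra.
        apply Hlub. intros z [Hz Hfz].
        assert (Hzs : z <= s) by (apply Hub; split; auto).
        destruct (Rle_lt_dec z (s - d/2)) as [|Hlt]; auto.
        destruct (Req_dec z s) as [->|Hne]; [lra|].
        assert (Hd2 : Rabs (f z - f s) < f s - w).
        { apply (Hd' z). split. split. exact I. lra.
          simpl. unfold R_dist. rewrite Rabs_left; lra. }
        apply Rabs_def2 in Hd2. lra. }
    exists s. repeat split; auto.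
    intros z' Hz'. destruct (Req_dec z' s) as [->|Hne]; [lra|]. apply Hge; lra.
Qed.

(** If f t were positive, then after its last crossing of the level f t / 2 the function would be
    positive, hence nonincreasing, and f t <= f t / 2. Since x may depend on eps, the barrier can
    start at -oo. *)
Lemma barrier_nonpos (f df : R -> R) (t : R) :
  (forall x, is_derive f x (df x)) ->
  (forall eps, 0 < eps -> exists x, x <= t /\ f x < eps /\
     forall y, x <= y <= t -> 0 < f y -> df y <= 0) ->
  f t <= 0.
Proof.
  intros Hd H. destruct (Rle_lt_dec (f t) 0) as [|Hpos]; auto. exfalso.
  destruct (H (f t / 2)) as [x [Hx [Hfx Hdec]]]; [lra|].
  destruct (last_crossing f x t (f t / 2)) as [z [Hz [Hfz Hge]]]; auto; try lra.
  - intros z _. eapply is_derive_cont, Hd.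
  - assert (f t <= f z); [|lra].
    apply (derive_nonincreasing f df); auto. lra.
    intros y Hy. apply Hdec. lra. specialize (Hge y Hy). lra.
Qed.

Lemma nonpos_forward (f df : R -> R) (t0 t : R) :
  (forall x, is_derive f x (df x)) -> t0 <= t -> f t0 <= 0 ->
  (forall x, t0 <= x <= t -> 0 < f x -> df x <= 0) -> f t <= 0.
Proof.
  intros Hd Ht H0 H. apply (barrier_nonpos f df); auto.
  intros eps Heps. exists t0. repeat split; auto. lra.
Qed.

(** The product f e^(k t) is nonincreasing where it is positive and is at most B e^(k t), which
    tends to 0 at -oo. *)
Lemma bounded_decay_nonpos (f df : R -> R) (k B t : R) :
  (forall x, is_derive f x (df x)) -> 0 < k ->
  (forall x, x <= t -> f x <= B) ->
  (forall x, x <= t -> 0 < f x -> df x <= - k * f x) -> f t <= 0.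
Proof.
  intros Hd Hk HB H.
  enough (f t * exp (k * t) <= 0).
  { assert (0 < exp (k * t)) by pos. nra. }
  apply (barrier_nonpos (fun x => f x * exp (k * x))
           (fun x => df x * exp (k * x) + f x * (k * exp (k * x)))).
  - intros x. derive_by fail. ring.
  - intros eps Heps.
    (* A positive bound whatever the sign of [B], so that the logarithm of eps / B' makes sense. *)
    set (B' := Rmax B 0 + 1).
    assert (HB' : 0 < B') by (unfold B'; assert (H' := Rmax_r B 0); lra).
    set (x := Rmin t (ln (eps / B') / k)).
    exists x. assert (Hxt : x <= t) by apply Rmin_l. split; [auto|].
    assert (He : exp (k * x) <= eps / B').
    { rewrite <- (exp_ln (eps / B')) by (apply Rdiv_lt_0_compat; auto).
      destruct (Req_dec (k * x) (ln (eps/B'))) as [->|Hne]; [lra|].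
      left; apply exp_increasing.
      assert (x <= ln (eps / B') / k) by apply Rmin_r.
      assert (k * x <= k * (ln (eps/B') / k)) by mono.
      replace (k * (ln (eps / B') / k)) with (ln (eps/B')) in H1 by (field; lra). lra. }
    split.
    + assert (0 < exp (k * x)) by pos.
      assert (f x < B') by (unfold B'; specialize (HB x Hxt); assert (H' := Rmax_l B 0); lra).
      apply Rlt_le_trans with (B' * exp (k * x)). nra.
      replace eps with (B' * (eps / B')) by (field; lra). nra.
    + intros y Hy Hp. assert (0 < exp (k * y)) by pos.
      assert (0 < f y) by nra. assert (df y <= - k * f y) by (apply H; lra). nra.
Qed.

(** The rate k replaces an initial condition at -oo; after T it is enough that f does not increase
    where it is positive. *)
Lemma bounded_decay_nonpos_global (f df : R -> R) (k B T : R) :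
  (forall x, is_derive f x (df x)) -> 0 < k ->
  (forall x, x <= T -> f x <= B) ->
  (forall x, x <= T -> 0 < f x -> df x <= - k * f x) ->
  (forall x, T <= x -> 0 < f x -> df x <= 0) -> forall t, f t <= 0.
Proof.
  intros Hd Hk HB H1 H2.
  assert (Hl : forall t, t <= T -> f t <= 0).
  { intros t Ht. apply (bounded_decay_nonpos f df k B); auto.
    intros x Hx. apply HB; lra. intros x Hx. apply H1; lra. }
  intros t. destruct (Rle_lt_dec t T); auto.
  apply (nonpos_forward f df T); auto. lra. apply Hl; lra.
  intros x Hx. apply H2; lra.
Qed.

Lemma is_derive_reflect (f : R -> R) (x l : R) :
  is_derive f (- x) l -> is_derive (fun y => f (- y)) x (- l).
Proof.
  intros H. replace (- l) with (scal (-1) l).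
  - apply (is_derive_comp f (fun y => - y)); auto.
    derive_by fail. ring.
  - unfold scal; simpl; unfold mult; simpl. ring.
Qed.

(** Time reversal of [bounded_decay_nonpos]: a quantity that grows exponentially wherever it is
    positive cannot stay bounded at +oo. This is how solutions of repelling equations are
    estimated. *)
Lemma bounded_growth_nonpos (f df : R -> R) (k B t : R) :
  (forall x, is_derive f x (df x)) -> 0 < k ->
  (forall x, t <= x -> f x <= B) ->
  (forall x, t <= x -> 0 < f x -> k * f x <= df x) -> f t <= 0.
Proof.
  intros Hd Hk HB H. replace t with (- - t) by ring.
  apply (bounded_decay_nonpos (fun x => f (- x)) (fun x => - df (- x)) k B); auto.
  - intros x. apply is_derive_reflect, Hd.
  - intros x Hx. apply HB. lra.
  - intros x Hx Hp. assert (k * f (- x) <= df (- x)) by (apply H; lra). lra.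
Qed.

Lemma bounded_growth_nonpos_global (f df : R -> R) (k B T : R) :
  (forall x, is_derive f x (df x)) -> 0 < k ->
  (forall x, T <= x -> f x <= B) ->
  (forall x, 0 < f x -> k * f x <= df x) -> forall t, f t <= 0.
Proof.
  intros Hd Hk HB H t. replace t with (- - t) by ring.
  apply (bounded_decay_nonpos_global (fun x => f (- x)) (fun x => - df (- x)) k B (-T)); auto.
  - intros x. apply is_derive_reflect, Hd.
  - intros x Hx. apply HB. lra.
  - intros x Hx Hp. specialize (H (-x) Hp). lra.
  - intros x Hx Hp. specialize (H (-x) Hp). nra.
Qed.

(** Lets a single barrier argument, carried out with a sign sg, bound an absolute value. *)
Lemma Rabs_le_sign (x B : R) : (forall sg, sg = 1 \/ sg = -1 -> sg * x <= B) -> Rabs x <= B.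
Proof.
  intros H. assert (H1 := H 1 (or_introl eq_refl)). assert (H2 := H (-1) (or_intror eq_refl)).
  apply Rabs_le. lra.
Qed.

Lemma sign_mul_range (sg x B : R) : sg = 1 \/ sg = -1 -> Rabs x <= B -> - B <= sg * x <= B.
Proof. intros [-> | ->] H; apply Rabs_le_between in H; lra. Qed.

(** * Linear scalar equations *)

Lemma continuity_pt_ext_val (f g : R -> R) (x : R) :
  (forall y, f y = g y) -> continuity_pt f x -> continuity_pt g x.
Proof.
  intros H Hc eps Heps. destruct (Hc eps Heps) as [d [Hd Hd']].
  exists d. split; auto. intros y Hy. rewrite <- !H. now apply Hd'.
Qed.

Lemma continuity_pt_Rmin (f : R -> R) (c x : R) :
  continuity_pt f x -> continuity_pt (fun y => Rmin (f y) c) x.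
Proof.
  intros H.
  apply (continuity_pt_ext_val (fun y => (f y + c - Rabs (f y - c)) * / 2)).
  - intros y. unfold Rmin. destruct (Rle_dec (f y) c).
    + rewrite Rabs_left1 by lra. field.
    + rewrite Rabs_right by lra. field.
  - apply (continuity_pt_mult (fun y => f y + c - Rabs (f y - c)) (fun _ => / 2)).
    2: apply continuity_pt_const; intros ? ?; reflexivity.
    apply (continuity_pt_minus (fun y => f y + c) (fun y => Rabs (f y - c))).
    + apply (continuity_pt_plus f (fun _ => c)); auto.
      apply continuity_pt_const; intros ? ?; reflexivity.
    + apply (continuity_pt_comp (fun y => f y - c) Rabs).
      * apply (continuity_pt_minus f (fun _ => c)); auto.
        apply continuity_pt_const; intros ? ?; reflexivity.
      * apply Rcontinuity_abs.
Qed.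

Lemma continuity_pt_exp_comp (f : R -> R) (x : R) :
  continuity_pt f x -> continuity_pt (fun y => exp (f y)) x.
Proof.
  intros H. apply (continuity_pt_comp f exp); auto.
  apply derivable_continuous_pt, derivable_pt_exp.
Qed.

Lemma continuity_pt_ln_comp (f : R -> R) (x : R) :
  0 < f x -> continuity_pt f x -> continuity_pt (fun y => ln (f y)) x.
Proof.
  intros Hp H. apply (continuity_pt_comp f ln); auto.
  apply derivable_continuous_pt. exists (/ f x). now apply derivable_pt_lim_ln.
Qed.

Lemma continuity_pt_neg_comp (f : R -> R) (x : R) :
  continuity_pt f (- x) -> continuity_pt (fun y => f (- y)) x.
Proof.
  intros H. apply (continuity_pt_comp (fun y => - y) f); auto.
  apply (continuity_pt_opp (fun y => y)), derivable_continuous_pt, derivable_pt_id.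
Qed.

Ltac cont_step tac :=
  lazymatch goal with
  | |- continuity_pt (fun _ => ?c) _ => apply (continuity_pt_const (fun _ => c)); intros ? ?; reflexivity
  | |- continuity_pt (fun y => y) _ => apply derivable_continuous_pt, derivable_pt_id
  | |- continuity_pt (fun y => @?f y + @?g y) _ => apply (continuity_pt_plus f g); cont_step tac
  | |- continuity_pt (fun y => @?f y - @?g y) _ => apply (continuity_pt_minus f g); cont_step tac
  | |- continuity_pt (fun y => - @?f y) _ => apply (continuity_pt_opp f); cont_step tac
  | |- continuity_pt (fun y => @?f y * @?g y) _ => apply (continuity_pt_mult f g); cont_step tac
  | |- continuity_pt (fun y => @?f y / @?g y) _ => apply (continuity_pt_div f g); [cont_step tac|cont_step tac|]
  | |- continuity_pt (fun y => / @?f y) _ => apply (continuity_pt_inv f); [cont_step tac|]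
  | |- continuity_pt (fun y => Rmin (@?f y) ?c) _ => apply (continuity_pt_Rmin f c); cont_step tac
  | |- continuity_pt (fun y => exp (@?f y)) _ => apply (continuity_pt_exp_comp f); cont_step tac
  | |- continuity_pt (fun y => ln (@?f y)) _ => apply (continuity_pt_ln_comp f); [|cont_step tac]
  | |- continuity_pt ?F ?x =>
      first [ match goal with H : forall _, continuity_pt ?G _ |- _ => unify F G; apply H end
            | match goal with H : forall _, is_derive ?G _ _ |- _ =>
                unify F G; exact (is_derive_cont _ _ _ (H x)) end
            | match goal with H : continuity_pt ?G ?y |- _ => unify F G; unify x y; exact H end
            | tac ]
  end.

Lemma primitive_exists (f : R -> R) :
  (forall x, continuity_pt f x) -> exists F : R -> R, forall x, is_derive F x (f x).
Proof.
  intros Hc. exists (fun x => RInt f 0 x). intros x.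
  apply (is_derive_RInt f (fun y => RInt f 0 y) 0 x).
  - apply filter_forall. intros y. apply (RInt_correct (V := R_CompleteNormedModule)).
    apply (ex_RInt_continuous (V := R_CompleteNormedModule)).
    intros z _. now apply continuity_pt_filterlim.
  - now apply continuity_pt_filterlim.
Qed.

(** No improper integral is formed. G - E is nonincreasing and G + E nondecreasing, so the supremum
    L of G - E lies between G x - E x and G x + E x for every x <= T, and plays the role of the
    value of G at -oo. *)
Lemma primitive_from_minf (f E e : R -> R) (T : R) :
  (forall x, continuity_pt f x) ->
  (forall x, is_derive E x (e x)) -> (forall x, x <= T -> Rabs (f x) <= e x) ->
  (forall x, x <= T -> 0 <= E x) ->
  exists F : R -> R, (forall x, is_derive F x (f x)) /\ (forall x, x <= T -> Rabs (F x) <= E x).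
Proof.
  intros Hc HE He HE0.
  destruct (primitive_exists f Hc) as [G HG].
  assert (Hup : forall s t, s <= t -> t <= T -> G s + E s <= G t + E t).
  { intros s t Hst HtT.
    apply (derive_nondecreasing (fun x => G x + E x) (fun x => f x + e x)); auto.
    - intros z _. derive_by fail. ring.
    - intros z Hz. assert (H1 : Rabs (f z) <= e z) by (apply He; lra).
      apply Rabs_le_between in H1. lra. }
  assert (Hdn : forall s t, s <= t -> t <= T -> G t - E t <= G s - E s).
  { intros s t Hst HtT.
    apply (derive_nonincreasing (fun x => G x - E x) (fun x => f x - e x)); auto.
    - intros z _. derive_by fail. ring.
    - intros z Hz. assert (H1 : Rabs (f z) <= e z) by (apply He; lra).
      apply Rabs_le_between in H1. lra. }
  destruct (completeness (fun y => exists x, x <= T /\ y = G x - E x)) as [L [Hub Hlub]].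
  - exists (G T + E T). intros y [x [Hx ->]].
    assert (H1 := Hup x T Hx (Rle_refl _)). assert (H2 := HE0 x Hx). lra.
  - exists (G T - E T). exists T. split; [lra|auto].
  - exists (fun x => G x - L). split.
    + intros x. derive_by fail. ring.
    + intros x Hx. apply Rabs_le. split.
      * enough (L <= G x + E x) by lra. apply Hlub. intros y [z [Hz ->]].
        assert (H2 := HE0 x Hx). assert (H3 := HE0 z Hz).
        destruct (Rle_lt_dec z x) as [Hzx|Hzx].
        -- assert (H1 := Hup z x Hzx Hx). lra.
        -- assert (H1 := Hdn x z (Rlt_le _ _ Hzx) Hz). lra.
      * assert (G x - E x <= L) by (apply Hub; exists x; auto). lra.
Qed.

(** Variation of constants from -oo. With K a primitive of k, the integrand f e^(-K) is dominated by
    the derivative of F / k0 e^(-K), which is the majorant that [primitive_from_minf] asks for. *)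
Lemma linear_ode_from_minf (k f : R -> R) (k0 F T : R) :
  (forall x, continuity_pt k x) -> (forall x, continuity_pt f x) -> 0 < k0 ->
  (forall x, x <= T -> k x <= - k0) -> (forall x, x <= T -> Rabs (f x) <= F) ->
  exists y : R -> R, (forall x, is_derive y x (k x * y x + f x)) /\
            (forall x, x <= T -> Rabs (y x) <= F / k0).
Proof.
  intros Hk Hf Hk0 Hkb Hfb.
  destruct (primitive_exists k Hk) as [K HK].
  assert (HF : 0 <= F) by (specialize (Hfb T (Rle_refl _)); assert (H := Rabs_pos (f T)); lra).
  destruct (primitive_from_minf (fun x => f x * exp (- K x)) (fun x => F / k0 * exp (- K x))
              (fun x => F / k0 * (- k x * exp (- K x))) T) as [G [HG HGb]].
  - intros x. cont_step fail.
  - intros x. derive_by fail. ring.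
  - intros x Hx. rewrite Rabs_mult, (Rabs_right (exp _)) by (left; apply exp_pos).
    assert (H0 := exp_pos (- K x)). specialize (Hkb x Hx).
    rewrite <- Rmult_assoc. apply Rmult_le_compat_r; [lra|].
    apply Rle_trans with F; auto.
    apply Rle_trans with (F / k0 * k0). right; field; lra.
    apply Rmult_le_compat_l; [|lra]. now apply Rdiv_le_0_compat.
  - intros x _. apply Rmult_le_pos. now apply Rdiv_le_0_compat. left; apply exp_pos.
  - exists (fun x => exp (K x) * G x). split.
    + intros x. derive_by fail.
      assert (E : exp (K x) * exp (- K x) = 1) by (rewrite <- exp_plus, Rplus_opp_r; apply exp_0).
      replace (f x) with (f x * (exp (K x) * exp (- K x))) at 2 by (rewrite E; ring). ring.
    + intros x Hx. rewrite Rabs_mult, (Rabs_right (exp _)) by (left; apply exp_pos).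
      apply Rle_trans with (exp (K x) * (F / k0 * exp (- K x))).
      apply Rmult_le_compat_l; [left; apply exp_pos | auto].
      right. rewrite exp_Ropp. field. repeat split; apply Rgt_not_eq; first [exact Hk0 | apply exp_pos].
Qed.

(** The function y e^(-K), with K a primitive of k, is strictly increasing, so nonnegativity near
    -oo propagates as strict positivity. *)
Lemma linear_ode_pos (k f y : R -> R) (T : R) :
  (forall x, continuity_pt k x) -> (forall x, is_derive y x (k x * y x + f x)) ->
  (forall x, 0 < f x) -> (forall x, x <= T -> 0 <= y x) -> forall x, 0 < y x.
Proof.
  intros Hk Hy Hf HT x.
  destruct (primitive_exists k Hk) as [K HK].
  set (s := Rmin T x - 1).
  assert (Hs : s < x) by (unfold s; assert (H := Rmin_r T x); lra).
  assert (HsT : s <= T) by (unfold s; assert (H := Rmin_l T x); lra).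
  destruct (MVT_gen (fun x => y x * exp (- K x)) s x (fun x => f x * exp (- K x))) as [z [_ E]].
  - intros z _. derive_by fail. ring.
  - intros z _. cont_step fail.
  - assert (0 < f z * exp (- K z)) by (apply Rmult_lt_0_compat; [auto | apply exp_pos]).
    assert (0 <= y s * exp (- K s)) by (apply Rmult_le_pos; [auto | left; apply exp_pos]).
    assert (0 < exp (- K x)) by pos. nra.
Qed.

Lemma linear_ode_nonneg (k f y : R -> R) (k0 B T : R) :
  (forall x, is_derive y x (k x * y x + f x)) -> (forall x, 0 < f x) -> 0 < k0 ->
  (forall x, x <= T -> k x <= - k0) -> (forall x, x <= T -> Rabs (y x) <= B) ->
  forall x, x <= T -> 0 <= y x.
Proof.
  intros Hy Hf Hk0 Hk HB x Hx. enough (- y x <= 0) by lra.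
  apply (bounded_decay_nonpos (fun x => - y x) (fun x => - (k x * y x + f x)) k0 B); auto.
  - intros z. derive_by fail. reflexivity.
  - intros z Hz. assert (H := HB z ltac:(lra)). apply Rabs_le_between in H. lra.
  - intros z Hz Hp. specialize (Hf z). assert (k z <= - k0) by (apply Hk; lra). nra.
Qed.

(** * Fixed points and comparison on the whole line *)

Lemma half_pow_small (C eps : R) : 0 < eps -> exists j, C * (/ 2) ^ j < eps.
Proof.
  intros He.
  destruct (pow_lt_1_zero (/ 2) ltac:(rewrite Rabs_right; lra) (eps / (Rabs C + 1))) as [N HN].
  { apply Rdiv_lt_0_compat; auto. assert (H := Rabs_pos C). lra. }
  exists N. specialize (HN N (Nat.le_refl _)).
  assert (Hp : 0 < (/ 2) ^ N) by (apply pow_lt; lra).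
  rewrite Rabs_right in HN by lra.
  assert (H := Rabs_pos C). assert (H1 := Rle_abs C).
  apply Rle_lt_trans with ((Rabs C + 1) * (/ 2) ^ N). nra.
  apply Rlt_le_trans with ((Rabs C + 1) * (eps / (Rabs C + 1))).
  apply Rmult_lt_compat_l; lra. right; field. lra.
Qed.

Lemma le_of_half_pow (x y C : R) : (forall j, x <= y + C * (/ 2) ^ j) -> x <= y.
Proof.
  intros H. apply Rnot_lt_le. intros Hlt.
  destruct (half_pow_small C (x - y)) as [j Hj]; [lra|]. specialize (H j). lra.
Qed.

Lemma continuity_pt_limit (x : R -> R) (s : nat -> R -> R) (w : R -> R) (C t : R) :
  continuity_pt w t -> (forall j, continuity_pt (s j) t) ->
  (forall j y, Rabs (x y - s j y) <= C * (/ 2) ^ j * w y) -> continuity_pt x t.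
Proof.
  intros Hw Hs Hx eps Heps.
  destruct (Hw 1 ltac:(lra)) as [d1 [Hd1 Hw1]].
  destruct (half_pow_small (Rabs C * (Rabs (w t) + 1)) (eps / 4)) as [j Hj]; [lra|].
  destruct (Hs j (eps / 4) ltac:(lra)) as [d2 [Hd2 Hs2]].
  exists (Rmin d1 d2). split. now apply Rmin_pos.
  intros y [Hy1 Hy2]. simpl in *.
  assert (H1 : Rabs (w y - w t) < 1).
  { apply Hw1. split; auto. assert (Hm := Rmin_l d1 d2). lra. }
  assert (H2 : Rabs (s j y - s j t) < eps / 4).
  { apply Hs2. split; auto. assert (Hm := Rmin_r d1 d2). lra. }
  assert (Hp : 0 < (/ 2) ^ j) by (apply pow_lt; lra).
  assert (Hb : forall z, Rabs (w z) <= Rabs (w t) + 1 -> Rabs (x z - s j z) < eps / 4).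
  { intros z Hz. apply Rle_lt_trans with (Rabs C * (Rabs (w t) + 1) * (/ 2) ^ j); auto.
    eapply Rle_trans; [apply Hx|]. eapply Rle_trans; [apply Rle_abs|].
    rewrite !Rabs_mult, (Rabs_right ((/ 2) ^ j)) by lra.
    assert (Hc := Rabs_pos C).
    replace (Rabs C * (Rabs (w t) + 1) * (/ 2) ^ j) with (Rabs C * (/ 2) ^ j * (Rabs (w t) + 1)) by ring.
    apply Rmult_le_compat_l; auto. apply Rmult_le_pos; lra. }
  assert (H3 : Rabs (x t - s j t) < eps / 4) by (apply Hb; lra).
  assert (H4 : Rabs (x y - s j y) < eps / 4).
  { apply Hb. replace (w y) with ((w y - w t) + w t) by ring.
    eapply Rle_trans; [apply Rabs_triang|]. lra. }
  apply Rabs_def2 in H2; apply Rabs_def2 in H3; apply Rabs_def2 in H4.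
  apply Rabs_def1; lra.
Qed.

(** Banach's fixed point theorem for the sup norm with weight 1 / w. Only the first step from x0 has
    to be of finite size; completeness is obtained from pointwise limits together with the
    closedness of X under geometric convergence. *)
Lemma weighted_fixpoint (X : (R -> R) -> Prop) (T : (R -> R) -> R -> R) (w x0 : R -> R) (d0 : R) :
  X x0 -> (forall x, X x -> X (T x)) ->
  0 <= d0 -> (forall t, 0 < w t) -> (forall t, Rabs (T x0 t - x0 t) <= d0 * w t) ->
  (forall x y d, X x -> X y -> 0 <= d -> (forall t, Rabs (x t - y t) <= d * w t) ->
     forall t, Rabs (T x t - T y t) <= d / 2 * w t) ->
  (forall x (s : nat -> R -> R) C, (forall j, X (s j)) ->
     (forall j t, Rabs (x t - s j t) <= C * (/ 2) ^ j * w t) -> X x) ->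
  exists x, X x /\ forall t, T x t = x t.
Proof.
  intros HX0 HXT Hd0 Hw Hst Hcon Hcl.
  set (s := fun j => Nat.iter j T x0).
  assert (HXs : forall j, X (s j)) by (intros j; induction j; simpl; auto).
  assert (Hs1 : forall j t, Rabs (s (S j) t - s j t) <= d0 * (/ 2) ^ j * w t).
  { induction j; intros t.
    - simpl. rewrite Rmult_1_r. apply Hst.
    - replace (d0 * (/ 2) ^ S j * w t) with ((d0 * (/ 2) ^ j) / 2 * w t) by (simpl; field).
      apply (Hcon (s (S j)) (s j)); auto.
      apply Rmult_le_pos; auto. left; apply pow_lt; lra. }
  assert (Hs2 : forall j m t, Rabs (s (m + j)%nat t - s j t) <= 2 * d0 * (/ 2) ^ j * w t).
  { intros j m t.
    enough (H : Rabs (s (m + j)%nat t - s j t) <= 2 * d0 * (/ 2) ^ j * (1 - (/ 2) ^ m) * w t).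
    { eapply Rle_trans; [apply H|]. specialize (Hw t).
      apply Rmult_le_compat_r; [lra|]. rewrite <- (Rmult_1_r (2 * d0 * (/ 2) ^ j)) at 2.
      assert (0 < (/ 2) ^ j) by (apply pow_lt; lra). assert (0 < (/ 2) ^ m) by (apply pow_lt; lra).
      apply Rmult_le_compat_l; [|lra]. apply Rmult_le_pos; lra. }
    induction m.
    - simpl. rewrite Rminus_diag, Rabs_R0. right; ring.
    - replace (s (S m + j)%nat t - s j t)
        with ((s (S (m + j)) t - s (m + j)%nat t) + (s (m + j)%nat t - s j t)) by (simpl; ring).
      eapply Rle_trans; [apply Rabs_triang|].
      eapply Rle_trans; [apply Rplus_le_compat; [apply Hs1 | apply IHm]|].
      right. rewrite pow_add. simpl. field. }
  assert (Hcv : forall t, {l | Un_cv (fun j => s j t) l}).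
  { intros t. apply Rcomplete.R_complete. intros eps Heps.
    destruct (half_pow_small (2 * d0 * w t) (eps / 2)) as [N HN]; [lra|].
    assert (Hb : forall m, (m >= N)%nat -> Rabs (s m t - s N t) < eps / 2).
    { intros m Hm. replace m with ((m - N) + N)%nat by lia.
      eapply Rle_lt_trans; [apply Hs2|].
      replace (2 * d0 * (/ 2) ^ N * w t) with (2 * d0 * w t * (/ 2) ^ N) by ring. auto. }
    exists N. intros m m' Hm Hm'.
    assert (H1 := Hb m Hm). assert (H2 := Hb m' Hm').
    apply Rabs_def2 in H1; apply Rabs_def2 in H2. apply Rabs_def1; lra. }
  set (x := fun t => proj1_sig (Hcv t)).
  assert (Hx : forall j t, Rabs (x t - s j t) <= 2 * d0 * (/ 2) ^ j * w t).
  { intros j t. unfold x. destruct (Hcv t) as [l Hl]; simpl.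
    apply Rnot_lt_le. intros Hlt.
    destruct (Hl (Rabs (l - s j t) - 2 * d0 * (/ 2) ^ j * w t)) as [N HN]; [lra|].
    specialize (HN (N + j)%nat ltac:(lia)). unfold R_dist in HN.
    assert (H1 := Hs2 j N t).
    assert (H2 := Rabs_triang (l - s (N + j)%nat t) (s (N + j)%nat t - s j t)).
    replace (l - s (N + j)%nat t + (s (N + j)%nat t - s j t)) with (l - s j t) in H2 by ring.
    rewrite Rabs_minus_sym in HN. lra. }
  assert (HXx : X x) by (apply (Hcl x s (2 * d0)); auto).
  exists x. split; auto. intros t.
  enough (Rabs (T x t - x t) <= 0).
  { assert (H1 := Rabs_pos (T x t - x t)).
    assert (H2 : Rabs (T x t - x t) = 0) by lra.
    destruct (Req_dec (T x t - x t) 0) as [|Hne]; [lra|]. apply Rabs_no_R0 in Hne. contradiction. }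
  apply (le_of_half_pow _ _ (2 * d0 * w t)). intros j.
  assert (H1 : Rabs (T x t - s (S j) t) <= (2 * d0 * (/ 2) ^ j) / 2 * w t).
  { apply (Hcon x (s j)); auto.
    assert (0 < (/ 2) ^ j) by (apply pow_lt; lra). apply Rmult_le_pos; lra. }
  assert (H2 := Hx (S j) t). simpl pow in H2.
  replace (T x t - x t) with ((T x t - s (S j) t) + (s (S j) t - x t)) by ring.
  eapply Rle_trans; [apply Rabs_triang|]. rewrite (Rabs_minus_sym (s (S j) t)). lra.
Qed.

(** A nonnegative primitive W of the forcing is a supersolution. The damping nu near -oo stands for
    the missing initial condition. *)
Lemma comparison_from_minf (D dD W w : R -> R) (nu B T : R) :
  (forall t, is_derive D t (dD t)) -> (forall t, is_derive W t (w t)) ->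
  (forall t, 0 <= W t) -> 0 < nu -> (forall t, t <= T -> D t <= B) ->
  (forall t, t <= T -> 0 < D t -> dD t <= w t - nu * D t) ->
  (forall t, 0 < D t -> dD t <= w t) -> forall t, D t <= W t.
Proof.
  intros HD HW HW0 Hnu HB H1 H2 t.
  enough (D t - W t <= 0) by lra.
  apply (bounded_decay_nonpos_global (fun t => D t - W t) (fun t => dD t - w t) nu B T); auto.
  - intros x. derive_by fail. reflexivity.
  - intros x Hx. specialize (HB x Hx). specialize (HW0 x). lra.
  - intros x Hx Hp. specialize (HW0 x). specialize (H1 x Hx ltac:(lra)). nra.
  - intros x Hx Hp. specialize (HW0 x). specialize (H2 x ltac:(lra)). lra.
Qed.

(** * Elementary estimates for exp and ln *)

Lemma exp_le (x y : R) : x <= y -> exp x <= exp y.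
Proof. intros [H| ->]; [left; now apply exp_increasing | right; auto]. Qed.

Lemma exp_ge_1_plus (x : R) : 1 + x <= exp x.
Proof.
  destruct (Req_dec x 0) as [->|H]. rewrite exp_0; lra. left; now apply exp_ineq1.
Qed.

Lemma exp_le_linear (x : R) : 0 <= x <= 1 / 2 -> exp x <= 1 + 2 * x.
Proof.
  intros H. assert (H1 := exp_ge_1_plus (- x)).
  assert (E : exp x * exp (- x) = 1) by (rewrite <- exp_plus, Rplus_opp_r; apply exp_0).
  assert (exp x * (1 - x) <= 1) by nra.
  assert (1 <= (1 + 2 * x) * (1 - x)) by nra.
  apply (Rmult_le_reg_r (1 - x)); lra.
Qed.

Lemma exp_sub_le (x y : R) : Rabs (exp x - exp y) <= Rmax (exp x) (exp y) * Rabs (x - y).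
Proof.
  enough (H : forall x y, y <= x -> Rabs (exp x - exp y) <= Rmax (exp x) (exp y) * Rabs (x - y)).
  { destruct (Rle_dec y x). now apply H.
    rewrite Rabs_minus_sym, (Rabs_minus_sym x), Rmax_comm. apply H; lra. }
  clear x y. intros x y H. assert (H1 := exp_le y x H).
  rewrite (Rabs_right (exp x - _)), (Rabs_right (x - y)), Rmax_left by lra.
  assert (H2 := exp_ge_1_plus (y - x)). assert (H3 := exp_pos x).
  replace (exp y) with (exp x * exp (y - x)) by (rewrite <- exp_plus; f_equal; ring). nra.
Qed.

Lemma ln_sub_le (x y l : R) : 0 < l -> l <= x -> l <= y -> Rabs (ln x - ln y) <= Rabs (x - y) / l.
Proof.
  intros Hl. enough (H : forall x y, l <= y -> y <= x -> Rabs (ln x - ln y) <= Rabs (x - y) / l).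
  { intros Hx Hy. destruct (Rle_dec y x). now apply H.
    rewrite Rabs_minus_sym, (Rabs_minus_sym x). apply H; lra. }
  clear x y. intros x y H H'.
  assert (ln y <= ln x) by (destruct H' as [H'| ->]; [left; apply ln_increasing; lra|lra]).
  rewrite !Rabs_right by lra.
  assert (H2 := exp_ge_1_plus (ln x - ln y)).
  replace (exp (ln x - ln y)) with (x / y) in H2.
  2: { unfold Rminus. rewrite exp_plus, exp_Ropp, !exp_ln by lra. reflexivity. }
  apply Rle_trans with ((x - y) / y).
  { replace ((x - y) / y) with (x / y - 1) by (field; lra). lra. }
  apply Rmult_le_compat_l. lra. apply Rinv_le_contravar; lra.
Qed.

Lemma inv_sub_ge_ln (x y : R) : 0 < x -> 0 < y -> (ln x - ln y) / x <= / y - / x.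
Proof.
  intros Hx Hy. assert (H2 := exp_ge_1_plus (ln x - ln y)).
  replace (exp (ln x - ln y)) with (x / y) in H2.
  2: { unfold Rminus. rewrite exp_plus, exp_Ropp, !exp_ln by lra. reflexivity. }
  replace (/ y - / x) with ((x / y - 1) / x) by (field; lra).
  apply Rmult_le_compat_r. pos. lra.
Qed.

(** * The variable s driven by r *)

Section SlowVariable.
Variables lam be rl rh La gh n ga : R.
Hypotheses (Hlam : 0 < lam) (Hbe : 0 < be) (Hrl : 0 < rl).
Hypothesis HLa : forall x, rl <= x <= rh -> - La <= ln x <= La.
Hypotheses (Hn : 0 < n) (Hn1 : n <= 1) (HnLa : n * La <= 1 / 4).
Hypotheses (Hga : 0 < ga) (Hgah : ga <= gh) (Hnga : n / (lam * rl) <= ga / 2).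

(** Three constants independent of n: n [gain_s] bounds the deviation of s from ga / be, n [gain_y]
    is the response of ln y to r, and n [gain_ds] that of s to r. *)
Definition gain_s : R := (4 * La * gh + 1 / (lam * rl)) / be.
Definition gain_y : R := 2 * be * gain_s + gh.
Definition gain_ds : R := (gh / be + gain_s) * (1 / rl + gain_y).

(* For the variable y = r^n / s the equation of s becomes linear once r is given; the solution bounded
   at -oo is the one that keeps s near ga / be. *)
Set Implicit Arguments.
Record y_driven (r y : R -> R) : Prop := {
  yd_range : forall t, rl <= r t <= rh;
  yd_pos : forall t, 0 < y t;
  yd_ode : forall t, is_derive y t (be * exp ((1 + n) * ln (r t)) - y t * (ga * r t - n / lam));
  yd_bounded : exists T B, forall t, t <= T -> y t <= B }.
Unset Implicit Arguments.

Lemma La_nonneg : rl <= rh -> 0 <= La.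
Proof. intros H. specialize (HLa rl). lra. Qed.

Lemma y_coef_pos (x : R) : rl <= x -> rl * (ga / 2) <= ga * x - n / lam.
Proof.
  intros Hx. replace (n / lam) with (rl * (n / (lam * rl))) by (field; lra). nra.
Qed.

Lemma exp_pow_split (x : R) : 0 < x -> exp ((1 + n) * ln x) = x * exp (n * ln x).
Proof.
  intros Hx. replace ((1 + n) * ln x) with (ln x + n * ln x) by ring.
  now rewrite exp_plus, exp_ln.
Qed.

Lemma exp_nln_range (x : R) : rl <= x <= rh -> exp (- (n * La)) <= exp (n * ln x) <= exp (n * La).
Proof.
  intros Hx. specialize (HLa x Hx). split; apply exp_le; nra.
Qed.

(** The equation pulls y toward be r^n / (ga - n / (lam r)). The two bounds enclose this quotient
    for r in [rl, rh] and act as barriers. *)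
Lemma y_bounds (r y : R -> R) : y_driven r y -> forall t,
  be * exp (- (n * La)) / ga <= y t <= be * exp (n * La) / (ga - n / (lam * rl)).
Proof.
  intros [Hr Hp Ho [T [B HB]]].
  assert (Hnl : n / lam = rl * (n / (lam * rl))) by (field; lra).
  set (de := n / (lam * rl)) in *.
  assert (Hde : 0 < de) by pos.
  assert (Hk0 : 0 < rl * (ga / 2)) by nra.
  split.
  - set (yl := be * exp (- (n * La)) / ga).
    assert (Hc : forall x, 0 < yl - y x ->
      - (be * exp ((1 + n) * ln (r x)) - y x * (ga * r x - n / lam)) <= - (rl * (ga / 2)) * (yl - y x)).
    { intros x Hx. destruct (Hr x) as [Hx1 Hx2]. rewrite exp_pow_split by lra.
      destruct (exp_nln_range (r x) (Hr x)) as [He _].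
      assert (H1 := y_coef_pos (r x) Hx1). specialize (Hp x).
      assert (E : be * exp (- (n * La)) = yl * ga) by (unfold yl; field; lra).
      assert (be * (r x * exp (n * ln (r x))) >= r x * (yl * ga)).
      { rewrite <- E. apply Rle_ge. replace (be * (r x * exp (n * ln (r x)))) with (r x * (be * exp (n * ln (r x)))) by ring.
        apply Rmult_le_compat_l. lra. apply Rmult_le_compat_l; lra. }
      assert (0 < rl * de) by nra. rewrite Hnl in *. nra. }
    enough (yl - y t <= 0) by lra.
    apply (bounded_decay_nonpos_global (fun x => yl - y x)
      (fun x => - (be * exp ((1 + n) * ln (r x)) - y x * (ga * r x - n / lam))) (rl * (ga / 2)) yl 0); auto.
    + intros x. derive_by fail. ring.
    + intros x _. specialize (Hp x). lra.
    + intros x _ Hx. specialize (Hc x Hx). nra.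
  - set (yh := be * exp (n * La) / (ga - de)).
    assert (Hc : forall x, 0 < y x - yh ->
      be * exp ((1 + n) * ln (r x)) - y x * (ga * r x - n / lam) <= - (rl * (ga / 2)) * (y x - yh)).
    { intros x Hx. destruct (Hr x) as [Hx1 Hx2]. rewrite exp_pow_split by lra.
      destruct (exp_nln_range (r x) (Hr x)) as [_ He].
      assert (H1 := y_coef_pos (r x) Hx1).
      assert (E : be * exp (n * La) = yh * (ga - de)) by (unfold yh; field; lra).
      assert (be * (r x * exp (n * ln (r x))) <= r x * (yh * (ga - de))).
      { rewrite <- E. replace (be * (r x * exp (n * ln (r x)))) with (r x * (be * exp (n * ln (r x)))) by ring.
        apply Rmult_le_compat_l. lra. apply Rmult_le_compat_l; lra. }
      assert (0 <= yh) by pos.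
      assert (de * r x >= de * rl) by nra.
      rewrite Hnl in *. nra. }
    enough (y t - yh <= 0) by lra.
    apply (bounded_decay_nonpos_global (fun x => y x - yh)
      (fun x => be * exp ((1 + n) * ln (r x)) - y x * (ga * r x - n / lam)) (rl * (ga / 2)) (B - yh) T); auto.
    + intros x. derive_by fail. ring.
    + intros x Hx. specialize (HB x Hx). lra.
    + intros x _ Hx. specialize (Hc x Hx). nra.
Qed.

(** The point x is decoupled from r t because [ln_y_derivative_le] needs the bound at an
    intermediate point given by the mean value theorem; x = r t gives s itself. *)
Lemma s_near (r y : R -> R) (x t : R) : y_driven r y -> rl <= x <= rh ->
  Rabs (exp (n * ln x) / y t - ga / be) <= n * gain_s.
Proof.
  intros Hyd Hx. assert (HL0 : 0 <= La) by (apply La_nonneg; lra).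
  destruct (y_bounds r y Hyd t) as [H1 H2].
  destruct (exp_nln_range x Hx) as [H3 H4].
  assert (Hy : 0 < y t) by apply (yd_pos Hyd).
  assert (E : n * gain_s = (4 * (n * La) * gh + n / (lam * rl)) / be) by (unfold gain_s; field; lra).
  set (de := n / (lam * rl)) in *.
  assert (Hde : 0 < de) by pos.
  set (e := n * La) in *. assert (He : 0 <= e) by pos.
  assert (E2 : exp e * exp e <= 1 + 4 * e).
  { rewrite <- exp_plus. replace (e + e) with (2 * e) by ring.
    eapply Rle_trans; [apply exp_le_linear; lra|]. lra. }
  assert (E3 : 1 - 2 * e <= exp (- e) * exp (- e)).
  { rewrite <- exp_plus. replace (- e + - e) with (- (2 * e)) by ring.
    assert (H := exp_ge_1_plus (- (2 * e))). lra. }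
  assert (E4 : exp e * exp (- e) = 1) by (rewrite <- exp_plus, Rplus_opp_r; apply exp_0).
  assert (Hup : exp (n * ln x) / y t <= exp e * exp e * ga / be).
  { apply (proj2 (Rle_div_l _ _ (y t) Hy)).
    apply Rle_trans with (exp e * exp e * ga / be * (be * exp (- e) / ga)).
    - replace (exp e * exp e * ga / be * (be * exp (- e) / ga)) with (exp e * (exp e * exp (- e))) by (field; lra).
      rewrite E4. lra.
    - mono. }
  assert (Hlo : exp (- e) * exp (- e) * (ga - de) / be <= exp (n * ln x) / y t).
  { apply (proj1 (Rle_div_r _ _ (y t) Hy)).
    apply Rle_trans with (exp (- e) * exp (- e) * (ga - de) / be * (be * exp e / (ga - de))).
    - mono.
    - replace (exp (- e) * exp (- e) * (ga - de) / be * (be * exp e / (ga - de)))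
        with (exp (- e) * (exp e * exp (- e))) by (field; lra).
      rewrite E4. lra. }
  rewrite E. apply Rabs_le. split.
  - apply Rle_trans with (exp (- e) * exp (- e) * (ga - de) / be - ga / be); [|lra].
    replace (- ((4 * e * gh + de) / be)) with ((- (4 * e * gh + de)) / be) by (field; lra).
    replace (exp (- e) * exp (- e) * (ga - de) / be - ga / be)
      with ((exp (- e) * exp (- e) * (ga - de) - ga) / be) by (field; lra).
    apply Rmult_le_compat_r. pos.
    assert ((1 - 2 * e) * (ga - de) <= exp (- e) * exp (- e) * (ga - de)) by mono.
    assert (0 <= e * de) by nra. nra.
  - apply Rle_trans with (exp e * exp e * ga / be - ga / be); [lra|].
    replace (exp e * exp e * ga / be - ga / be) with ((exp e * exp e * ga - ga) / be) by (field; lra).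
    apply Rmult_le_compat_r. pos. nra.
Qed.

Lemma exp_pow_mvt (x x' : R) : rl <= x <= rh -> rl <= x' <= rh ->
  exists z, rl <= z <= rh /\
  exp ((1 + n) * ln x) - exp ((1 + n) * ln x') = (1 + n) * exp (n * ln z) * (x - x').
Proof.
  intros Hx Hx'.
  assert (Hm : rl <= Rmin x' x /\ Rmax x' x <= rh).
  { split; [apply Rmin_glb | apply Rmax_lub]; lra. }
  destruct (MVT_gen (fun z => exp ((1 + n) * ln z)) x' x (fun z => (1 + n) * exp (n * ln z))) as [z [Hz E]].
  - intros z Hz. derive_by fail. lra. rewrite exp_pow_split by lra. field. lra.
  - intros z Hz. cont_step fail. lra.
  - exists z. split; [lra|exact E].
Qed.

Lemma gain_s_nonneg : rl <= rh -> 0 <= gain_s.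
Proof.
  intros H. apply La_nonneg in H. apply Rdiv_le_0_compat; auto.
  assert (0 < 1 / (lam * rl)) by pos. nra.
Qed.

(** In the difference of the logarithmic derivatives, the factor of r - r' is be (1 + n) z^n / y' -
    ga, which is O(n) by [s_near]: this cancellation is the source of every small gain of s. The
    remaining term, be r^(1 + n) (1 / y' - 1 / y), is a damping of ln y - ln y'. *)
Lemma ln_y_derivative_le (r r' y y' : R -> R) (t : R) :
  y_driven r y -> y_driven r' y' -> 0 < ln (y t) - ln (y' t) ->
  (be * exp ((1 + n) * ln (r t)) - y t * (ga * r t - n / lam)) * / y t
    - (be * exp ((1 + n) * ln (r' t)) - y' t * (ga * r' t - n / lam)) * / y' t
  <= n * gain_y * Rabs (r t - r' t) - rl * ga / 4 * (ln (y t) - ln (y' t)).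
Proof.
  intros Hy Hy' Ht.
  assert (Hrr : rl <= rh) by (destruct (yd_range Hy 0); lra). assert (HS0 := gain_s_nonneg Hrr).
  destruct (exp_pow_mvt (r t) (r' t) (yd_range Hy t) (yd_range Hy' t)) as [z [Hz E]].
  assert (Hs := s_near r' y' z t Hy' Hz).
  assert (Hy0 := yd_pos Hy t). assert (Hy0' := yd_pos Hy' t).
  match goal with |- ?X <= _ =>
    replace X with (be * (exp ((1 + n) * ln (r t)) - exp ((1 + n) * ln (r' t))) / y' t
      - ga * (r t - r' t) - be * exp ((1 + n) * ln (r t)) * (/ y' t - / y t)) by (field; lra) end.
  rewrite E.
  replace (be * ((1 + n) * exp (n * ln z) * (r t - r' t)) / y' t - ga * (r t - r' t))
    with ((be * (1 + n) * (exp (n * ln z) / y' t - ga / be) + n * ga) * (r t - r' t)) by (field; lra).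
  assert (H1 : (be * (1 + n) * (exp (n * ln z) / y' t - ga / be) + n * ga) * (r t - r' t)
               <= n * gain_y * Rabs (r t - r' t)).
  { eapply Rle_trans; [apply Rle_abs|]. rewrite Rabs_mult.
    apply Rmult_le_compat_r; [apply Rabs_pos|].
    eapply Rle_trans; [apply Rabs_triang|].
    rewrite Rabs_mult, (Rabs_right (be * (1 + n))), (Rabs_right (n * ga)) by nra.
    unfold gain_y.
    apply Rle_trans with (be * (1 + n) * (n * gain_s) + n * ga).
    { apply Rplus_le_compat_r. apply Rmult_le_compat_l; nra. }
    assert (0 <= n * gain_s * be) by pos. nra. }
  assert (H2 : rl * ga / 4 * (ln (y t) - ln (y' t)) <= be * exp ((1 + n) * ln (r t)) * (/ y' t - / y t)).
  { destruct (yd_range Hy t) as [R1 R2]. rewrite exp_pow_split by lra.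
    destruct (exp_nln_range (r t) (yd_range Hy t)) as [X1 _].
    destruct (y_bounds r y Hy t) as [_ Y2].
    set (D := ln (y t) - ln (y' t)) in *.
    assert (Hgd : 0 < ga - n / (lam * rl)) by lra.
    set (w := exp (n * ln (r t))) in *.
    assert (X0 := exp_pos (- (n * La))).
    assert (Hyh : y t * (ga / 2) <= be * exp (n * La)).
    { apply Rle_trans with (y t * (ga - n / (lam * rl))). apply Rmult_le_compat_l; lra.
      apply Rle_trans with (be * exp (n * La) / (ga - n / (lam * rl)) * (ga - n / (lam * rl))).
      apply Rmult_le_compat_r; lra. set (x := ga - n / (lam * rl)) in *. right; field. lra. }
    (* From n La <= 1 / 4: e^(-2 n La) >= 1 - 2 n La >= 1 / 2. *)
    assert (Hee : exp (n * La) * / 2 <= exp (- (n * La))).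
    { assert (E1 : exp (n * La) * exp (- (n * La)) = 1) by (rewrite <- exp_plus, Rplus_opp_r; apply exp_0).
      assert (E2 := exp_ge_1_plus (- (2 * (n * La)))).
      replace (- (2 * (n * La))) with (- (n * La) + - (n * La)) in E2 by ring. rewrite exp_plus in E2.
      apply (Rmult_le_reg_r (exp (- (n * La)))); auto. lra. }
    assert (Hkey : y t * (rl * ga / 4) <= be * (r t * w)).
    { apply Rle_trans with (be * (rl * exp (- (n * La)))).
      - assert (rl * (y t * (ga / 2) * / 2) <= rl * (be * (exp (n * La) * / 2))) by nra.
        assert (rl * be * (exp (n * La) * / 2) <= rl * be * exp (- (n * La))) by mono.
        lra.
      - mono. }
    assert (H3 := inv_sub_ge_ln (y t) (y' t) Hy0 Hy0'). fold D in H3.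
    apply Rle_trans with (be * (r t * w) * (D / y t)).
    - replace (rl * ga / 4 * D) with (y t * (rl * ga / 4) * (D / y t)) by (field; lra).
      apply Rmult_le_compat_r; auto. apply Rdiv_le_0_compat; lra.
    - mono. }
  lra.
Qed.

Lemma ln_y_bounded (r r' y y' : R -> R) : y_driven r y -> y_driven r' y' ->
  exists B, forall t, Rabs (ln (y t) - ln (y' t)) <= B.
Proof.
  intros Hy Hy'.
  assert (Hyl : 0 < be * exp (- (n * La)) / ga) by pos.
  assert (HH : forall a b, 0 < a -> a <= b -> ln a <= ln b).
  { intros a b Ha [Hab| ->]; [left; apply ln_increasing; lra|lra]. }
  eexists. intros t.
  destruct (y_bounds r y Hy t) as [L1 U1]. destruct (y_bounds r' y' Hy' t) as [L2 U2].
  apply HH in U1; [|apply (yd_pos Hy)]. apply HH in U2; [|apply (yd_pos Hy')].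
  apply HH in L1; auto. apply HH in L2; auto.
  apply Rabs_le. split.
  2: apply Rle_trans with (ln (be * exp (n * La) / (ga - n / (lam * rl))) - ln (be * exp (- (n * La)) / ga)); [lra|apply Rle_refl].
  lra.
Qed.

Lemma ln_y_compare (r r' y y' W w : R -> R) :
  y_driven r y -> y_driven r' y' -> (forall t, is_derive W t (w t)) -> (forall t, 0 <= W t) ->
  (forall t, Rabs (r t - r' t) <= w t) ->
  forall t, ln (y t) - ln (y' t) <= n * gain_y * W t.
Proof.
  intros Hy Hy' HW HW0 Hw t.
  assert (Hrr : rl <= rh) by (destruct (yd_range Hy 0); lra).
  assert (HS0 := gain_s_nonneg Hrr).
  assert (Hgy : 0 <= n * gain_y) by pos.
  assert (Hnu : 0 < rl * ga / 4) by pos.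
  assert (Hd := fun t => ln_y_derivative_le r r' y y' t Hy Hy').
  destruct (ln_y_bounded r r' y y' Hy Hy') as [B HB].
  assert (Hy0 := yd_pos Hy). assert (Hy0' := yd_pos Hy').
  assert (Ho := yd_ode Hy). assert (Ho' := yd_ode Hy').
  assert (Hgw : forall t, n * gain_y * Rabs (r t - r' t) <= n * gain_y * w t).
  { intros x. apply Rmult_le_compat_l; auto. }
  apply (comparison_from_minf (fun t => ln (y t) - ln (y' t))
     (fun t => (be * exp ((1 + n) * ln (r t)) - y t * (ga * r t - n / lam)) * / y t
       - (be * exp ((1 + n) * ln (r' t)) - y' t * (ga * r' t - n / lam)) * / y' t)
     (fun t => n * gain_y * W t) (fun t => n * gain_y * w t) (rl * ga / 4) B 0); auto.
  - intros x. derive_by fail; auto.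
  - intros x. derive_by fail. ring.
  - intros x. apply Rmult_le_pos; auto.
  - intros x _. eapply Rle_trans; [apply Rle_abs|apply HB].
  - intros x _ Hx. specialize (Hd x Hx). specialize (Hgw x). lra.
  - intros x Hx. specialize (Hd x Hx). specialize (Hgw x).
    assert (0 <= rl * ga / 4 * (ln (y x) - ln (y' x))) by pos. lra.
Qed.

(** Writing s = exp (n ln r - ln y) reduces differences of s to differences of logarithms. *)
Lemma s_sub_le (r r' y y' : R -> R) (t : R) : y_driven r y -> y_driven r' y' ->
  Rabs (exp (n * ln (r t)) / y t - exp (n * ln (r' t)) / y' t)
  <= (gh / be + gain_s) * (n * (Rabs (r t - r' t) / rl) + Rabs (ln (y t) - ln (y' t))).
Proof.
  intros Hy Hy'.
  assert (Hrr : rl <= rh) by (destruct (yd_range Hy 0); lra).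
  assert (HS0 := gain_s_nonneg Hrr).
  assert (Hr := ln_sub_le (r t) (r' t) rl Hrl (proj1 (yd_range Hy t)) (proj1 (yd_range Hy' t))).
  assert (Hx : forall r y, y_driven r y -> exp (n * ln (r t)) / y t = exp (n * ln (r t) - ln (y t))).
  { intros r1 y1 H1. unfold Rminus. rewrite exp_plus, exp_Ropp, exp_ln; auto. apply (yd_pos H1). }
  assert (Hm : forall r y, y_driven r y -> exp (n * ln (r t)) / y t <= gh / be + gain_s).
  { intros r1 y1 H1. assert (H := s_near r1 y1 (r1 t) t H1 (yd_range H1 t)).
    apply Rabs_le_between in H.
    assert (ga / be <= gh / be) by mono.
    assert (n * gain_s <= 1 * gain_s) by mono. lra. }
  assert (M1 := Hm r y Hy). assert (M2 := Hm r' y' Hy'). rewrite !Hx in * by auto.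
  eapply Rle_trans; [apply exp_sub_le|].
  apply Rmult_le_compat; auto using Rabs_pos.
  - eapply Rle_trans; [|apply Rmax_l]. left; apply exp_pos.
  - now apply Rmax_lub.
  - replace (n * ln (r t) - ln (y t) - (n * ln (r' t) - ln (y' t)))
      with (n * (ln (r t) - ln (r' t)) + - (ln (y t) - ln (y' t))) by ring.
    eapply Rle_trans; [apply Rabs_triang|]. rewrite Rabs_Ropp, Rabs_mult, (Rabs_right n) by lra.
    apply Rplus_le_compat_r, Rmult_le_compat_l; lra.
Qed.

Lemma s_compare (r r' y y' W w : R -> R) :
  y_driven r y -> y_driven r' y' -> (forall t, is_derive W t (w t)) -> (forall t, 0 <= W t <= w t) ->
  (forall t, Rabs (r t - r' t) <= w t) ->
  forall t, Rabs (exp (n * ln (r t)) / y t - exp (n * ln (r' t)) / y' t) <= n * gain_ds * w t.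
Proof.
  intros Hy Hy' HW HW0 Hw t.
  assert (Hrr : rl <= rh) by (destruct (yd_range Hy 0); lra).
  assert (HS0 := gain_s_nonneg Hrr).
  assert (Hgy : 0 <= n * gain_y) by pos.
  assert (Hl1 := ln_y_compare r r' y y' W w Hy Hy' HW (fun t => proj1 (HW0 t)) Hw t).
  assert (Hl2 : ln (y' t) - ln (y t) <= n * gain_y * W t).
  { apply (ln_y_compare r' r y' y W w); auto. intros x; apply HW0.
    intros x. rewrite Rabs_minus_sym. auto. }
  assert (Hl : Rabs (ln (y t) - ln (y' t)) <= n * gain_y * w t).
  { apply Rle_trans with (n * gain_y * W t). apply Rabs_le; lra.
    apply Rmult_le_compat_l; auto. apply HW0. }
  eapply Rle_trans; [now apply s_sub_le|].
  unfold gain_ds.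
  replace (n * ((gh / be + gain_s) * (1 / rl + gain_y)) * w t)
    with ((gh / be + gain_s) * (n * (w t / rl) + n * gain_y * w t)) by (field; lra).
  apply Rmult_le_compat_l.
  - pos.
  - apply Rplus_le_compat; auto. apply Rmult_le_compat_l; [lra|].
    apply Rmult_le_compat_r; auto. pos.
Qed.

Lemma y_driven_exists (r : R -> R) :
  (forall t, continuity_pt r t) -> (forall t, rl <= r t <= rh) -> exists y, y_driven r y.
Proof.
  intros Hc Hr.
  assert (Hk0 : 0 < rl * (ga / 2)) by nra.
  destruct (linear_ode_from_minf (fun t => - (ga * r t - n / lam)) (fun t => be * exp ((1 + n) * ln (r t)))
    (rl * (ga / 2)) (be * (rh * exp (n * La))) 0) as [y [Hy Hb]]; auto.
  - intros t. cont_step fail.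
  - intros t. cont_step fail. destruct (Hr t); lra.
  - intros t _. assert (H := y_coef_pos (r t) (proj1 (Hr t))). lra.
  - intros t _. assert (H := exp_pos ((1 + n) * ln (r t))).
    rewrite Rabs_right by nra. apply Rmult_le_compat_l; [lra|].
    destruct (Hr t). rewrite exp_pow_split by lra.
    destruct (exp_nln_range (r t) (Hr t)). assert (H4 := exp_pos (n * ln (r t))).
    apply Rmult_le_compat; lra.
  - exists y. split; auto.
    + apply (linear_ode_pos (fun t => - (ga * r t - n / lam)) (fun t => be * exp ((1 + n) * ln (r t))) y 0); auto.
      * intros t. cont_step fail.
      * intros t. assert (H := exp_pos ((1 + n) * ln (r t))). nra.
      * apply (linear_ode_nonneg (fun t => - (ga * r t - n / lam)) (fun t => be * exp ((1 + n) * ln (r t))) y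
          (rl * (ga / 2)) (be * (rh * exp (n * La)) / (rl * (ga / 2))) 0); auto.
        -- intros t. assert (H := exp_pos ((1 + n) * ln (r t))). nra.
        -- intros t _. assert (H := y_coef_pos (r t) (proj1 (Hr t))). lra.
    + intros t. eapply derive_change; [apply Hy|]. ring.
    + exists 0. eexists. intros t Ht. eapply Rle_trans; [apply Rle_abs|]. now apply Hb.
Qed.

(** The rest point of the equation of y for constant r. Comparison with it gives the decay of s - s0
    at -oo, and the limit at +oo when the constant is [r_eq1]. *)
Lemma y_driven_const (a : R) : rl <= a <= rh ->
  y_driven (fun _ => a) (fun _ => be * exp ((1 + n) * ln a) / (ga * a - n / lam)).
Proof.
  intros Ha. assert (H := y_coef_pos a (proj1 Ha)).
  assert (Hk0 : 0 < rl * (ga / 2)) by nra.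
  split; auto.
  - intros _. assert (H1 := exp_pos ((1 + n) * ln a)). apply Rdiv_lt_0_compat; nra.
  - intros t. eapply derive_change; [apply derive_cst|].
    set (x := ga * a - n / lam) in *. field. lra.
  - exists 0. eexists. intros t _. apply Rle_refl.
Qed.

Lemma s_const (a : R) : rl <= a <= rh ->
  exp (n * ln a) / (be * exp ((1 + n) * ln a) / (ga * a - n / lam)) = ga / be - n / (lam * be * a).
Proof.
  intros Ha. assert (H := y_coef_pos a (proj1 Ha)).
  assert (Hk0 : 0 < rl * (ga / 2)) by nra.
  rewrite exp_pow_split by lra. assert (H1 := exp_pos (n * ln a)).
  replace (ga / be - n / (lam * be * a)) with ((ga * a - n / lam) / (be * a)) by (field; lra).
  set (x := ga * a - n / lam) in *. field. lra.
Qed.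
End SlowVariable.

(** * Clamps, decay of e^(2t) and the weights of the contraction *)

Lemma Rmin_sub_le (x y c : R) : Rabs (Rmin x c - Rmin y c) <= Rabs (x - y).
Proof.
  unfold Rmin. destruct (Rle_dec x c), (Rle_dec y c); unfold Rabs;
    repeat destruct Rcase_abs; lra.
Qed.

Lemma exp_2t_small (C eps T : R) : 0 < eps -> exists x, x <= T /\ C * exp (2 * x) < eps.
Proof.
  intros He. set (C' := Rmax C 0 + 1).
  assert (HC : 0 < C') by (unfold C'; assert (H := Rmax_r C 0); lra).
  set (x := Rmin T (ln (eps / C') / 2)). exists x. split. apply Rmin_l.
  assert (H1 : exp (2 * x) <= eps / C').
  { rewrite <- (exp_ln (eps / C')) by (apply Rdiv_lt_0_compat; auto).
    apply exp_le. assert (H := Rmin_r T (ln (eps / C') / 2)). unfold x. lra. }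
  assert (H2 := exp_pos (2 * x)).
  apply Rlt_le_trans with (C' * exp (2 * x)).
  - apply Rmult_lt_compat_r; auto. unfold C'. assert (H := Rmax_l C 0). lra.
  - replace eps with (C' * (eps / C')) by (field; lra). apply Rmult_le_compat_l; lra.
Qed.

Lemma ln_le_compat (x y : R) : 0 < x -> x <= y -> ln x <= ln y.
Proof. intros Hx [H| ->]; [left; apply ln_increasing; lra|lra]. Qed.

Lemma ln_sub_ge (x y : R) : 0 < x -> 0 < y -> (x - y) / x <= ln x - ln y.
Proof.
  intros Hx Hy. assert (H := exp_ge_1_plus (ln y - ln x)).
  unfold Rminus in H. rewrite exp_plus, exp_Ropp, !exp_ln in H by lra.
  replace ((x - y) / x) with (1 - y * / x) by (field; lra). lra.
Qed.

(* Om is the weight of the contraction. The logarithmic derivatives of u, v and y involve |r - r'|, so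
   these variables are compared in the primitive Om1, which gains 1/K as t -> +oo. *)
Definition Om (K t : R) : R := exp (2 * t) + exp (K * t).
Definition Om1 (K t : R) : R := exp (2 * t) / 2 + exp (K * t) / K.

Lemma derive_Om1 (K t : R) : 0 < K -> is_derive (Om1 K) t (Om K t).
Proof.
  intros HK. unfold Om1, Om.
  apply (is_derive_ext (fun t => exp (2 * t) / 2 + exp (K * t) / K)); auto.
  derive_by fail; try lra. field. lra.
Qed.

Lemma derive_Om (K t : R) : is_derive (Om K) t (2 * exp (2 * t) + K * exp (K * t)).
Proof. apply (is_derive_ext (fun t => exp (2 * t) + exp (K * t))); auto.
  derive_by fail. ring.
Qed.

Lemma Om1_le_Om (K t : R) : 4 <= K -> 0 <= Om1 K t <= Om K t.
Proof.
  intros HK. unfold Om1, Om. assert (H1 := exp_pos (2 * t)). assert (H2 := exp_pos (K * t)).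
  assert (0 < exp (K * t) / K) by pos.
  assert (exp (K * t) / K <= exp (K * t)); [|lra].
  apply Rle_div_l; nra.
Qed.

(* The gain 1/K in Om1 is only available on the second exponential; the first one is
   controlled by the smallness of m for t <= 1/2 and by e^(2t) <= (2/K) e^(K t) beyond. *)
Lemma Om1_gain (K m mh ms t : R) : 4 <= K -> 0 <= m -> m <= mh -> 0 <= ms ->
  (t <= 1 / 2 -> m <= ms) -> m * Om1 K t <= (ms / 2 + 2 * mh / K) * Om K t.
Proof.
  intros HK Hm0 Hm Hms0 Hms.
  unfold Om, Om1. assert (H1 := exp_pos (2 * t)). assert (H2 := exp_pos (K * t)).
  assert (Hi : 0 < / K) by pos.
  replace (exp (K * t) / K) with (/ K * exp (K * t)) by (unfold Rdiv; ring).
  replace (2 * mh / K) with (2 * (mh * / K)) by (unfold Rdiv; ring).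
  assert (H0 : 0 <= mh * / K) by pos.
  assert (Hb : m * (/ K * exp (K * t)) <= mh * / K * exp (K * t)).
  { rewrite Rmult_assoc. apply Rmult_le_compat_r; auto. apply Rmult_le_pos; lra. }
  destruct (Rle_dec t (1 / 2)) as [Ht|Ht].
  - nra.
  - assert (E : K / 2 * exp (2 * t) <= exp (K * t)).
    { replace (K * t) with (2 * t + (K - 2) * t) by ring. rewrite exp_plus.
      assert (H3 := exp_ge_1_plus ((K - 2) * t)).
      assert (K / 2 <= exp ((K - 2) * t)) by nra. nra. }
    assert (exp (2 * t) <= 2 * / K * exp (K * t)).
    { apply Rle_trans with (2 * / K * (K / 2 * exp (2 * t))). right; field; lra.
      apply Rmult_le_compat_l; lra. }
    assert (m * exp (2 * t) <= mh * (2 * / K * exp (K * t))) by mono.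
    assert (0 <= ms * exp (K * t)) by pos.
    assert (0 <= ms * exp (2 * t)) by pos.
    assert (0 <= mh * / K * exp (2 * t)) by pos. lra.
Qed.

(** * The clamped fixed-point problem *)

Section Operator.
Variables lam be ze P Q rl rh g gh bh La : R.

(** The constants up to [pq_slope] involve neither n, nor the coefficients a, b, k, ga, Bm, nor kap
    and K. This is what allows K, kap and n to be chosen after them. *)
Definition p_max : R := (2 + rh / lam) / (lam * rl).
Definition q_max : R := 1 + bh / lam.
Definition gain_u : R := (1 + rh / lam) / rl + 1 / lam.
Definition gain_v : R := lam * p_max + 1 / lam + q_max * gain_u.
Definition gain_pq : R := (gain_u + gain_v) / rl + lam * gain_v.
(** The constant C of |r - a| <= C e^(2t). It is rh^2 times the bound of [rho_slope], because r - a
    = - r a (rho - 1 / a). *)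
Definition r_slope : R := rh * rh * (2 * (Q / rl + lam * P + 1) / g).
(** The exponential is the square of e^(2 r_slope / lam): one factor for 1 / v, the other for u. *)
Definition pq_slope : R := (1 + bh * rh) * exp (4 * r_slope / lam).

Variables n a b k ga Bm kap K : R.
Hypotheses (Hlam : 0 < lam) (Hbe : 0 < be) (Hze : 0 < ze) (HP : 0 < P) (HQ : 0 < Q).
Hypotheses (Hrl : 0 < rl) (Hg : 0 < g).
Hypothesis HLa : forall x, rl <= x <= rh -> - La <= ln x <= La.
Hypotheses (Hn : 0 < n) (Hn1 : n <= 1) (HnLa : n * La <= 1 / 4).
Hypotheses (Hga : 0 < ga) (Hgah : ga <= gh) (Hnga : n / (lam * rl) <= ga / 2).
Hypotheses (Ha : rl <= a <= rh) (Hb : 0 < b) (Hbh : b <= bh).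
Hypothesis Hkap : 0 < kap.

Set Implicit Arguments.
Record admissible (r : R -> R) : Prop := {
  ad_cont : forall t, continuity_pt r t;
  ad_range : forall t, rl <= r t <= rh;
  ad_slope : forall t, Rabs (r t - a) <= r_slope * exp (2 * t) }.
Unset Implicit Arguments.

(* For r given, u = q / p, v = 1 / p and rho = 1 / r solve linear equations; p and q are clamped at P and Q
   in the equation of rho only. A fixed point r = / rho solves (S) wherever p <= P and q <= Q. *)
Definition N_of (r y v : R -> R) (t : R) : R :=
  lam * Rmin (/ v t) P + ze * (exp (n * ln (r t)) / y t) - Bm.

Set Implicit Arguments.
(** In u' / u = q' / q - p' / p the terms lam p r + q cancel, and in v' = - p' / p^2 they become lam
    r + u. This is why both equations are linear once r is given. *)
Record driven (r y u v rho : R -> R) : Prop := {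
  dr_y : y_driven lam be rl rh n ga r y;
  dr_u_pos : forall t, 0 < u t;
  dr_v_pos : forall t, 0 < v t;
  dr_rho_pos : forall t, 0 < rho t;
  dr_u : forall t, is_derive u t (b * r t - u t * (1 + (r t - a) / lam));
  dr_v : forall t, is_derive v t (lam * r t + u t - v t * (2 + (r t - a) / lam));
  dr_rho : forall t, is_derive rho t ((rho t * (k - Rmin (u t / v t) Q) - N_of r y v t) / n);
  dr_u_bd : exists T B, forall t, t <= T -> u t <= B;
  dr_v_bd : exists T B, forall t, t <= T -> Rabs (v t - exp (- 2 * t) / kap) <= B;
  dr_rho_bd : exists T B, forall t, T <= t -> rho t <= B }.
Unset Implicit Arguments.

Lemma rh_pos : 0 < rh. Proof. lra. Qed.

Lemma rdev_range (r t : R) : rl <= r <= rh -> - (rh / lam) <= (r - a) / lam <= rh / lam.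
Proof.
  intros Hr. replace (- (rh / lam)) with ((- rh) / lam) by (field; lra).
  split; apply Rmult_le_compat_r; try lra; pos.
Qed.

Lemma rh_lam_pos : 0 < rh / lam. Proof. apply Rdiv_lt_0_compat; lra. Qed.

Lemma p_max_pos : 0 < p_max.
Proof.
  assert (H := rh_lam_pos). apply Rdiv_lt_0_compat; nra.
Qed.

Lemma q_max_ge : 1 <= q_max /\ b <= lam * q_max.
Proof.
  assert (0 < bh / lam) by pos.
  unfold q_max. split. lra.
  replace (lam * (1 + bh / lam)) with (lam + bh) by (field; lra). lra.
Qed.

Lemma gain_u_pos : 0 < gain_u.
Proof. unfold gain_u.
  assert (0 < (1 + rh / lam) / rl) by pos.
  assert (0 < 1 / lam) by pos. lra.
Qed.

Lemma gain_v_pos : 0 < gain_v.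
Proof.
  assert (H := gain_u_pos). assert (H1 := p_max_pos). destruct q_max_ge as [H2 _].
  assert (0 < 1 / lam) by pos. unfold gain_v. nra.
Qed.

Lemma r_slope_pos : 0 < r_slope.
Proof.
  assert (0 < Q / rl) by pos.
  assert (0 < lam * P) by nra.
  apply Rmult_lt_0_compat. nra. apply Rdiv_lt_0_compat; lra.
Qed.

Lemma u_lower {r y u v rho : R -> R} : admissible r -> driven r y u v rho ->
  forall t, b * rl / (1 + rh / lam) <= u t.
Proof.
  intros [_ Hr _] [_ Hu0 _ _ Hu _ _ _ _ _] t.
  set (ul := b * rl / (1 + rh / lam)).
  assert (E : ul * (1 + rh / lam) = b * rl) by (unfold ul; field; lra).
  enough (ul - u t <= 0) by lra.
  assert (Hc : forall x, 0 < ul - u x ->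
     - (b * r x - u x * (1 + (r x - a) / lam)) <= - 1 * (ul - u x)).
  { intros x Hx. specialize (Hr x). specialize (Hu0 x).
    assert (H1 := rdev_range (r x) x Hr).
    assert (b * rl <= b * r x) by mono.
    nra. }
  apply (bounded_decay_nonpos_global (fun x => ul - u x)
    (fun x => - (b * r x - u x * (1 + (r x - a) / lam))) 1 ul 0); auto.
  - intros x. derive_by fail. ring.
  - lra.
  - intros x _. specialize (Hu0 x). lra.
  - intros x _ Hx. specialize (Hc x Hx). lra.
Qed.

(** For v < 1 / p_max the forcing lam r of v exceeds its decay. This bound and that of q are coarse
    but independent of the clamps; the gains are built on them, before the clamps are known to be
    inactive. *)
Lemma p_bound {r y u v rho : R -> R} : admissible r -> driven r y u v rho ->
  forall t, / v t <= p_max.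
Proof.
  intros [_ Hr _] [_ Hu0 Hv0 _ _ Hv _ _ _ _] t.
  assert (H := rh_lam_pos). assert (H0 := p_max_pos).
  assert (E : / p_max * (2 + rh / lam) = lam * rl).
  { unfold p_max. set (x := rh / lam) in *. field. nra. }
  assert (Hi : 0 < / p_max) by pos.
  enough (/ p_max - v t <= 0).
  { rewrite <- (Rinv_inv p_max). apply Rinv_le_contravar; lra. }
  assert (Hc : forall x, 0 < / p_max - v x ->
     - (lam * r x + u x - v x * (2 + (r x - a) / lam)) <= - 1 * (/ p_max - v x)).
  { intros x Hx. specialize (Hr x). specialize (Hu0 x). specialize (Hv0 x).
    assert (H1 := rdev_range (r x) x Hr).
    assert (lam * rl <= lam * r x) by mono.
    nra. }
  apply (bounded_decay_nonpos_global (fun x => / p_max - v x)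
    (fun x => - (lam * r x + u x - v x * (2 + (r x - a) / lam))) 1 (/ p_max) 0); auto.
  - intros x. derive_by fail. ring.
  - lra.
  - intros x _. specialize (Hv0 x). lra.
  - intros x _ Hx. specialize (Hc x Hx). lra.
Qed.

Lemma derive_q {r y u v rho : R -> R} : driven r y u v rho -> forall t,
  is_derive (fun t => u t / v t) t
    (u t / v t * (1 - lam * / v t * r t - u t / v t) + b * / v t * r t).
Proof.
  intros [_ Hu0 Hv0 _ Hu Hv _ _ _ _] t. specialize (Hv0 t).
  derive_by fail. lra. field. lra.
Qed.

Lemma derive_p {r y u v rho : R -> R} : driven r y u v rho -> forall t,
  is_derive (fun t => / v t) t
    (/ v t * (1 / lam * (r t - a) + 2 - lam * / v t * r t - u t / v t)).
Proof.
  intros [_ Hu0 Hv0 _ Hu Hv _ _ _ _] t. specialize (Hv0 t).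
  derive_by fail. lra. field. lra.
Qed.

(** Above [q_max] both q (1 - q) and b - lam q push q down. At -oo the product q = u p is bounded
    because u and p are. *)
Lemma q_bound {r y u v rho : R -> R} : admissible r -> driven r y u v rho ->
  forall t, u t / v t <= q_max.
Proof.
  intros Hr Hd t.
  assert (Hq := derive_q Hd). assert (Hp := p_bound Hr Hd).
  destruct Hd as [_ Hu0 Hv0 _ _ _ _ [T [B HB]] _ _]. destruct Hr as [_ Hr _].
  destruct q_max_ge as [Hq1 Hq2].
  assert (Hv : forall t, 0 < / v t) by (intros; now apply Rinv_0_lt_compat).
  enough (u t / v t - q_max <= 0) by lra.
  assert (Hc : forall x, 0 < u x / v x - q_max ->
    u x / v x * (1 - lam * / v x * r x - u x / v x) + b * / v x * r x <= - 1 * (u x / v x - q_max)).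
  { intros x Hx. specialize (Hr x). specialize (Hv x). set (q := u x / v x) in *.
    assert (lam * q_max <= lam * q) by mono.
    assert (0 < / v x * r x) by nra.
    replace (q * (1 - lam * / v x * r x - q) + b * / v x * r x)
      with (q * (1 - q) + (/ v x * r x) * (b - lam * q)) by ring.
    assert ((/ v x * r x) * (b - lam * q) <= 0) by nra. nra. }
  apply (bounded_decay_nonpos_global (fun x => u x / v x - q_max)
    (fun x => u x / v x * (1 - lam * / v x * r x - u x / v x) + b * / v x * r x)
    1 (B * p_max - q_max) T); auto.
  - intros x. eapply derive_change.
    apply (derive_sub (fun x => u x / v x) (fun _ => q_max)); [apply Hq | apply derive_cst]. ring.
  - lra.
  - intros x Hx. apply Rplus_le_compat_r.
    apply Rmult_le_compat; auto; left; auto.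
  - intros x _ Hx. specialize (Hc x Hx). lra.
Qed.

Lemma slope_exponent (t : R) : t <= 1 / 2 ->
  0 <= r_slope / lam * exp (2 * t) / 2 /\ exp (r_slope / lam * exp (2 * t) / 2) <= exp (2 * r_slope / lam).
Proof.
  intros Ht. assert (H1 := exp_pos (2 * t)).
  assert (H2 : exp (2 * t) <= 3).
  { eapply Rle_trans; [|apply exp_le_3]. apply exp_le. lra. }
  assert (0 < r_slope / lam) by pos.
  split. nra. apply exp_le. replace (2 * r_slope / lam) with (2 * (r_slope / lam)) by (field; lra). nra.
Qed.

Lemma rdev_slope (r : R -> R) (t : R) : admissible r ->
  - (r_slope / lam * exp (2 * t)) <= (r t - a) / lam <= r_slope / lam * exp (2 * t).
Proof.
  intros [_ _ Hs]. specialize (Hs t). apply Rabs_le_between in Hs.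
  replace (- (r_slope / lam * exp (2 * t))) with ((- (r_slope * exp (2 * t))) / lam) by (field; lra).
  replace (r_slope / lam * exp (2 * t)) with ((r_slope * exp (2 * t)) / lam) by (field; lra).
  split; apply Rmult_le_compat_r; try lra; pos.
Qed.

(** The derivative of h dominates |r - a| / lam, so the factor e^h absorbs the fluctuation of the
    coefficients: v e^(2t) e^h is nondecreasing and not below 1 / kap in the limit at -oo, whence 1
    / v <= kap e^(2t) e^h; similarly u e^(-h) stays below b rh. *)
Lemma pq_small {r y u v rho : R -> R} : admissible r -> driven r y u v rho -> forall t, t <= 1 / 2 ->
  / v t <= kap * pq_slope * exp (2 * t) /\ u t / v t <= kap * pq_slope * exp (2 * t).
Proof.
  intros Had [_ Hu0 Hv0 _ Hu Hv _ [T1 [B1 HB1]] [T2 [B2 HB2]] _] t Ht.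
  set (h := fun t => r_slope / lam * exp (2 * t) / 2).
  assert (Hh : forall t, is_derive h t (r_slope / lam * exp (2 * t))).
  { intros x. unfold h. derive_by fail; try lra. }
  destruct (slope_exponent t Ht) as [Hh0 Hh1]. fold (h t) in Hh0, Hh1.
  assert (Hr := ad_range Had).
  assert (Hsl := r_slope_pos). assert (Hrh := rh_pos).
  assert (Hh0' : forall x, 0 <= h x).
  { intros x. assert (H1 := exp_pos (2 * x)).
    assert (0 < r_slope / lam) by pos.
    apply Rdiv_le_0_compat; [apply Rmult_le_pos|]; lra. }
  assert (Hp : / v t <= kap * exp (2 * t) * exp (h t)).
  { assert (Hk : / kap - v t * (exp (2 * t) * exp (h t)) <= 0).
    { apply (barrier_nonpos (fun t => / kap - v t * (exp (2 * t) * exp (h t)))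
       (fun t => - ((lam * r t + u t - v t * (2 + (r t - a) / lam)) * (exp (2 * t) * exp (h t))
          + v t * ((2 + r_slope / lam * exp (2 * t)) * (exp (2 * t) * exp (h t)))))).
      - intros x. derive_by fail. ring.
      - intros eps Heps.
        destruct (exp_2t_small B2 eps (Rmin t T2) Heps) as [x [Hx1 Hx2]].
        assert (H1 := Rmin_l t T2). assert (H2 := Rmin_r t T2).
        exists x. split; [lra|]. split.
        + specialize (HB2 x ltac:(lra)). apply Rabs_le_between in HB2.
          assert (E1 := exp_pos (2 * x)).
          assert (E2 : 1 <= exp (h x)).
          { rewrite <- exp_0. apply exp_le. apply Hh0'. }
          assert (E3 : exp (- 2 * x) * exp (2 * x) = 1).
          { rewrite <- exp_plus. replace (- 2 * x + 2 * x) with 0 by ring. apply exp_0. }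
          assert (E4 : / kap - B2 * exp (2 * x) <= v x * exp (2 * x)).
          { replace (/ kap) with ((exp (- 2 * x) / kap) * exp (2 * x)).
            2: { unfold Rdiv. rewrite Rmult_assoc, (Rmult_comm (/ kap)), <- Rmult_assoc, E3. ring. }
            rewrite <- Rmult_minus_distr_r. apply Rmult_le_compat_r; lra. }
          assert (0 < v x * exp (2 * x)) by (apply Rmult_lt_0_compat; auto).
          rewrite <- Rmult_assoc.
          assert (v x * exp (2 * x) * 1 <= v x * exp (2 * x) * exp (h x)) by mono.
          lra.
        + intros z Hz _. assert (H3 := rdev_slope r z Had).
          specialize (Hr z). specialize (Hu0 z). specialize (Hv0 z).
          assert (E1 := exp_pos (2 * z)). assert (E2 := exp_pos (h z)).
          set (X := (r z - a) / lam) in *. set (Y := r_slope / lam * exp (2 * z)) in *.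
          set (Z := exp (2 * z) * exp (h z)).
          replace ((lam * r z + u z - v z * (2 + X)) * Z + v z * ((2 + Y) * Z))
            with ((lam * r z + u z + v z * (Y - X)) * Z) by ring.
          assert (0 <= (lam * r z + u z + v z * (Y - X)) * Z) by pos. lra. }
    specialize (Hv0 t).
    apply (Rmult_le_reg_l (v t)); auto. rewrite Rinv_r by lra.
    apply (Rmult_le_reg_l (/ kap)). now apply Rinv_0_lt_compat.
    replace (/ kap * (v t * (kap * exp (2 * t) * exp (h t)))) with (v t * (exp (2 * t) * exp (h t))) by (field; lra).
    lra. }
  assert (Hu1 : u t <= b * rh * exp (h t)).
  { enough (H : u t * exp (- h t) - b * rh <= 0).
    { replace (u t) with (u t * exp (- h t) * exp (h t)).
      apply Rmult_le_compat_r; [left; apply exp_pos|lra].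
      rewrite Rmult_assoc, <- exp_plus, Rplus_opp_l, exp_0. ring. }
    assert (Hc : forall x, (b * r x - u x * (1 + (r x - a) / lam)) * exp (- h x)
         + u x * (- (r_slope / lam * exp (2 * x)) * exp (- h x)) <= - 1 * (u x * exp (- h x) - b * rh)).
    { intros x. assert (H3 := rdev_slope r x Had). specialize (Hr x). specialize (Hu0 x).
      set (X := (r x - a) / lam) in *. set (Y := r_slope / lam * exp (2 * x)) in *.
      assert (E1 := exp_pos (- h x)).
      assert (E2 : exp (- h x) <= 1) by (rewrite <- exp_0; apply exp_le; specialize (Hh0' x); lra).
      assert (0 <= u x * (X + Y) * exp (- h x)) by pos.
      assert (b * r x * exp (- h x) <= b * rh * 1) by mono.
      nra. }
    apply (bounded_decay_nonpos_global (fun t => u t * exp (- h t) - b * rh)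
      (fun x => (b * r x - u x * (1 + (r x - a) / lam)) * exp (- h x)
         + u x * (- (r_slope / lam * exp (2 * x)) * exp (- h x))) 1 B1 T1).
    - intros x. derive_by fail. ring.
    - lra.
    - intros x Hx. specialize (HB1 x Hx). specialize (Hu0 x).
      assert (E2 : exp (- h x) <= 1) by (rewrite <- exp_0; apply exp_le; specialize (Hh0' x); lra). nra.
    - intros x _ Hx. apply Hc.
    - intros x _ Hx. specialize (Hc x). lra. }
  specialize (Hu0 t). specialize (Hv0 t).
  assert (E1 := exp_pos (2 * t)). assert (E2 := exp_pos (h t)).
  assert (E3 : 1 <= exp (2 * r_slope / lam)).
  { rewrite <- exp_0. apply exp_le. apply Rdiv_le_0_compat; lra. }
  assert (E4 : exp (4 * r_slope / lam) = exp (2 * r_slope / lam) * exp (2 * r_slope / lam)).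
  { rewrite <- exp_plus. f_equal. field. lra. }
  set (X := exp (2 * r_slope / lam)) in *.
  assert (Hbr : 0 < b * rh) by nra.
  assert (Hbr2 : b * rh <= bh * rh) by nra.
  unfold pq_slope. rewrite E4. split.
  - eapply Rle_trans; [apply Hp|].
    replace (kap * ((1 + bh * rh) * (X * X)) * exp (2 * t)) with (kap * exp (2 * t) * ((1 + bh * rh) * (X * X))) by ring.
    apply Rmult_le_compat_l. nra. nra.
  - apply Rle_trans with (b * rh * exp (h t) * (kap * exp (2 * t) * exp (h t))).
    + mono.
    + replace (kap * ((1 + bh * rh) * (X * X)) * exp (2 * t)) with (kap * exp (2 * t) * ((1 + bh * rh) * (X * X))) by ring.
      replace (b * rh * exp (h t) * (kap * exp (2 * t) * exp (h t)))
        with (kap * exp (2 * t) * (b * rh * (exp (h t) * exp (h t)))) by ring.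
      apply Rmult_le_compat_l. nra.
      apply Rmult_le_compat; nra.
Qed.

Lemma exp_ln_q {r y u v rho : R -> R} (t : R) : driven r y u v rho ->
  u t / v t = exp (ln (u t) - ln (v t)).
Proof.
  intros [_ Hu0 Hv0 _ _ _ _ _ _ _]. unfold Rminus.
  rewrite exp_plus, exp_Ropp, !exp_ln; auto.
Qed.

(** The response of ln u to r is b / u' - 1 / lam, bounded through [u_lower]. The term b r (1 / u' -
    1 / u) is a damping, whose rate is bounded below near -oo because u is bounded there. *)
Lemma ln_u_compare {r r' y y' u u' v v' rho rho' W w : R -> R} :
  admissible r -> admissible r' -> driven r y u v rho -> driven r' y' u' v' rho' ->
  (forall t, is_derive W t (w t)) -> (forall t, 0 <= W t) ->
  (forall t, Rabs (r t - r' t) <= w t) ->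
  forall t, ln (u t) - ln (u' t) <= gain_u * W t.
Proof.
  intros Hr Hr' Hd Hd' HW HW0 Hw t. assert (Hul' := u_lower Hr' Hd').
  destruct Hd as [_ Hu0 _ _ Hu _ _ [T [B HB]] _ _].
  destruct Hd' as [_ Hu0' _ _ Hu' _ _ _ _ _].
  destruct Hr as [_ Hr _]. destruct Hr' as [_ Hr' _].
  assert (HB0 : 0 < B) by (specialize (HB T (Rle_refl _)); specialize (Hu0 T); lra).
  assert (Hrl' := rh_lam_pos). assert (Hgu := gain_u_pos).
  assert (Hi := Rinv_0_lt_compat lam Hlam).
  set (ul := b * rl / (1 + rh / lam)) in *.
  assert (Hulp : 0 < ul) by pos.
  assert (Hbul : b / ul = (1 + rh / lam) / rl).
  { unfold ul. set (x := rh / lam) in *. field. lra. }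
  set (dD := fun t => (b * r t - u t * (1 + (r t - a) / lam)) * / u t
                    - (b * r' t - u' t * (1 + (r' t - a) / lam)) * / u' t).
  assert (Hc : forall x, 0 < ln (u x) - ln (u' x) ->
    dD x <= gain_u * w x - b * rl * (/ u x * (ln (u x) - ln (u' x)))).
  { intros x Hx. specialize (Hul' x). specialize (Hu0 x). specialize (Hu0' x).
    replace (dD x) with ((b / u' x - / lam) * (r x - r' x) - b * r x * (/ u' x - / u x))
      by (unfold dD; field; lra).
    assert (H1 : (b / u' x - / lam) * (r x - r' x) <= gain_u * w x).
    { eapply Rle_trans; [apply Rle_abs|]. rewrite Rabs_mult.
      apply Rmult_le_compat; auto using Rabs_pos.
      assert (H2 : 0 <= b / u' x <= b / ul).
      { split. apply Rdiv_le_0_compat; lra. apply Rmult_le_compat_l; [lra|].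
        apply Rinv_le_contravar; lra. }
      rewrite Hbul in H2. unfold gain_u. replace (1 / lam) with (/ lam) by (field; lra). apply Rabs_le. lra. }
    assert (H2 : b * rl * (/ u x * (ln (u x) - ln (u' x))) <= b * r x * (/ u' x - / u x)).
    { assert (H3 := inv_sub_ge_ln (u x) (u' x) Hu0 Hu0'). unfold Rdiv in H3.
      rewrite Rmult_comm in H3.
      assert (0 < / u x * (ln (u x) - ln (u' x))) by pos.
      apply Rmult_le_compat; try lra.
      - pos.
      - apply Rmult_le_compat_l; [lra|]. apply Hr. }
    lra. }
  apply (comparison_from_minf (fun t => ln (u t) - ln (u' t)) dD
    (fun t => gain_u * W t) (fun t => gain_u * w t) (b * rl / B) (ln B - ln ul) T).
  - intros x. derive_by fail; auto.
  - intros x. derive_by fail. ring.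
  - intros x. apply Rmult_le_pos; [lra|auto].
  - pos.
  - intros x Hx. apply Rplus_le_compat.
    + apply ln_le_compat; auto.
    + apply Ropp_le_contravar, ln_le_compat; auto.
  - intros x Hx Hp. specialize (Hc x Hp).
    eapply Rle_trans; [apply Hc|]. apply Rplus_le_compat_l, Ropp_le_contravar.
    unfold Rdiv. rewrite !Rmult_assoc. apply Rmult_le_compat_l; [lra|].
    apply Rmult_le_compat_l; [lra|]. apply Rmult_le_compat_r; [lra|].
    apply Rinv_le_contravar; auto.
  - intros x Hp. specialize (Hc x Hp). specialize (Hu0 x).
    assert (0 <= b * rl * (/ u x * (ln (u x) - ln (u' x)))); [|lra].
    apply Rmult_le_pos. apply Rmult_le_pos; lra. apply Rmult_le_pos; [|lra].
    pos.
Qed.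

Lemma v_asymptotic (v : R -> R) (T B t : R) :
  (forall t, t <= T -> Rabs (v t - exp (- 2 * t) / kap) <= B) -> t <= T ->
  Rabs (v t * exp (2 * t) - / kap) <= B * exp (2 * t).
Proof.
  intros H Ht. specialize (H t Ht). assert (E := exp_pos (2 * t)).
  replace (v t * exp (2 * t) - / kap) with ((v t - exp (- 2 * t) / kap) * exp (2 * t)).
  - rewrite Rabs_mult, (Rabs_right (exp _)) by lra. apply Rmult_le_compat_r; lra.
  - rewrite Rmult_minus_distr_r. f_equal. unfold Rdiv.
    rewrite Rmult_assoc, (Rmult_comm (/ kap)), <- Rmult_assoc, <- exp_plus.
    replace (-2 * t + 2 * t) with 0 by ring. rewrite exp_0. ring.
Qed.

(** Since ln v is unbounded at -oo, the comparison cannot start as for u. Instead v and v' share the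
    leading term e^(-2t) / kap, so ln v - ln v' tends to 0, and [barrier_nonpos] starts from
    there. *)
Lemma ln_v_compare {r r' y y' u u' v v' rho rho' W w : R -> R} :
  admissible r -> admissible r' -> driven r y u v rho -> driven r' y' u' v' rho' ->
  (forall t, is_derive W t (w t)) -> (forall t, 0 <= W t <= w t) ->
  (forall t, Rabs (r t - r' t) <= w t) ->
  forall t, ln (v t) - ln (v' t) <= gain_v * W t.
Proof.
  intros Hr Hr' Hd Hd' HW HW0 Hw t.
  assert (Hlu := ln_u_compare Hr Hr' Hd Hd' HW
    (fun t => proj1 (HW0 t)) Hw).
  assert (Hpb := p_bound Hr Hd). assert (Hqb := q_bound Hr Hd).
  destruct Hd as [_ Hu0 Hv0 _ Hu Hv _ _ [T [B HB]] _].
  destruct Hd' as [_ Hu0' Hv0' _ Hu' Hv' _ _ [T' [B' HB']] _].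
  destruct Hr as [_ Hr _]. destruct Hr' as [_ Hr' _].
  assert (Hgu := gain_u_pos). assert (Hgv := gain_v_pos). destruct q_max_ge as [Hq1 _].
  assert (Hi := Rinv_0_lt_compat lam Hlam).
  set (dD := fun t => (lam * r t + u t - v t * (2 + (r t - a) / lam)) * / v t
                    - (lam * r' t + u' t - v' t * (2 + (r' t - a) / lam)) * / v' t).
  enough (ln (v t) - ln (v' t) - gain_v * W t <= 0) by lra.
  apply (barrier_nonpos (fun t => ln (v t) - ln (v' t) - gain_v * W t)
    (fun t => dD t - gain_v * w t)).
  - intros x. derive_by fail; auto. unfold dD. ring.
  - intros eps Heps.
    set (BB := Rabs B + Rabs B').
    assert (HBl := Rle_abs B). assert (HBl' := Rle_abs B').
    assert (Hik := Rinv_0_lt_compat kap Hkap).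
    set (l := / kap / 2). assert (Hl : 0 < l) by pos.
    destruct (exp_2t_small BB (Rmin l (eps * l)) (Rmin t (Rmin T T'))) as [x [Hx1 Hx2]].
    { apply Rmin_pos; auto. now apply Rmult_lt_0_compat. }
    min_bounds t (Rmin T T').
    min_bounds T T'.
    min_bounds l (eps * l).
    exists x. split; [lra|]. split.
    + assert (A1 := v_asymptotic v T B x HB ltac:(lra)).
      assert (A2 := v_asymptotic v' T' B' x HB' ltac:(lra)).
      specialize (Hv0 x). specialize (Hv0' x). assert (E := exp_pos (2 * x)).
      assert (B * exp (2 * x) <= Rabs B * exp (2 * x)) by mono.
      assert (B' * exp (2 * x) <= Rabs B' * exp (2 * x)) by mono.
      unfold BB in Hx2. rewrite Rmult_plus_distr_r in Hx2.
      apply Rabs_le_between in A1. apply Rabs_le_between in A2.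
      assert (Hik2 : / kap = 2 * l) by (unfold l; field; lra).
      assert (A3 := ln_sub_le (v x * exp (2 * x)) (v' x * exp (2 * x)) l Hl ltac:(lra) ltac:(lra)).
      rewrite !ln_mult, ln_exp in A3 by lra.
      replace (ln (v x) + 2 * x - (ln (v' x) + 2 * x)) with (ln (v x) - ln (v' x)) in A3 by ring.
      assert (A4 : Rabs (v x * exp (2 * x) - v' x * exp (2 * x)) / l < eps).
      { apply Rlt_div_l; auto. apply Rle_lt_trans with ((Rabs B + Rabs B') * exp (2 * x)).
        apply Rabs_le. lra. lra. }
      assert (A5 := Rle_abs (ln (v x) - ln (v' x))).
      assert (0 <= gain_v * W x) by (apply Rmult_le_pos; [lra|apply HW0]). lra.
    + intros x' _ Hp.
      assert (HD : 0 < ln (v x') - ln (v' x')).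
      { assert (0 <= gain_v * W x') by (apply Rmult_le_pos; [lra|apply HW0]). lra. }
      specialize (Hlu x'). specialize (HW0 x').
      specialize (Hpb x'). specialize (Hqb x'). specialize (Hr' x').
      specialize (Hu0 x'). specialize (Hu0' x'). specialize (Hv0 x'). specialize (Hv0' x').
      replace (dD x') with ((lam * / v x' - / lam) * (r x' - r' x') + (u x' - u' x') * / v x'
         - (lam * r' x' + u' x') * (/ v' x' - / v x')) by (unfold dD; field; lra).
      assert (H1 : (lam * / v x' - / lam) * (r x' - r' x') <= (lam * p_max + 1 / lam) * w x').
      { eapply Rle_trans; [apply Rle_abs|]. rewrite Rabs_mult.
        apply Rmult_le_compat; auto using Rabs_pos.
        assert (0 <= lam * / v x') by pos.
        assert (lam * / v x' <= lam * p_max) by mono.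
        replace (1 / lam) with (/ lam) by (field; lra). apply Rabs_le. lra. }
      assert (H2 : (u x' - u' x') * / v x' <= q_max * gain_u * w x').
      { assert (0 <= q_max * gain_u) by pos.
        apply Rle_trans with (q_max * (gain_u * W x')).
        2: { rewrite <- Rmult_assoc. apply Rmult_le_compat_l; lra. }
        assert (H3 := ln_sub_ge (u x') (u' x') Hu0 Hu0').
        replace ((u x' - u' x') * / v x') with ((u x' / v x') * ((u x' - u' x') / u x')) by (field; lra).
        assert (0 < u x' / v x') by pos.
        apply Rle_trans with ((u x' / v x') * (gain_u * W x')).
        - nra.
        - mono. }
      assert (H3 : 0 <= (lam * r' x' + u' x') * (/ v' x' - / v x')).
      { apply Rmult_le_pos.
        - pos.
        - assert (H4 := inv_sub_ge_ln (v x') (v' x') Hv0 Hv0').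
          assert (0 < (ln (v x') - ln (v' x')) / v x') by pos. lra. }
      unfold gain_v. lra.
Qed.

Hypotheses (HK : 4 <= K) (HnK : n * K <= g / 2).

(** The first summand is made small by kap, the second by K; the 3 bounds e^(2t) for t <= 1 / 2. *)
Definition pq_factor : R := 3 * pq_slope * kap / 2 + 2 * (p_max + q_max) / K.

Lemma pq_weighted (m t : R) : 0 <= m -> m <= p_max + q_max ->
  (t <= 1 / 2 -> m <= kap * pq_slope * exp (2 * t)) -> m * Om1 K t <= pq_factor * Om K t.
Proof.
  intros Hm0 Hm Hs. unfold pq_factor.
  assert (0 < kap * pq_slope) by pos.
  replace (3 * pq_slope * kap / 2) with (3 * (kap * pq_slope) / 2) by field.
  apply Om1_gain; auto. lra.
  intros Ht. eapply Rle_trans; [now apply Hs|].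
  assert (exp (2 * t) <= 3) by (eapply Rle_trans; [|apply exp_le_3]; apply exp_le; lra).
  rewrite Rmult_comm. apply Rmult_le_compat_r; lra.
Qed.

(** A difference of exponentials is at most the larger one times the difference of exponents. The
    exponents are compared in Om1, while the larger of p, p' (or q, q') is small for t <= 1 / 2;
    [Om1_gain] converts both facts into a small multiple of Om. *)
Lemma pq_compare {r r' y y' u u' v v' rho rho' : R -> R} (d : R) :
  admissible r -> admissible r' -> driven r y u v rho -> driven r' y' u' v' rho' -> 0 <= d ->
  (forall t, Rabs (r t - r' t) <= d * Om K t) -> forall t,
  Rabs (/ v t - / v' t) <= gain_v * (pq_factor * (d * Om K t)) /\
  Rabs (u t / v t - u' t / v' t) <= (gain_u + gain_v) * (pq_factor * (d * Om K t)).
Proof.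
  intros Hr Hr' Hd Hd' Hd0 Hw t.
  assert (Hgu := gain_u_pos). assert (Hgv := gain_v_pos). destruct q_max_ge as [Hqm _].
  assert (HW : forall t, is_derive (fun t => d * Om1 K t) t (d * Om K t)).
  { intros x. eapply derive_change.
    apply (derive_mul (fun _ => d) (Om1 K)); [apply derive_cst | apply derive_Om1; lra]. ring. }
  assert (HW0 : forall t, 0 <= d * Om1 K t <= d * Om K t).
  { intros x. destruct (Om1_le_Om K x HK). split. now apply Rmult_le_pos.
    now apply Rmult_le_compat_l. }
  assert (Hw' : forall t, Rabs (r' t - r t) <= d * Om K t) by (intros; rewrite Rabs_minus_sym; auto).
  assert (U1 := ln_u_compare Hr Hr' Hd Hd' HW (fun t => proj1 (HW0 t)) Hw t).
  assert (U2 := ln_u_compare Hr' Hr Hd' Hd HW (fun t => proj1 (HW0 t)) Hw' t).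
  assert (V1 := ln_v_compare Hr Hr' Hd Hd' HW HW0 Hw t).
  assert (V2 := ln_v_compare Hr' Hr Hd' Hd HW HW0 Hw' t).
  simpl in *. destruct (HW0 t) as [W0 _].
  assert (Hiv : forall v, 0 < v -> / v = exp (- ln v)).
  { intros z Hz. rewrite exp_Ropp, exp_ln; auto. }
  assert (Hp1 := p_bound Hr Hd t). assert (Hp2 := p_bound Hr' Hd' t).
  assert (Hq1 := q_bound Hr Hd t). assert (Hq2 := q_bound Hr' Hd' t).
  assert (Hs1 := pq_small Hr Hd t). assert (Hs2 := pq_small Hr' Hd' t).
  assert (Hv1 := dr_v_pos Hd t). assert (Hv2 := dr_v_pos Hd' t).
  assert (Hu1 := dr_u_pos Hd t).
  assert (Hi1 := Rinv_0_lt_compat _ Hv1).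
  assert (Hqp : 0 < u t / v t) by pos.
  split.
  - set (m := Rmax (/ v t) (/ v' t)).
    assert (Hm : 0 < m) by (unfold m; eapply Rlt_le_trans; [|apply Rmax_l]; auto).
    apply Rle_trans with (m * (gain_v * (d * Om1 K t))).
    + unfold m. rewrite (Hiv _ Hv1), (Hiv _ Hv2). eapply Rle_trans; [apply exp_sub_le|].
      apply Rmult_le_compat_l. rewrite <- (Hiv _ Hv1), <- (Hiv _ Hv2). fold m; lra.
      replace (- ln (v t) - - ln (v' t)) with (- (ln (v t) - ln (v' t))) by ring.
      rewrite Rabs_Ropp. apply Rabs_le. lra.
    + replace (m * (gain_v * (d * Om1 K t))) with (gain_v * d * (m * Om1 K t)) by ring.
      replace (gain_v * (pq_factor * (d * Om K t))) with (gain_v * d * (pq_factor * Om K t)) by ring.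
      apply Rmult_le_compat_l. apply Rmult_le_pos; lra.
      apply pq_weighted. lra. unfold m; apply Rmax_lub; lra.
      intros Ht. unfold m; apply Rmax_lub. apply Hs1, Ht. apply Hs2, Ht.
  - set (m := Rmax (u t / v t) (u' t / v' t)).
    assert (Hm : 0 < m) by (unfold m; eapply Rlt_le_trans; [|apply Rmax_l]; auto).
    apply Rle_trans with (m * ((gain_u + gain_v) * (d * Om1 K t))).
    + unfold m. rewrite (exp_ln_q t Hd), (exp_ln_q t Hd').
      eapply Rle_trans; [apply exp_sub_le|].
      apply Rmult_le_compat_l.
      rewrite <- (exp_ln_q t Hd), <- (exp_ln_q t Hd'). fold m; lra.
      apply Rabs_le. lra.
    + replace (m * ((gain_u + gain_v) * (d * Om1 K t))) with ((gain_u + gain_v) * d * (m * Om1 K t)) by ring.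
      replace ((gain_u + gain_v) * (pq_factor * (d * Om K t)))
        with ((gain_u + gain_v) * d * (pq_factor * Om K t)) by ring.
      apply Rmult_le_compat_l. apply Rmult_le_pos; lra.
      apply pq_weighted. lra. unfold m; apply Rmax_lub; lra.
      intros Ht. unfold m; apply Rmax_lub. apply Hs1, Ht. apply Hs2, Ht.
Qed.

Lemma pq_factor_pos : 0 < pq_factor.
Proof. destruct q_max_ge as [H2 _].
  unfold pq_factor.
  assert (0 < pq_slope * kap) by pos.
  assert (0 < 2 * (p_max + q_max) / K) by pos.
  replace (3 * pq_slope * kap / 2) with (3 / 2 * (pq_slope * kap)) by field. lra.
Qed.

Lemma gain_pq_pos : 0 < gain_pq.
Proof. unfold gain_pq.
  assert (0 < (gain_u + gain_v) / rl) by pos.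
  assert (0 < lam * gain_v) by pos. lra.
Qed.

Lemma gain_ds_nonneg : 0 <= gain_ds lam be rl La gh.
Proof.
  assert (H : 0 <= gain_s lam be rl La gh) by (apply (gain_s_nonneg lam be rl rh La gh ga); auto; lra).
  assert (0 < gh / be) by pos.
  assert (0 < 1 / rl) by pos.
  assert (0 <= be * gain_s lam be rl La gh) by pos.
  unfold gain_ds, gain_y. apply Rmult_le_pos; lra.
Qed.

Hypothesis HkQ : Q + g <= k.

Lemma k_minus_q {r y u v rho : R -> R} (t : R) : driven r y u v rho ->
  g <= k - Rmin (u t / v t) Q <= k /\ 0 < Rmin (u t / v t) Q <= Q /\ 0 < Rmin (/ v t) P <= P.
Proof.
  intros [_ Hu0 Hv0 _ _ _ _ _ _ _]. specialize (Hu0 t). specialize (Hv0 t).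
  assert (0 < / v t) by pos.
  assert (0 < u t / v t) by pos.
  assert (H1 := Rmin_r (u t / v t) Q). assert (H2 := Rmin_r (/ v t) P).
  assert (0 < Rmin (u t / v t) Q) by now apply Rmin_pos.
  assert (0 < Rmin (/ v t) P) by now apply Rmin_pos. lra.
Qed.

(* Since the equation n z' = kk z + ... is repelling, a solution bounded at +oo cannot rise above a supersolution S. *)
Lemma fast_comparison (z dz S dS kk : R -> R) (B T : R) :
  (forall t, is_derive z t (dz t)) -> (forall t, is_derive S t (dS t)) -> (forall t, 0 <= S t) ->
  (forall t, T <= t -> z t <= B) -> (forall t, g <= kk t) ->
  (forall t, kk t * z t - (g * S t - n * dS t) <= n * dz t) -> forall t, z t <= S t.
Proof.
  intros Hz HS HS0 HB Hkk H t. enough (z t - S t <= 0) by lra.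
  apply (bounded_growth_nonpos_global (fun t => z t - S t) (fun t => dz t - dS t) (g / n) B T).
  - intros x. derive_by fail. reflexivity.
  - pos.
  - intros x Hx. specialize (HB x Hx). specialize (HS0 x). lra.
  - intros x Hx. specialize (H x). specialize (Hkk x). specialize (HS0 x).
    apply (Rmult_le_reg_l n); auto.
    replace (n * (g / n * (z x - S x))) with (g * (z x - S x)) by (field; lra).
    assert (g * z x <= kk x * z x) by mono. lra.
Qed.

Lemma fast_comparison_abs (z dz S dS kk : R -> R) (B T : R) :
  (forall t, is_derive z t (dz t)) -> (forall t, is_derive S t (dS t)) -> (forall t, 0 <= S t) ->
  (forall t, T <= t -> Rabs (z t) <= B) -> (forall t, g <= kk t) ->
  (forall t, Rabs (n * dz t - kk t * z t) <= g * S t - n * dS t) -> forall t, Rabs (z t) <= S t.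
Proof.
  intros Hz HS HS0 HB Hkk H t. apply Rabs_le_sign. intros sg Hsg.
  apply (fast_comparison (fun t => sg * z t) (fun t => sg * dz t) S dS kk B T); auto.
  - intros x. derive_by fail. ring.
  - intros x Hx. apply (sign_mul_range sg _ _ Hsg), HB, Hx.
  - intros x. specialize (H x). apply (sign_mul_range sg _ _ Hsg) in H. lra.
Qed.

(** The supersolution S is twice F / g times the weighted distance. The doubling pays for n S': by n
    K <= g / 2 the weight grows slowly enough for n S' <= (g / 2) S. *)
Lemma rho_contract {r r' y y' u u' v v' rho rho' : R -> R} (d : R) :
  admissible r -> admissible r' -> driven r y u v rho -> driven r' y' u' v' rho' -> 0 <= d ->
  (forall t, Rabs (r t - r' t) <= d * Om K t) -> (forall t, rho' t <= / rl) -> forall t,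
  Rabs (rho t - rho' t)
  <= 2 * (gain_pq * pq_factor + ze * (n * gain_ds lam be rl La gh)) / g * (d * Om K t).
Proof.
  intros Hr Hr' Hd Hd' Hd0 Hw Hrl' t.
  set (F := gain_pq * pq_factor + ze * (n * gain_ds lam be rl La gh)).
  assert (HOm0 : forall t, 0 <= d * Om K t).
  { intros x. destruct (Om1_le_Om K x HK). apply Rmult_le_pos; lra. }
  assert (HF1 : 0 <= F).
  { assert (H1 := gain_pq_pos). assert (H2 := pq_factor_pos). assert (H3 := gain_ds_nonneg).
    apply Rplus_le_le_0_compat; apply Rmult_le_pos; try lra. apply Rmult_le_pos; lra. }
  assert (HF : forall t, Rabs (rho' t * (Rmin (u t / v t) Q - Rmin (u' t / v' t) Q))
     + Rabs (N_of r y v t - N_of r' y' v' t) <= F * (d * Om K t)).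
  { intros x. destruct (pq_compare d Hr Hr' Hd Hd' Hd0 Hw x) as [Hp Hq].
    assert (Hs : Rabs (exp (n * ln (r x)) / y x - exp (n * ln (r' x)) / y' x)
        <= n * gain_ds lam be rl La gh * (d * Om K x)).
    { apply (s_compare lam be rl rh La gh n ga Hlam Hbe Hrl HLa Hn Hn1 HnLa Hga Hgah Hnga r r' y y'
        (fun t => d * Om1 K t) (fun t => d * Om K t)); auto.
      - apply (dr_y Hd).
      - apply (dr_y Hd').
      - intros z. eapply derive_change.
        apply (derive_mul (fun _ => d) (Om1 K)); [apply derive_cst | apply derive_Om1; lra]. ring.
      - intros z. destruct (Om1_le_Om K z HK). split. now apply Rmult_le_pos.
        now apply Rmult_le_compat_l. }
    specialize (Hrl' x). assert (Hrp := dr_rho_pos Hd' x).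
    set (X := pq_factor * (d * Om K x)) in *.
    assert (H1 : Rabs (rho' x * (Rmin (u x / v x) Q - Rmin (u' x / v' x) Q)) <= / rl * ((gain_u + gain_v) * X)).
    { rewrite Rabs_mult, (Rabs_right (rho' x)) by lra.
      apply Rmult_le_compat; try lra. apply Rabs_pos.
      eapply Rle_trans; [apply Rmin_sub_le|apply Hq]. }
    assert (H2 : Rabs (N_of r y v x - N_of r' y' v' x)
        <= lam * (gain_v * X) + ze * (n * gain_ds lam be rl La gh * (d * Om K x))).
    { unfold N_of.
      set (A := Rmin (/ v x) P) in *. set (A' := Rmin (/ v' x) P) in *.
      set (S1 := exp (n * ln (r x)) / y x) in *. set (S2 := exp (n * ln (r' x)) / y' x) in *.
      replace (lam * A + ze * S1 - Bm - (lam * A' + ze * S2 - Bm))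
        with (lam * (A - A') + ze * (S1 - S2)) by ring.
      eapply Rle_trans; [apply Rabs_triang|]. rewrite !Rabs_mult, (Rabs_right lam), (Rabs_right ze) by lra.
      apply Rplus_le_compat; apply Rmult_le_compat_l; try lra.
      eapply Rle_trans; [apply Rmin_sub_le|apply Hp]. }
    replace (F * (d * Om K x)) with (/ rl * ((gain_u + gain_v) * X) + (lam * (gain_v * X)
       + ze * (n * gain_ds lam be rl La gh * (d * Om K x)))).
    lra. unfold F, X, gain_pq. field. lra. }
  destruct (dr_rho_bd Hd) as [T [B HB]]. destruct (dr_rho_bd Hd') as [T' [B' HB']].
  apply (fast_comparison_abs (fun t => rho t - rho' t)
    (fun t => (rho t * (k - Rmin (u t / v t) Q) - N_of r y v t) / n
            - (rho' t * (k - Rmin (u' t / v' t) Q) - N_of r' y' v' t) / n)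
    (fun t => 2 * F / g * (d * Om K t))
    (fun t => 2 * F / g * (d * (2 * exp (2 * t) + K * exp (K * t))))
    (fun t => k - Rmin (u t / v t) Q) (B + B') (Rmax T T')).
  - intros x. assert (D1 := dr_rho Hd). assert (D2 := dr_rho Hd'). derive_by fail. reflexivity.
  - intros x. assert (D1 := derive_Om K). derive_by fail. ring.
  - intros x. apply Rmult_le_pos; auto. apply Rdiv_le_0_compat; lra.
  - intros x Hx. max_bounds T T'.
    specialize (HB x ltac:(lra)). specialize (HB' x ltac:(lra)).
    assert (Hp := dr_rho_pos Hd x). assert (Hp' := dr_rho_pos Hd' x). apply Rabs_le. lra.
  - intros x. apply (k_minus_q x Hd).
  - intros x.
    match goal with |- Rabs (n * (?X / n - ?Y / n) - ?Z) <= _ =>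
      replace (n * (X / n - Y / n) - Z) with (X - Y - Z) by (field; lra) end.
    replace (rho x * (k - Rmin (u x / v x) Q) - N_of r y v x - (rho' x * (k - Rmin (u' x / v' x) Q) - N_of r' y' v' x)
       - (k - Rmin (u x / v x) Q) * (rho x - rho' x))
      with (- (rho' x * (Rmin (u x / v x) Q - Rmin (u' x / v' x) Q) + (N_of r y v x - N_of r' y' v' x))) by ring.
    rewrite Rabs_Ropp. eapply Rle_trans; [apply Rabs_triang|]. eapply Rle_trans; [apply HF|].
    replace (g * (2 * F / g * (d * Om K x)) - n * (2 * F / g * (d * (2 * exp (2 * x) + K * exp (K * x)))))
      with (2 * (F * (d * Om K x)) - 2 / g * ((F * d) * (n * (2 * exp (2 * x) + K * exp (K * x))))) by (field; lra).
    assert (A4 : n * (2 * exp (2 * x) + K * exp (K * x)) <= g / 2 * Om K x).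
    { unfold Om.
      assert (n * 2 <= n * K) by mono.
      assert (n * 2 * exp (2 * x) <= g / 2 * exp (2 * x)) by mono.
      assert (n * K * exp (K * x) <= g / 2 * exp (K * x)) by mono. lra. }
    assert (A5 : (F * d) * (n * (2 * exp (2 * x) + K * exp (K * x))) <= (F * d) * (g / 2 * Om K x)) by mono.
    assert (A6 : 2 / g * ((F * d) * (n * (2 * exp (2 * x) + K * exp (K * x)))) <= 2 / g * ((F * d) * (g / 2 * Om K x))) by mono.
    replace (2 / g * ((F * d) * (g / 2 * Om K x))) with (F * (d * Om K x)) in A6 by (field; lra). lra.
Qed.

Hypothesis Hka : k = a * (ze * (ga / be - n / (lam * be * a)) - Bm).
Hypothesis HNh : lam * P + ze * (ga / be + n * gain_s lam be rl La gh) - Bm <= g / rl.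
Hypothesis HNl : k / rh <= ze * (ga / be - n * gain_s lam be rl La gh) - Bm.

Lemma N_range (r y v : R -> R) (t : R) : y_driven lam be rl rh n ga r y -> 0 < v t ->
  k / rh <= N_of r y v t <= g / rl.
Proof.
  intros Hy Hv.
  assert (Hs := s_near lam be rl rh La gh n ga Hlam Hbe Hrl HLa Hn HnLa Hga Hgah Hnga r y (r t) t
     Hy (yd_range Hy t)).
  apply Rabs_le_between in Hs. unfold N_of.
  assert (Hi : 0 < / v t) by pos.
  assert (0 < Rmin (/ v t) P) by now apply Rmin_pos.
  assert (Rmin (/ v t) P <= P) by apply Rmin_r.
  set (s := exp (n * ln (r t)) / y t) in *. set (m := Rmin (/ v t) P) in *.
  assert (lam * m <= lam * P) by mono.
  assert (0 < lam * m) by pos.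
  assert (ze * s <= ze * (ga / be + n * gain_s lam be rl La gh)) by mono.
  assert (ze * (ga / be - n * gain_s lam be rl La gh) <= ze * s) by mono.
  lra.
Qed.

(** By [N_range], rho would run away downward from below 1 / rh and upward from above 1 / rl. The
    first contradicts its positivity, the second its boundedness at +oo. *)
Lemma rho_range {r y u v rho : R -> R} : driven r y u v rho -> forall t, / rh <= rho t <= / rl.
Proof.
  intros Hd. assert (Hk := fun t => k_minus_q t Hd).
  assert (HN := fun t => N_range r y v t (dr_y Hd) (dr_v_pos Hd t)).
  assert (Hrho := dr_rho Hd). assert (Hp := dr_rho_pos Hd).
  destruct (dr_rho_bd Hd) as [T [B HB]].
  assert (Hil := Rinv_0_lt_compat _ Hrl).
  split.
  - enough (/ rh - rho t <= 0) by lra.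
    apply (fast_comparison (fun t => / rh - rho t)
      (fun t => - ((rho t * (k - Rmin (u t / v t) Q) - N_of r y v t) / n))
      (fun _ => 0) (fun _ => 0) (fun t => k - Rmin (u t / v t) Q) (/ rh) T).
    + intros x. derive_by fail. ring.
    + intros x. apply derive_cst.
    + intros; lra.
    + intros x _. specialize (Hp x). lra.
    + intros x. apply Hk.
    + intros x. specialize (Hk x). specialize (HN x).
      match goal with |- _ <= n * - (?X / n) => replace (n * - (X / n)) with (- X) by (field; lra) end.
      assert (/ rh * (k - Rmin (u x / v x) Q) <= / rh * k) by mono. lra.
  - enough (rho t - / rl <= 0) by lra.
    apply (fast_comparison (fun t => rho t - / rl)
      (fun t => (rho t * (k - Rmin (u t / v t) Q) - N_of r y v t) / n)
      (fun _ => 0) (fun _ => 0) (fun t => k - Rmin (u t / v t) Q) B T).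
    + intros x. derive_by fail. ring.
    + intros x. apply derive_cst.
    + intros; lra.
    + intros x Hx. specialize (HB x Hx). lra.
    + intros x. apply Hk.
    + intros x. specialize (Hk x). specialize (HN x).
      match goal with |- _ <= n * (?X / n) => replace (n * (X / n)) with X by (field; lra) end.
      assert (/ rl * g <= / rl * (k - Rmin (u x / v x) Q)) by mono. lra.
Qed.

Hypotheses (HkapP : kap * pq_slope <= P) (HkapQ : kap * pq_slope <= Q).
Hypothesis Hns : ze * (n * gain_ds lam be rl La gh * r_slope) <= 1.

(** Beyond t = 1 / 2 the clamp itself is below m' e^(2t), so a clamped variable is O(e^(2t)) on the
    whole line. *)
Lemma clamped_slope (m m' t : R) : 0 < m' -> kap * pq_slope <= m' ->
  (t <= 1 / 2 -> m <= kap * pq_slope * exp (2 * t)) -> Rmin m m' <= m' * exp (2 * t).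
Proof.
  intros Hm' Hk H. assert (E := exp_pos (2 * t)). destruct (Rle_dec t (1 / 2)) as [Ht|Ht].
  - eapply Rle_trans; [apply Rmin_l|]. eapply Rle_trans; [now apply H|].
    apply Rmult_le_compat_r; lra.
  - eapply Rle_trans; [apply Rmin_r|]. assert (H1 := exp_ge_1_plus (2 * t)).
    rewrite <- (Rmult_1_r m') at 1. apply Rmult_le_compat_l; lra.
Qed.

Lemma s_slope {r y u v rho : R -> R} (t : R) : admissible r -> driven r y u v rho ->
  Rabs (exp (n * ln (r t)) / y t - (ga / be - n / (lam * be * a)))
  <= n * gain_ds lam be rl La gh * (r_slope * exp (2 * t)).
Proof.
  intros Hr Hd.
  rewrite <- (s_const lam be rl rh n ga) by auto.
  apply (s_compare lam be rl rh La gh n ga Hlam Hbe Hrl HLa Hn Hn1 HnLa Hga Hgah Hnga r (fun _ => a) y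
    (fun _ => be * exp ((1 + n) * ln a) / (ga * a - n / lam))
    (fun t => r_slope * exp (2 * t) / 2) (fun t => r_slope * exp (2 * t))).
  - apply (dr_y Hd).
  - now apply y_driven_const.
  - intros z. derive_by fail; lra.
  - intros z.
    assert (0 < r_slope * exp (2 * z)) by pos. lra.
  - apply (ad_slope Hr).
Qed.

(** By [Hka] the constant 1 / a solves the equation of rho when p = q = 0 and s has its value at M0.
    The remaining forcing is at most F e^(2t), and the factor 2 in 2 F / g again absorbs n S'. *)
Lemma rho_slope {r y u v rho : R -> R} : admissible r -> driven r y u v rho -> forall t,
  Rabs (rho t - / a) <= 2 * (Q / rl + lam * P + 1) / g * exp (2 * t).
Proof.
  intros Hr Hd. assert (Hk := fun t => k_minus_q t Hd).
  assert (Hrho := dr_rho Hd).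
  assert (Hrg := rho_range Hd).
  assert (Ha0 : 0 < a) by lra.
  assert (Hia := Rinv_0_lt_compat _ Ha0).
  assert (Hial : / a <= / rl) by (apply Rinv_le_contravar; lra).
  set (F := Q / rl + lam * P + 1).
  assert (HF0 : 0 < F) by pos.
  assert (HF : forall t, Rabs (Rmin (u t / v t) Q * / a + (N_of r y v t - k * / a)) <= F * exp (2 * t)).
  { intros x. specialize (Hk x).
    assert (Hs := s_slope x Hr Hd).
    assert (Hka' : k * / a = ze * (ga / be - n / (lam * be * a)) - Bm) by (rewrite Hka; field; lra).
    rewrite Hka'. unfold N_of.
    set (s := exp (n * ln (r x)) / y x) in *. set (s0 := ga / be - n / (lam * be * a)) in *.
    assert (Hq1 : Rmin (u x / v x) Q <= Q * exp (2 * x)).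
    { apply clamped_slope; auto. intros Hx. now apply (pq_small Hr Hd). }
    assert (Hp1 : Rmin (/ v x) P <= P * exp (2 * x)).
    { apply clamped_slope; auto. intros Hx. now apply (pq_small Hr Hd). }
    set (q := Rmin (u x / v x) Q) in *. set (p := Rmin (/ v x) P) in *.
    replace (q * / a + (lam * p + ze * s - Bm - (ze * s0 - Bm))) with (q * / a + lam * p + ze * (s - s0)) by ring.
    eapply Rle_trans; [apply Rabs_triang|].
    assert (0 <= q * / a + lam * p) by pos.
    rewrite Rabs_right by lra. rewrite Rabs_mult, (Rabs_right ze) by lra.
    assert (q * / a <= Q * exp (2 * x) * / rl) by mono.
    assert (lam * p <= lam * (P * exp (2 * x))) by mono.
    assert (ze * Rabs (s - s0) <= ze * (n * gain_ds lam be rl La gh * (r_slope * exp (2 * x))))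
      by mono.
    assert (ze * (n * gain_ds lam be rl La gh * r_slope) * exp (2 * x) <= 1 * exp (2 * x))
      by mono.
    unfold F, Rdiv. lra. }
  assert (Hsup : forall x, F * exp (2 * x) <= g * (2 * F / g * exp (2 * x)) - n * (2 * F / g * (2 * exp (2 * x)))).
  { intros x.
    assert (Hn4 : n * 4 <= g / 2) by nra.
    replace (g * (2 * F / g * exp (2 * x)) - n * (2 * F / g * (2 * exp (2 * x))))
      with ((2 - n * 4 / g) * (F * exp (2 * x))) by (field; lra).
    assert (n * 4 / g <= 1 / 2) by (apply Rle_div_l; lra).
    assert (0 < F * exp (2 * x)) by pos. nra. }
  apply (fast_comparison_abs (fun t => rho t - / a)
    (fun t => (rho t * (k - Rmin (u t / v t) Q) - N_of r y v t) / n)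
    (fun x => 2 * F / g * exp (2 * x)) (fun x => 2 * F / g * (2 * exp (2 * x)))
    (fun t => k - Rmin (u t / v t) Q) (/ rl) 0); auto.
  - intros x. derive_by fail. ring.
  - intros x. derive_by fail; try lra.
  - intros x. apply Rmult_le_pos; [|left; apply exp_pos]. apply Rdiv_le_0_compat; lra.
  - intros x _. specialize (Hrg x). assert (Hi := Rinv_0_lt_compat _ rh_pos). apply Rabs_le. lra.
  - intros x. apply Hk.
  - intros x. specialize (HF x). specialize (Hsup x).
    match goal with |- Rabs (n * (?X / n) - ?Z) <= _ =>
      replace (n * (X / n) - Z) with (- (Rmin (u x / v x) Q * / a + (N_of r y v x - k * / a))) by (field; lra) end.
    rewrite Rabs_Ropp. lra.
Qed.

Lemma driven_exists (r : R -> R) : admissible r -> exists y u v rho, driven r y u v rho.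
Proof.
  intros Had. destruct Had as [Hc Hr Hs] eqn:E. clear E.
  destruct (y_driven_exists lam be rl rh La n ga Hlam Hbe Hrl HLa Hn Hga Hnga r Hc Hr) as [y Hy]. assert (Hik := Rinv_0_lt_compat kap Hkap).
  assert (Hsl0 : 0 < r_slope / lam) by pos.
  (* Before T one has (r - a) / lam >= - 1 / 2, which keeps the equations of u and v damped with
     rates at least 1 / 2 and 1. *)
  destruct (exp_2t_small (r_slope / lam) (1 / 2) 0) as [T [_ HT]]; [lra|].
  assert (HT' : forall t, t <= T -> - (1 / 2) <= (r t - a) / lam).
  { intros t Ht. assert (H := rdev_slope r t Had).
    assert (exp (2 * t) <= exp (2 * T)) by (apply exp_le; lra). nra. }
  assert (Hbrt : forall t, 0 < b * r t <= b * rh).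
  { intros t. specialize (Hr t). split. apply Rmult_lt_0_compat; lra. apply Rmult_le_compat_l; lra. }
  destruct (linear_ode_from_minf (fun t => - (1 + (r t - a) / lam)) (fun t => b * r t) (1 / 2) (b * rh) T)
    as [u [Hu Hub]].
  - intros t. cont_step fail. lra.
  - intros t. cont_step fail.
  - lra.
  - intros t Ht. specialize (HT' t Ht). lra.
  - intros t Ht. specialize (Hbrt t). rewrite Rabs_right; lra.
  - assert (Hu0 : forall t, 0 < u t).
    { apply (linear_ode_pos (fun t => - (1 + (r t - a) / lam)) (fun t => b * r t) u T); auto.
      - intros t. cont_step fail. lra.
      - intros t. apply Hbrt.
      - apply (linear_ode_nonneg (fun t => - (1 + (r t - a) / lam)) (fun t => b * r t) u (1 / 2) (b * rh / (1 / 2)) T); auto.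
        + intros t. apply Hbrt.
        + lra.
        + intros t Ht. specialize (HT' t Ht). lra. }
    (* The unknown is the bounded remainder w = v - e^(-2t) / kap; its forcing is bounded because (r
       - a) e^(-2t) is. *)
    destruct (linear_ode_from_minf (fun t => - (2 + (r t - a) / lam))
       (fun t => lam * r t + u t - (r t - a) / lam * (exp (- 2 * t) * / kap))
       1 (lam * rh + b * rh / (1 / 2) + r_slope / lam * / kap) T) as [w [Hw Hwb]].
    + intros t. cont_step fail. lra.
    + intros t. cont_step fail. lra.
    + lra.
    + intros t Ht. specialize (HT' t Ht). lra.
    + intros t Ht. specialize (Hub t Ht). specialize (Hr t).
      assert (H1 : Rabs ((r t - a) / lam * (exp (- 2 * t) * / kap)) <= r_slope / lam * / kap).
      { assert (H2 := rdev_slope r t Had). assert (E1 := exp_pos (- 2 * t)).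
        assert (H3 : Rabs ((r t - a) / lam) <= r_slope / lam * exp (2 * t)) by (apply Rabs_le; lra).
        rewrite Rabs_mult, (Rabs_right (exp (- 2 * t) * / kap)) by (apply Rle_ge, Rmult_le_pos; lra).
        apply Rle_trans with (r_slope / lam * exp (2 * t) * (exp (- 2 * t) * / kap)).
        - mono.
        - right. rewrite Rmult_assoc, <- (Rmult_assoc (exp (2 * t))), <- exp_plus.
          replace (2 * t + -2 * t) with 0 by ring. rewrite exp_0. ring. }
      assert (H2 : 0 < lam * r t <= lam * rh) by nra.
      apply Rabs_le_between in Hub. apply Rabs_le_between in H1. apply Rabs_le. lra.
    + set (v := fun t => exp (- 2 * t) / kap + w t).
      assert (Hv : forall t, is_derive v t (- (2 + (r t - a) / lam) * v t + (lam * r t + u t))).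
      { intros t. unfold v. derive_by fail. unfold Rdiv. ring. }
      set (W := lam * rh + b * rh / (1 / 2) + r_slope / lam * / kap) in *.
      assert (Hv0 : forall t, 0 < v t).
      { destruct (exp_2t_small (kap * (W / 1)) 1 T) as [T' [HT1 HT2]]; [lra|].
        apply (linear_ode_pos (fun t => - (2 + (r t - a) / lam)) (fun t => lam * r t + u t) v T'); auto.
        - intros t. cont_step fail. lra.
        - intros t. specialize (Hu0 t). specialize (Hr t).
          assert (0 < lam * r t) by pos. lra.
        - intros t Ht. specialize (Hwb t ltac:(lra)). apply Rabs_le_between in Hwb.
          enough (W / 1 <= exp (- 2 * t) / kap) by (unfold v; lra).
          apply (proj1 (Rle_div_r _ _ kap Hkap)).
          apply (Rmult_le_reg_r (exp (2 * t))). apply exp_pos.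
          rewrite <- exp_plus. replace (-2 * t + 2 * t) with 0 by ring. rewrite exp_0.
          assert (exp (2 * t) <= exp (2 * T')) by (apply exp_le; lra).
          assert (0 <= W / 1 * kap) by pos.
          apply Rle_trans with (W / 1 * kap * exp (2 * T')). now apply Rmult_le_compat_l. lra. }
      assert (Hyc : forall t, continuity_pt y t)
        by (intros t; exact (is_derive_cont _ _ _ (yd_ode Hy t))).
      assert (HN := fun t => N_range r y v t Hy (Hv0 t)).
      assert (Hk0 : 0 < k / rh) by pos.
      assert (Hkq : forall t, g <= k - Rmin (u t / v t) Q).
      { intros t. assert (H1 := Rmin_r (u t / v t) Q). lra. }
      assert (Hqc : forall t, continuity_pt (fun t => (k - Rmin (u t / v t) Q) / n) t).
      { intros t. cont_step fail. apply Rgt_not_eq, Hv0. lra. }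
      assert (HNc : forall t, continuity_pt (fun t => N_of r y v t / n) t).
      { intros t. unfold N_of. specialize (Hr t). specialize (Hv0 t).
        assert (H1 := yd_pos Hy t). cont_step fail; lra. }
      assert (Hgn : 0 < g / n) by pos.
      assert (Hkn : forall x, - ((k - Rmin (u (- x) / v (- x)) Q) / n) <= - (g / n)).
      { intros x. apply Ropp_le_contravar.
        apply Rmult_le_compat_r; auto. pos. }
      assert (HNn : forall x, 0 < N_of r y v (- x) / n).
      { intros x. specialize (HN (- x)). apply Rdiv_lt_0_compat; lra. }
      (* The solution rho bounded at +oo is obtained by solving the reversed, damped equation from
         -oo. *)
      destruct (linear_ode_from_minf (fun t => - ((k - Rmin (u (- t) / v (- t)) Q) / n))
         (fun t => N_of r y v (- t) / n) (g / n) (g / rl / n) 0) as [z [Hz Hzb]]; auto.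
      * intros t. apply (continuity_pt_opp (fun t => (k - Rmin (u (- t) / v (- t)) Q) / n)).
        apply (continuity_pt_neg_comp (fun t => (k - Rmin (u t / v t) Q) / n)), Hqc.
      * intros t. apply (continuity_pt_neg_comp (fun t => N_of r y v t / n)), HNc.
      * intros t _. specialize (HNn t). rewrite Rabs_right by lra.
        apply Rmult_le_compat_r; [pos|apply HN].
      * assert (Hz0 : forall t, 0 < z t).
        { apply (linear_ode_pos (fun t => - ((k - Rmin (u (- t) / v (- t)) Q) / n))
            (fun t => N_of r y v (- t) / n) z 0); auto.
          - intros t. apply (continuity_pt_opp (fun t => (k - Rmin (u (- t) / v (- t)) Q) / n)).
            apply (continuity_pt_neg_comp (fun t => (k - Rmin (u t / v t) Q) / n)), Hqc.
          - apply (linear_ode_nonneg (fun t => - ((k - Rmin (u (- t) / v (- t)) Q) / n))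
              (fun t => N_of r y v (- t) / n) z (g / n) (g / rl / n / (g / n)) 0); auto. }
        exists y, u, v, (fun t => z (- t)). split; auto.
        -- intros t. eapply derive_change; [apply Hu|]. ring.
        -- intros t. eapply derive_change; [apply Hv|]. ring.
        -- intros t. eapply derive_change. apply is_derive_reflect, Hz.
           rewrite Ropp_involutive. field. lra.
        -- exists T. eexists. intros t Ht. eapply Rle_trans; [apply Rle_abs|now apply Hub].
        -- exists T. eexists. intros t Ht. unfold v.
           replace (exp (-2 * t) / kap + w t - exp (-2 * t) / kap) with (w t) by ring. now apply Hwb.
        -- exists 0. eexists. intros t Ht. eapply Rle_trans; [apply Rle_abs|apply Hzb; lra].
Qed.

Hypothesis Hcontract :
  gain_pq * pq_factor + ze * (n * gain_ds lam be rl La gh) <= g / (4 * (rh * rh)).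

Lemma inv_rho_range {r y u v rho : R -> R} (t : R) : driven r y u v rho -> rl <= / rho t <= rh.
Proof.
  intros Hd. destruct (rho_range Hd t) as [H1 H2].
  assert (Hi := Rinv_0_lt_compat _ rh_pos). split.
  - rewrite <- (Rinv_inv rl). apply Rinv_le_contravar; lra.
  - rewrite <- (Rinv_inv rh). apply Rinv_le_contravar; lra.
Qed.

Lemma inv_rho_admissible {r y u v rho : R -> R} : admissible r -> driven r y u v rho ->
  admissible (fun t => / rho t).
Proof.
  intros Hr Hd. split.
  - intros t. assert (Hp := dr_rho_pos Hd t). assert (D := dr_rho Hd).
    cont_step fail. lra.
  - intros t. eapply inv_rho_range, Hd.
  - intros t. assert (Hrg := inv_rho_range t Hd). assert (Hp := dr_rho_pos Hd t).
    assert (Hsl := rho_slope Hr Hd t).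
    replace (/ rho t - a) with (/ rho t * (a * (- (rho t - / a)))) by (field; lra).
    rewrite !Rabs_mult, Rabs_Ropp, (Rabs_right (/ rho t)), (Rabs_right a) by lra.
    unfold r_slope. rewrite !Rmult_assoc.
    apply Rmult_le_compat; try lra. pos.
    apply Rmult_le_compat; try lra. apply Rabs_pos.
Qed.

Theorem operator_fixpoint : exists r y u v rho,
  admissible r /\ driven r y u v rho /\ forall t, r t = / rho t.
Proof.
  (* Choice turns the relation between r and 1 / rho into an operator on all functions; its value on
     functions that are not admissible is a dummy. *)
  assert (Hch : forall r, exists r', admissible r ->
     exists y u v rho, driven r y u v rho /\ forall t, r' t = / rho t).
  { intros r. destruct (excluded_middle_informative (admissible r)) as [Hr|Hr].
    - destruct (driven_exists r Hr) as [y [u [v [rho Hd]]]].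
      exists (fun t => / rho t). intros _. exists y, u, v, rho. auto.
    - exists r. intros H. contradiction. }
  set (T := fun r => proj1_sig (constructive_indefinite_description _ (Hch r))).
  assert (HT : forall r, admissible r -> exists y u v rho, driven r y u v rho /\ forall t, T r t = / rho t).
  { intros r Hr. exact (proj2_sig (constructive_indefinite_description _ (Hch r)) Hr). }
  assert (Hext : forall r r', (forall t, r t = r' t) -> admissible r -> admissible r').
  { intros r r' E [Hc Hr Hs]. split.
    - intros t. now apply (continuity_pt_ext_val r).
    - intros t. rewrite <- E. auto.
    - intros t. rewrite <- E. auto. }
  assert (HTa : forall r, admissible r -> admissible (T r)).
  { intros r Hr. destruct (HT r Hr) as [y [u [v [rho [Hd E]]]]].
    apply (Hext (fun t => / rho t)); auto. now apply (inv_rho_admissible Hr Hd). }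
  assert (Hsl := r_slope_pos).
  assert (Ha0 : admissible (fun _ => a)).
  { split; auto. intros t. cont_step fail.
    intros t. rewrite Rminus_diag, Rabs_R0. pos. }
  assert (Hlip : forall r r' d, admissible r -> admissible r' -> 0 <= d ->
     (forall t, Rabs (r t - r' t) <= d * Om K t) -> forall t, Rabs (T r t - T r' t) <= d / 2 * Om K t).
  { intros r r' d Hr Hr' Hd0 Hw t.
    destruct (HT r Hr) as [y [u [v [rho [Hd E]]]]].
    destruct (HT r' Hr') as [y' [u' [v' [rho' [Hd' E']]]]]. rewrite E, E'.
    assert (R1 := inv_rho_range t Hd). assert (R2 := inv_rho_range t Hd').
    assert (Hp := dr_rho_pos Hd t). assert (Hp' := dr_rho_pos Hd' t).
    assert (Hw' : forall t, Rabs (r' t - r t) <= d * Om K t) by (intros x; rewrite Rabs_minus_sym; auto).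
    assert (H := rho_contract d Hr' Hr Hd' Hd Hd0 Hw'
      (fun x => proj2 (rho_range Hd x)) t).
    replace (/ rho t - / rho' t) with (/ rho t * / rho' t * (rho' t - rho t)) by (field; lra).
    set (F := gain_pq * pq_factor + ze * (n * gain_ds lam be rl La gh)) in *.
    assert (HOm : 0 <= d * Om K t) by pos.
    assert (Hrr : 0 < / rho t * / rho' t <= rh * rh) by nra.
    (* Origin of the 4 in [Hcontract]: a factor 2 from [rho_contract] and the contraction rate 1 /
       2. The square of rh comes from passing from rho to 1 / rho. *)
    assert (HF : 2 * F / g <= 1 / (2 * (rh * rh))).
    { apply Rle_trans with (2 * (g / (4 * (rh * rh))) / g).
      apply Rmult_le_compat_r; [pos|lra]. right; field; lra. }
    assert (H2 : Rabs (rho' t - rho t) <= 1 / (2 * (rh * rh)) * (d * Om K t)) by nra.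
    assert (H3 : 0 <= 1 / (2 * (rh * rh)) * (d * Om K t)) by pos.
    rewrite Rabs_mult, (Rabs_right (/ rho t * / rho' t)) by lra.
    apply Rle_trans with (/ rho t * / rho' t * (1 / (2 * (rh * rh)) * (d * Om K t))).
    - nra.
    - apply Rle_trans with (rh * rh * (1 / (2 * (rh * rh)) * (d * Om K t))).
      apply Rmult_le_compat_r; lra. right; field; lra. }
  assert (HOmp : forall t, 0 < Om K t).
  { intros t. unfold Om. assert (H1 := exp_pos (2 * t)). assert (H2 := exp_pos (K * t)). lra. }
  destruct (weighted_fixpoint admissible T (Om K) (fun _ => a) r_slope) as [r [Hr E]]; auto.
  - lra.
  - intros t. eapply Rle_trans; [apply (ad_slope (HTa _ Ha0))|].
    apply Rmult_le_compat_l; [lra|]. unfold Om. assert (H := exp_pos (K * t)). lra.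
  - intros x s C Hs Hx. split.
    + intros t. apply (continuity_pt_limit x s (Om K) C); auto.
      * assert (D := derive_Om K). cont_step fail.
      * intros j. apply (ad_cont (Hs j)).
    + intros t. split; apply (le_of_half_pow _ _ (C * Om K t)); intros j; specialize (Hx j t);
        apply Rabs_le_between in Hx; assert (H := ad_range (Hs j) t); lra.
    + intros t. apply (le_of_half_pow _ _ (C * Om K t)). intros j. specialize (Hx j t).
      assert (H := ad_slope (Hs j) t). assert (H1 := Rabs_triang (x t - s j t) (s j t - a)).
      replace (x t - s j t + (s j t - a)) with (x t - a) in H1 by ring. lra.
  - destruct (HT r Hr) as [y [u [v [rho [Hd E']]]]].
    exists r, y, u, v, rho. split; [exact Hr|]. split; [exact Hd|].
    intros t. rewrite <- E'. symmetry. apply E.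
Qed.

(** The deviation x = u - b a obeys x' = - x + O(e^(2t)), with C e^(2t) as a supersolution. This
    limit of q / p is the component b r0 of the eigenvector. *)
Lemma u_asymptotic {r y u v rho : R -> R} : admissible r -> driven r y u v rho ->
  exists C T, forall t, t <= T -> Rabs (u t - b * a) <= C * exp (2 * t).
Proof.
  intros Hr Hd. assert (Hu := dr_u Hd). assert (Hu0 := dr_u_pos Hd).
  destruct (dr_u_bd Hd) as [T [B HB]]. assert (Hsl := r_slope_pos).
  assert (HB0 : 0 < B) by (specialize (HB T (Rle_refl _)); specialize (Hu0 T); lra).
  set (C := (b + B * / lam) * r_slope).
  exists C, T.
  assert (Hdu : forall x, x <= T -> exists w, Rabs w <= C * exp (2 * x) /\
     b * r x - u x * (1 + (r x - a) / lam) = - (u x - b * a) + w).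
  { intros x Hx. exists ((b + - (u x * / lam)) * (r x - a)). split.
    - rewrite Rabs_mult. unfold C. rewrite Rmult_assoc.
      apply Rmult_le_compat; auto using Rabs_pos; [|apply (ad_slope Hr)].
      specialize (HB x Hx). specialize (Hu0 x).
      assert (0 < u x * / lam) by pos.
      assert (u x * / lam <= B * / lam) by mono. apply Rabs_le. lra.
    - field. lra. }
  intros t Ht. apply Rabs_le_sign. intros sg Hsg.
  enough (sg * (u t - b * a) - C * exp (2 * t) <= 0) by lra.
  apply (bounded_decay_nonpos (fun t => sg * (u t - b * a) - C * exp (2 * t))
    (fun x => sg * (b * r x - u x * (1 + (r x - a) / lam)) - C * (2 * exp (2 * x))) 1 (B + b * a) t); try lra.
  - intros x. derive_by fail. ring.
  - intros x Hx. specialize (HB x ltac:(lra)). specialize (Hu0 x).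
    assert (0 <= C * exp (2 * x)) by pos.
    assert (0 < b * a) by pos. destruct Hsg as [-> | ->]; lra.
  - intros x Hx Hp. destruct (Hdu x ltac:(lra)) as [w [Hw ->]]. apply (sign_mul_range sg _ _ Hsg) in Hw. lra.
Qed.

Lemma p_asymptotic {r y u v rho : R -> R} : admissible r -> driven r y u v rho ->
  exists C T, forall t, t <= T -> Rabs (/ v t * exp (- 2 * t) - kap) <= C * exp (2 * t).
Proof.
  intros Hr Hd. assert (Hv0 := dr_v_pos Hd).
  destruct (dr_v_bd Hd) as [T [B HB]].
  exists (kap * pq_slope * kap * B), (Rmin T (1 / 2)). intros t Ht.
  min_bounds T (1 / 2).
  assert (Hv := v_asymptotic v T B t HB ltac:(lra)).
  destruct (pq_small Hr Hd t ltac:(lra)) as [Hp _].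
  specialize (Hv0 t). assert (Hiv := Rinv_0_lt_compat _ Hv0). assert (E2 := exp_pos (- 2 * t)).
  assert (E3 : exp (2 * t) * exp (- 2 * t) = 1).
  { rewrite <- exp_plus. replace (2 * t + -2 * t) with 0 by ring. apply exp_0. }
  assert (Hpt : / v t * exp (- 2 * t) <= kap * pq_slope).
  { apply Rle_trans with (kap * pq_slope * exp (2 * t) * exp (- 2 * t)).
    apply Rmult_le_compat_r; lra. right. rewrite Rmult_assoc, E3. ring. }
  replace (/ v t * exp (-2 * t) - kap)
    with (/ v t * exp (- 2 * t) * kap * - (v t * exp (2 * t) - / kap)).
  - rewrite !Rabs_mult, Rabs_Ropp, (Rabs_right (/ v t)), (Rabs_right (exp _)), (Rabs_right kap) by lra.
    replace (kap * pq_slope * kap * B * exp (2 * t)) with (kap * pq_slope * kap * (B * exp (2 * t))) by ring.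
    apply Rmult_le_compat; auto using Rabs_pos.
    + pos.
    + nra.
  - replace (/ v t * exp (-2 * t) * kap * - (v t * exp (2 * t) - / kap))
      with (/ v t * exp (- 2 * t) - kap * (exp (2 * t) * exp (- 2 * t))) by (field; lra).
    rewrite E3. ring.
Qed.

Set Implicit Arguments.
(** All that is used of the fixed point from here on. The auxiliary u is kept for the ratio q / p at
    -oo, and y for the limit at +oo, where ln y is the attracting component. *)
Record clamped_orbit (p q r s u y : R -> R) : Prop := {
  co_y : y_driven lam be rl rh n ga r y;
  co_s_def : forall t, s t = exp (n * ln (r t)) / y t;
  co_p : forall t, is_derive p t (p t * (1 / lam * (r t - a) + 2 - lam * p t * r t - q t));
  co_q : forall t, is_derive q t (q t * (1 - lam * p t * r t - q t) + b * p t * r t);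
  co_r : forall t, is_derive r t
    (r t * (- (k - Rmin (q t) Q) + r t * (lam * Rmin (p t) P + ze * s t - Bm)) / n);
  co_s : forall t, is_derive s t
    (s t * (- (k - Rmin (q t) Q) + r t * (lam * Rmin (p t) P + ze * s t - Bm)
            - be * r t * s t + ga * r t - n / lam));
  co_p_pos : forall t, 0 < p t;
  co_q_pos : forall t, 0 < q t;
  co_p_max : forall t, p t <= p_max;
  co_q_max : forall t, q t <= q_max;
  co_pq_small : forall t, t <= 1 / 2 ->
    p t <= kap * pq_slope * exp (2 * t) /\ q t <= kap * pq_slope * exp (2 * t);
  co_r_slope : forall t, Rabs (r t - a) <= r_slope * exp (2 * t);
  co_s_slope : forall t, Rabs (s t - (ga / be - n / (lam * be * a)))
    <= n * gain_ds lam be rl La gh * (r_slope * exp (2 * t));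
  co_s_near : forall t, Rabs (s t - ga / be) <= n * gain_s lam be rl La gh;
  co_q_def : forall t, q t = u t * p t;
  co_u_lim : exists C T, forall t, t <= T -> Rabs (u t - b * a) <= C * exp (2 * t);
  co_p_lim : exists C T, forall t, t <= T -> Rabs (p t * exp (- 2 * t) - kap) <= C * exp (2 * t) }.
Unset Implicit Arguments.

Theorem clamped_orbit_exists : exists p q r s u y, clamped_orbit p q r s u y.
Proof.
  destruct operator_fixpoint as [r [y [u [v [rho [Hr [Hd E]]]]]]].
  assert (Hy := dr_y Hd). assert (Hy0 := yd_pos Hy).
  assert (Hrg := ad_range Hr).
  assert (Hv0 := dr_v_pos Hd). assert (Hu0 := dr_u_pos Hd).
  assert (Hrho0 := dr_rho_pos Hd). assert (Drho := dr_rho Hd).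
  assert (Dy := yd_ode Hy).
  assert (Dr : forall t, is_derive r t (r t * (- (k - Rmin (u t / v t) Q)
     + r t * (lam * Rmin (/ v t) P + ze * (exp (n * ln (r t)) / y t) - Bm)) / n)).
  { intros t. apply (is_derive_ext (fun t => / rho t)); [intros; auto|].
    eapply derive_change. apply derive_inv_comp; [apply Drho|]. specialize (Hrho0 t); lra.
    unfold N_of. rewrite (E t). specialize (Hrho0 t). specialize (Hy0 t). field. lra. }
  exists (fun t => / v t), (fun t => u t / v t), r, (fun t => exp (n * ln (r t)) / y t), u, y.
  split; auto.
  - intros t. now apply (derive_p Hd).
  - intros t. now apply (derive_q Hd).
  - intros t. specialize (Hrg t). specialize (Hy0 t).
    derive_by fail; try lra. rewrite exp_pow_split by lra. field. lra.
  - intros t. now apply Rinv_0_lt_compat.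
  - intros t. now apply Rdiv_lt_0_compat.
  - now apply (p_bound Hr Hd).
  - now apply (q_bound Hr Hd).
  - now apply (pq_small Hr Hd).
  - apply (ad_slope Hr).
  - intros t. now apply (s_slope t Hr Hd).
  - intros t. apply (s_near lam be rl rh La gh n ga) with (r := r); auto.
  - now apply (u_asymptotic Hr Hd).
  - now apply (p_asymptotic Hr Hd).
Qed.
End Operator.

(* A linear barrier started at [t0] traps the repelling variable: it may lag behind its
   quasi-equilibrium [Np / kk] only by O(n). *)
Lemma slow_tracking (rho kk N Np : R -> R) (n g L rm rmax e0 t0 : R) :
  0 < n -> 0 < g -> 0 <= L ->
  (forall t, is_derive rho t ((rho t * kk t - N t) / n)) ->
  (forall t, g <= kk t) -> (forall t, 0 <= rho t <= rmax) ->
  (forall t, t0 <= t -> Rabs (kk t - kk t0) <= L * (t - t0)) ->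
  (forall t, t0 <= t -> Rabs (Np t - Np t0) <= L * (t - t0)) ->
  (forall t, Rabs (N t - Np t) <= n * e0) -> 0 <= Np t0 -> Np t0 <= rm * kk t0 ->
  Rabs (rho t0 - Np t0 / kk t0) <= (e0 + (L * rm + L) / g) / g * n.
Proof.
  intros Hn Hg HL Hd Hk Hb HLk HLN HN Hp0 Hp.
  (* The barrier has half-width C0 n + M (t - t0) around the quasi-equilibrium rb frozen at t0: M
     absorbs the drift of [kk] and [Np], and C0 absorbs e0 and the slope M itself. *)
  set (M := (L * rm + L) / g). set (C0 := (e0 + M) / g). set (rb := Np t0 / kk t0).
  assert (Hk0 := Hk t0).
  assert (Erb : rb * kk t0 = Np t0) by (unfold rb; field; lra).
  assert (Hrb : 0 <= rb) by pos.
  assert (Hrm : rb <= rm) by nra.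
  assert (EM : g * M = L * rm + L) by (unfold M; field; lra).
  assert (HM : 0 <= M) by pos.
  assert (EC : g * C0 = e0 + M) by (unfold C0; field; lra).
  assert (He0 : 0 <= e0).
  { assert (H := Rle_trans _ _ _ (Rabs_pos _) (HN t0)). nra. }
  assert (HC : 0 <= C0) by pos.
  apply Rabs_le_sign. intros sg Hsg.
  enough (sg * (rho t0 - rb) - (C0 * n + M * (t0 - t0)) <= 0) by nra.
  apply (bounded_growth_nonpos (fun t => sg * (rho t - rb) - (C0 * n + M * (t - t0)))
    (fun t => sg * ((rho t * kk t - N t) / n) - M) (g / n) (rmax + rb) t0).
  - intros x. derive_by fail. ring.
  - pos.
  - intros x Hx. specialize (Hb x). assert (0 <= C0 * n) by nra. assert (0 <= M * (x - t0)) by nra.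
    destruct Hsg as [-> | ->]; lra.
  - intros x Hx Hpos. specialize (HLk x Hx). specialize (HLN x Hx). specialize (HN x). specialize (Hk x).
    set (tau := x - t0) in *. assert (Htau : 0 <= tau) by (unfold tau; lra).
    set (f := sg * (rho x - rb) - (C0 * n + M * tau)) in *.
    assert (Hdev : Rabs (kk x * rb - N x) <= L * tau * rb + L * tau + n * e0).
    { apply Rabs_le_between in HLk. apply Rabs_le_between in HLN. apply Rabs_le_between in HN.
      apply Rabs_le. nra. }
    apply (sign_mul_range sg) in Hdev; auto.
    apply (Rmult_le_reg_l n); auto.
    replace (n * (g / n * f)) with (g * f) by (field; lra).
    replace (n * (sg * ((rho x * kk x - N x) / n) - M))
      with (kk x * f + (sg * (kk x * rb - N x) + kk x * (C0 * n + M * tau) - n * M)) by (unfold f; field; lra).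
    assert (g * f <= kk x * f) by mono.
    assert (g * (C0 * n + M * tau) <= kk x * (C0 * n + M * tau)) by mono.
    assert (g * (C0 * n + M * tau) = (e0 + M) * n + (L * rm + L) * tau) by nra.
    assert (L * tau * rb <= L * tau * rm) by mono.
    lra.
Qed.

(** * Crossings, stability and small gain toward +oo *)

Lemma lipschitz_of_derive (f df : R -> R) (L : R) :
  (forall t, is_derive f t (df t)) -> (forall t, Rabs (df t) <= L) ->
  forall s t, s <= t -> Rabs (f t - f s) <= L * (t - s).
Proof.
  intros Hd HL s t Hst.
  destruct (MVT_gen f s t df) as [z [_ E]].
  - intros z _. apply Hd.
  - intros z _. exact (is_derive_cont _ _ _ (Hd z)).
  - rewrite E, Rabs_mult, (Rabs_right (t - s)) by lra. apply Rmult_le_compat_r; auto. lra.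
Qed.

Lemma first_crossing (f : R -> R) (x y w : R) :
  x <= y -> (forall z, continuity_pt f z) -> w < f x -> f y < w ->
  exists z, x <= z <= y /\ f z = w /\ forall z', x <= z' <= z -> w <= f z'.
Proof.
  intros Hxy Hc Hx Hy.
  destruct (last_crossing (fun t => f (- t)) (- y) (- x) w) as [z [Hz [E H]]].
  - lra.
  - intros z _. apply continuity_pt_neg_comp, Hc.
  - now rewrite Ropp_involutive.
  - now rewrite Ropp_involutive.
  - exists (- z). split; [lra|]. split; auto.
    intros z' Hz'. specialize (H (- z') ltac:(lra)). now rewrite Ropp_involutive in H.
Qed.

(** At the first return to the level w the function arrives from above, so its difference quotients
    from the left are nonpositive, against df > 0. *)
Lemma stay_above (f df : R -> R) (w t1 t : R) :
  (forall x, is_derive f x (df x)) -> (forall x, f x = w -> 0 < df x) ->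
  w < f t1 -> t1 <= t -> w <= f t.
Proof.
  intros Hd Hw H1 Ht. apply Rnot_lt_le. intros Hlt.
  destruct (first_crossing f t1 t w) as [z [Hz [E H]]]; auto.
  { intros z. exact (is_derive_cont _ _ _ (Hd z)). }
  assert (Hz1 : t1 < z) by (destruct (Req_dec t1 z); [subst; lra|lra]).
  assert (D := Hd z). apply is_derive_Reals in D.
  destruct (D (df z) (Hw z E)) as [d Hdd].
  set (h := - Rmin (d / 2) (z - t1)).
  min_bounds (d / 2) (z - t1).
  assert (Hd0 := cond_pos d).
  assert (Hm0 : 0 < Rmin (d / 2) (z - t1)) by (apply Rmin_pos; lra).
  assert (Hh : h < 0) by (unfold h; lra).
  specialize (Hdd h ltac:(lra)). rewrite (Rabs_left h) in Hdd by lra.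
  specialize (Hdd ltac:(unfold h; lra)).
  assert (H2 : w <= f (z + h)) by (apply H; unfold h; lra).
  rewrite E in Hdd. apply Rabs_def2 in Hdd. destruct Hdd as [_ Hdd].
  assert ((f (z + h) - w) / h <= 0); [|lra].
  replace ((f (z + h) - w) / h) with (- ((f (z + h) - w) * / (- h))) by (field; lra).
  assert (0 <= (f (z + h) - w) * / (- h)) by pos. lra.
Qed.

(** Inside the strip z rises at speed at least gam. It cannot leave through the bottom, passes the
    top within time (2 del + 1) / gam, and cannot come back. *)
Lemma cross_strip (z dz : R -> R) (del gam t1 : R) :
  (forall x, is_derive z x (dz x)) -> 0 < gam ->
  (forall x, - del <= z x <= del -> gam <= dz x) -> - del < z t1 -> 0 < del ->
  exists t2, t1 <= t2 /\ forall t, t2 <= t -> del <= z t.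
Proof.
  intros Hd Hg Hs H1 Hdel.
  assert (Hlow : forall t, t1 <= t -> - del <= z t).
  { intros t Ht. apply (stay_above z dz (- del) t1); auto.
    intros x Hx. specialize (Hs x). lra. }
  assert (Hex : exists t2, t1 <= t2 /\ del < z t2).
  { apply NNPP. intros Hno.
    assert (Hup : forall t, t1 <= t -> z t <= del).
    { intros t Ht. apply Rnot_lt_le. intros Hlt. apply Hno. exists t. auto. }
    set (t := t1 + (2 * del + 1) / gam).
    assert (0 < (2 * del + 1) / gam) by pos.
    assert (Ht : t1 <= t) by (unfold t; lra).
    assert (H2 : z t1 - gam * t1 <= z t - gam * t).
    { apply (derive_nondecreasing (fun x => z x - gam * x) (fun x => dz x - gam)); auto.
      - intros x _. derive_by fail. ring.
      - intros x Hx. specialize (Hs x (conj (Hlow x (proj1 Hx)) (Hup x (proj1 Hx)))). lra. }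
    assert (E : gam * (t - t1) = 2 * del + 1) by (unfold t; field; lra).
    specialize (Hup t Ht). clearbody t. lra. }
  destruct Hex as [t2 [Ht2 Hz2]]. exists t2. split; auto.
  intros t Ht. apply (stay_above z dz del t2); auto. intros x Hx. specialize (Hs x). lra.
Qed.

(** Comparison with X + m e^(-k (x - T)); the maximum with 1 keeps m positive. *)
Lemma stable_pinf (f df : R -> R) (k X T : R) :
  (forall x, is_derive f x (df x)) -> 0 < k ->
  (forall x, T <= x -> X < f x -> df x <= - k * (f x - X)) ->
  forall eps, 0 < eps -> exists T', T <= T' /\ forall x, T' <= x -> f x <= X + eps.
Proof.
  intros Hd Hk H eps Heps.
  set (m := Rmax (f T - X) 1). assert (Hm : 1 <= m) by apply Rmax_r. assert (Hm' : f T - X <= m) by apply Rmax_l.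
  assert (Hb : forall x, T <= x -> (f x - X) - m * exp (- k * (x - T)) <= 0).
  { intros x Hx.
    apply (nonpos_forward (fun x => (f x - X) - m * exp (- k * (x - T)))
      (fun x => df x + k * (m * exp (- k * (x - T)))) T); auto.
    - intros y. derive_by fail. ring.
    - replace (- k * (T - T)) with 0 by ring. rewrite exp_0. lra.
    - intros y Hy Hp.
      assert (0 < m * exp (- k * (y - T))) by pos.
      specialize (H y (proj1 Hy) ltac:(lra)). nra. }
  set (T' := T + Rmax 0 (ln (m / eps) / k)).
  exists T'. split. unfold T'. assert (H1 := Rmax_l 0 (ln (m / eps) / k)). lra.
  intros x Hx. assert (H1 := Rmax_l 0 (ln (m / eps) / k)). assert (H2 := Rmax_r 0 (ln (m / eps) / k)).
  specialize (Hb x ltac:(unfold T' in Hx; lra)).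
  enough (m * exp (- k * (x - T)) <= eps) by lra.
  assert (H3 : ln (m / eps) <= k * (x - T)).
  { apply Rle_trans with (k * (ln (m / eps) / k)). right; field; lra.
    apply Rmult_le_compat_l; unfold T' in Hx; lra. }
  apply Rle_trans with (m * exp (- ln (m / eps))).
  - apply Rmult_le_compat_l; [lra|]. apply exp_le. lra.
  - rewrite exp_Ropp, exp_ln by pos. right; field; lra.
Qed.

(** Applied with E X stating that X is an eventual bound of a function, this replaces the argument
    on the limit superior. *)
Lemma halving_to_zero (E : R -> Prop) (B : R) :
  (forall x y, E x -> x <= y -> E y) -> 0 < B -> E B ->
  (forall X, 0 < X -> E X -> E (X / 2)) -> forall eps, 0 < eps -> E eps.
Proof.
  intros Hmon HB H0 Hstep eps Heps.
  destruct (half_pow_small B eps Heps) as [j Hj].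
  apply (Hmon (B * (/ 2) ^ j)); [|lra]. clear Hj.
  induction j; simpl. now rewrite Rmult_1_r.
  replace (B * (/ 2 * (/ 2) ^ j)) with (B * (/ 2) ^ j / 2) by field.
  apply Hstep; auto. apply Rmult_lt_0_compat; auto. apply pow_lt; lra.
Qed.

(* A repelling component f and an attracting component h, weakly coupled: small-gain argument. *)
Lemma small_gain_pinf (f df h dh eta : R -> R) (kf kh Bf Bh M T0 : R) :
  (forall x, is_derive f x (df x)) -> (forall x, is_derive h x (dh x)) ->
  0 < kf -> 0 < kh -> 0 <= Bf -> 0 <= Bh -> Bf * Bh <= kf * kh / 4 ->
  (forall x, T0 <= x -> Rabs (f x) <= M) ->
  (forall x sg, T0 <= x -> sg = 1 \/ sg = -1 -> 0 < sg * f x ->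
     kf * (sg * f x) - Bf * Rabs (h x) - eta x <= sg * df x) ->
  (forall x sg, T0 <= x -> sg = 1 \/ sg = -1 -> 0 < sg * h x ->
     sg * dh x <= - kh * (sg * h x) + Bh * Rabs (f x) + eta x) ->
  (forall eps, 0 < eps -> exists T, forall x, T <= x -> eta x <= eps) ->
  forall eps, 0 < eps -> exists T, forall x, T <= x -> Rabs (f x) <= eps /\ Rabs (h x) <= eps.
Proof.
  intros Df Dh Hkf Hkh HBf HBh Hgain HM Hf1 Hh1 Heta.
  assert (Hh : forall X e, 0 <= X -> 0 < e -> (exists T, forall x, T <= x -> Rabs (f x) <= X) ->
    exists T, T0 <= T /\ forall x, T <= x -> Rabs (h x) <= Bh * X / kh + e).
  { intros X e HX He [T1 HT1]. destruct (Heta (kh * (e / 2))) as [T2 HT2]; [pos|].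
    set (T := Rmax T0 (Rmax T1 T2)).
    assert (M1 := Rmax_l T0 (Rmax T1 T2)). assert (M2 := Rmax_r T0 (Rmax T1 T2)).
    assert (M3 := Rmax_l T1 T2). assert (M4 := Rmax_r T1 T2). fold T in M1, M2.
    set (Y := Bh * X / kh + e / 2).
    assert (EY : kh * Y = Bh * X + kh * (e / 2)) by (unfold Y; field; lra).
    assert (HY : 0 < Y) by nra.
    assert (Hone : forall sg, sg = 1 \/ sg = -1 -> exists T', T <= T' /\ forall x, T' <= x -> sg * h x <= Y + e / 2).
    { intros sg Hsg. apply (stable_pinf (fun x => sg * h x) (fun x => sg * dh x) kh Y T); auto; try lra.
      { intros x. derive_by fail. ring. }
      intros x Hx Hp. specialize (Hh1 x sg ltac:(lra) Hsg ltac:(lra)). specialize (HT1 x ltac:(lra)).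
      specialize (HT2 x ltac:(lra)).
      assert (Bh * Rabs (f x) <= Bh * X) by mono. lra. }
    destruct (Hone 1) as [T3 [H31 H32]]; auto. destruct (Hone (-1)) as [T4 [H41 H42]]; auto.
    exists (Rmax T3 T4). max_bounds T3 T4. split. lra.
    intros x Hx. specialize (H32 x ltac:(lra)). specialize (H42 x ltac:(lra)).
    unfold Y in *. apply Rabs_le. lra. }
  assert (HM0 : 0 <= M) by (eapply Rle_trans; [apply Rabs_pos|apply (HM T0); lra]).
  assert (Hf : forall eps, 0 < eps -> exists T, forall x, T <= x -> Rabs (f x) <= eps).
  { apply (halving_to_zero (fun X => exists T, forall x, T <= x -> Rabs (f x) <= X) (M + 1)).
    - intros x y [T HT] Hxy. exists T. intros z Hz. specialize (HT z Hz). lra.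
    - lra.
    - exists T0. intros x Hx. specialize (HM x Hx). lra.
    - intros X HX HE.
      (* The margin granted to h, with a 1 that keeps the divisor positive when Bf = 0. The coupling
         then contributes kf X / 4, this margin and eta kf X / 8 each, in total kf X / 2. *)
      assert (Hc : 0 < kf * X / (8 * (Bf + 1))) by pos.
      destruct (Hh X _ (Rlt_le _ _ HX) Hc HE) as [T1 [HT10 HT1]].
      destruct (Heta (kf * X / 8)) as [T2 HT2]. { assert (0 < kf * X) by pos. lra. }
      set (T := Rmax T1 T2). assert (M1 := Rmax_l T1 T2). assert (M2 := Rmax_r T1 T2). fold T in M1, M2.
      assert (Hbd : forall x, T <= x -> Bf * Rabs (h x) + eta x <= kf * (X / 2)).
      { intros x Hx. specialize (HT1 x ltac:(lra)). specialize (HT2 x ltac:(lra)).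
        assert (A1 : Bf * Rabs (h x) <= Bf * (Bh * X / kh + kf * X / (8 * (Bf + 1)))) by mono.
        assert (A2 : Bf * (Bh * X / kh) <= kf * X / 4).
        { replace (Bf * (Bh * X / kh)) with ((Bf * Bh) * (X / kh)) by (field; lra).
          replace (kf * X / 4) with ((kf * kh / 4) * (X / kh)) by (field; lra).
          apply Rmult_le_compat_r; auto. apply Rdiv_le_0_compat; lra. }
        assert (A3 : Bf * (kf * X / (8 * (Bf + 1))) <= kf * X / 8).
        { replace (kf * X / 8) with ((Bf + 1) * (kf * X / (8 * (Bf + 1)))) by (field; lra).
          apply Rmult_le_compat_r; lra. }
        lra. }
      exists T. intros x Hx. apply Rabs_le_sign. intros sg Hsg.
      enough (sg * f x - X / 2 <= 0) by lra.
      apply (bounded_growth_nonpos (fun x => sg * f x - X / 2) (fun x => sg * df x) kf M x); auto.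
      + intros y. derive_by fail; lra.
      + intros y Hy. specialize (HM y ltac:(lra)). apply (sign_mul_range sg) in HM; auto. lra.
      + intros y Hy Hp. specialize (Hf1 y sg ltac:(lra) Hsg ltac:(lra)). specialize (Hbd y ltac:(lra)). lra. }
  intros eps Heps.
  set (X := Rmin eps (kh * eps / (2 * (Bh + 1)))).
  assert (HX1 : X <= eps) by apply Rmin_l.
  assert (HX2 : X <= kh * eps / (2 * (Bh + 1))) by apply Rmin_r.
  assert (HX0 : 0 < X).
  { apply Rmin_pos; auto. apply Rdiv_lt_0_compat; [apply Rmult_lt_0_compat|]; lra. }
  destruct (Hf X HX0) as [T1 HT1].
  destruct (Hh X (eps / 2) (Rlt_le _ _ HX0)) as [T2 [_ HT2]]; [lra|now exists T1|].
  exists (Rmax T1 T2). max_bounds T1 T2.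
  intros x Hx. specialize (HT1 x ltac:(lra)). specialize (HT2 x ltac:(lra)). split; [lra|].
  enough (Bh * X / kh <= eps / 2) by lra.
  apply Rle_div_l; auto.
  assert (Bh * X <= Bh * (kh * eps / (2 * (Bh + 1)))) by mono.
  replace (eps / 2 * kh) with ((Bh + 1) * (kh * eps / (2 * (Bh + 1)))) by (field; lra). lra.
Qed.

(** * The planar system for p and q *)

Section Planar.
Variables lam c a b eps P Q e0 del : R.
Variables p q r e : R -> R.
Hypotheses (Hlam : 0 < lam) (Hc : 0 < c) (Hlc : lam * c < 1) (Ha : 0 < a) (Hb : 0 < b) (Heps : 0 <= eps).
Hypothesis HI1 : a * (1 + lam * c) = 2 + 2 * lam - eps.
Hypothesis HI2 : lam * c * a + b = 1 + lam - eps.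
Hypotheses (HP : 0 < P) (HQ : 1 <= Q) (Hdel : 0 < del).
Hypothesis Hpd : forall t, is_derive p t (p t * (1 / lam * (r t - a) + 2 - lam * p t * r t - q t)).
Hypothesis Hqd : forall t, is_derive q t (q t * (1 - lam * p t * r t - q t) + b * p t * r t).
Hypotheses (Hp0 : forall t, 0 < p t) (Hq0 : forall t, 0 < q t) (Hr0 : forall t, 0 < r t).
Hypothesis Hr : forall t, r t * (c + lam * Rmin (p t) P) = c * a - Rmin (q t) Q + e t.
Hypothesis He : forall t, Rabs (e t) <= e0.
Hypothesis Hpm : forall y T, 0 < y -> exists x, x <= T /\ p x < y.
Hypothesis Hqm : forall y T, 0 < y -> exists x, x <= T /\ q x < y.
Hypothesis HPcond : 2 * c - (2 - eps) * P + e0 * (1 / lam + lam * P) <= 0.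
Hypothesis HQcond : c * a * b - (1 - eps) * Q + e0 * (b + lam * Q) <= 0.

Lemma err_mul (x B t : R) : Rabs x <= B -> Rabs (e t * x) <= e0 * B.
Proof. intros H. rewrite Rabs_mult. apply Rmult_le_compat; auto using Rabs_pos. Qed.

Lemma il_pos : 0 < 1 / lam. Proof. apply Rdiv_lt_0_compat; lra. Qed.

Lemma p_coef_le (t x : R) : 0 <= x <= P -> Rabs (1 / lam - lam * x) <= 1 / lam + lam * P.
Proof.
  intros Hx. assert (H := il_pos). assert (0 <= lam * x <= lam * P) by nra. apply Rabs_le. lra.
Qed.

(** At p = P, eliminating r through the slow manifold relation bounds (c + lam P) p' / p by 2 c - (2
    - eps) P plus the error, which [HPcond] makes nonpositive. *)
Lemma p_le_P (t : R) : p t <= P.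
Proof.
  enough (p t - P <= 0) by lra.
  apply (barrier_nonpos (fun t => p t - P)
    (fun t => p t * (1 / lam * (r t - a) + 2 - lam * p t * r t - q t))).
  - intros x. derive_by fail. ring.
  - intros y Hy. destruct (Hpm P t HP) as [x [Hx Hx']]. exists x. split; auto. split; [lra|].
    intros z _ Hz. specialize (Hr z). rewrite (Rmin_right (p z)) in Hr by lra.
    set (m := Rmin (q z) Q) in *. assert (Hm : m <= q z) by apply Rmin_l.
    assert (Hm0 : 0 < m) by (unfold m; apply Rmin_pos; [auto|lra]).
    specialize (Hp0 z). specialize (Hr0 z).
    assert (Herr := err_mul _ _ z (p_coef_le z P ltac:(lra))). apply Rabs_le_between in Herr.
    assert (Hd : 0 < c + lam * P) by nra.
    assert (Hk : (c + lam * P) * (1 / lam * (r z - a) + 2 - lam * P * r z - m) <= 0).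
    { replace ((c + lam * P) * (1 / lam * (r z - a) + 2 - lam * P * r z - m))
        with ((1 / lam - lam * P) * (r z * (c + lam * P)) + (2 - a / lam - m) * (c + lam * P)) by (field; lra).
      rewrite Hr.
      replace ((1 / lam - lam * P) * (c * a - m + e z) + (2 - a / lam - m) * (c + lam * P))
        with (2 * c + P * (2 * lam - a * (1 + lam * c)) - m * (1 / lam + c) + e z * (1 / lam - lam * P)) by (field; lra).
      rewrite HI1. assert (0 < m * (1 / lam + c)) by pos. lra. }
    assert (lam * P * r z <= lam * p z * r z) by mono.
    set (X := 1 / lam * (r z - a) + 2) in *.
    assert (X - lam * P * r z - m <= 0) by nra.
    assert (0 <= p z * - (X - lam * p z * r z - q z)) by pos. lra.
Qed.

(** At q = Q the same elimination leaves c Q (1 - Q) + p (c a b - (1 - eps) Q) plus the error: hence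
    the requirements Q >= 1 and [HQcond]. *)
Lemma q_le_Q (t : R) : q t <= Q.
Proof.
  enough (q t - Q <= 0) by lra.
  apply (barrier_nonpos (fun t => q t - Q)
    (fun t => q t * (1 - lam * p t * r t - q t) + b * p t * r t)).
  - intros x. derive_by fail. ring.
  - intros y Hy. destruct (Hqm Q t ltac:(lra)) as [x [Hx Hx']]. exists x. split; auto. split; [lra|].
    intros z _ Hz. assert (HpP := p_le_P z). specialize (Hr z).
    rewrite (Rmin_left (p z)), (Rmin_right (q z)) in Hr by lra.
    specialize (Hp0 z). specialize (Hr0 z).
    assert (Hd : 0 < c + lam * p z) by nra.
    assert (Herr : Rabs (e z * (b - lam * Q)) <= e0 * (b + lam * Q)).
    { apply err_mul. apply Rabs_le. nra. }
    apply Rabs_le_between in Herr.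
    assert (Hk : (c + lam * p z) * (Q * (1 - Q) + p z * r z * (b - lam * Q)) <= 0).
    { replace ((c + lam * p z) * (Q * (1 - Q) + p z * r z * (b - lam * Q)))
        with ((c + lam * p z) * (Q * (1 - Q)) + p z * (b - lam * Q) * (r z * (c + lam * p z))) by ring.
      rewrite Hr.
      replace ((c + lam * p z) * (Q * (1 - Q)) + p z * (b - lam * Q) * (c * a - Q + e z))
        with (c * (Q * (1 - Q)) + p z * (c * a * b + Q * (lam - (lam * c * a + b)) + e z * (b - lam * Q))) by ring.
      rewrite HI2.
      assert (0 <= c * (Q * (Q - 1))) by pos.
      assert (0 <= p z * - (c * a * b + Q * (lam - (1 + lam - eps)) + e z * (b - lam * Q))) by pos.
      lra. }
    assert (H1 : Q * (1 - Q) + p z * r z * (b - lam * Q) <= 0) by nra.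
    assert (H2 : p z * r z * (b - lam * q z) <= p z * r z * (b - lam * Q)).
    { apply Rmult_le_compat_l. apply Rmult_le_pos; lra. nra. }
    assert (H3 : q z * (1 - q z) <= Q * (1 - Q)) by nra. lra.
Qed.

Lemma r_unclamped (t : R) : r t * (c + lam * p t) = c * a - q t + e t.
Proof.
  assert (H := Hr t). rewrite !Rmin_left in H; auto. apply q_le_Q. apply p_le_P.
Qed.

(* Up to the O(n) terms, zf = 0 is the p-nullcline, and p' has the sign of - zf. *)
Definition zf (t : R) : R := p t - c + (c + 1 / lam) / 2 * q t.

Lemma p_bracket (t : R) :
  (c + lam * p t) * (1 / lam * (r t - a) + 2 - lam * p t * r t - q t)
  = - 2 * zf t + eps * p t + e t * (1 / lam - lam * p t).
Proof.
  replace ((c + lam * p t) * (1 / lam * (r t - a) + 2 - lam * p t * r t - q t))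
    with ((1 / lam - lam * p t) * (r t * (c + lam * p t)) + (2 - a / lam - q t) * (c + lam * p t)) by (field; lra).
  rewrite r_unclamped.
  replace ((1 / lam - lam * p t) * (c * a - q t + e t) + (2 - a / lam - q t) * (c + lam * p t))
    with (2 * c + p t * (2 * lam - a * (1 + lam * c)) - q t * (1 / lam + c) + e t * (1 / lam - lam * p t)) by (field; lra).
  rewrite HI1. unfold zf. field. lra.
Qed.

(* The first summand is the value on the p-nullcline z = 0 at eps = 0; its roots lie beyond the strip. *)
Lemma q_bracket (t : R) :
  (c + lam * p t) * (q t * (1 - lam * p t * r t - q t) + b * p t * r t)
  = (1 - lam * c) / (2 * lam) * ((lam * c * a - q t) * (c * a - q t))
    + (1 - lam * c) / (2 * lam) * (c * a * eps * q t / 2)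
    - (c - (c + 1 / lam) / 2 * q t) * (c * a * eps / 2)
    + zf t * (c * a * b - q t) + eps * p t * q t + e t * p t * (b - lam * q t).
Proof.
  replace ((c + lam * p t) * (q t * (1 - lam * p t * r t - q t) + b * p t * r t))
    with ((c + lam * p t) * (q t * (1 - q t)) + p t * (b - lam * q t) * (r t * (c + lam * p t))) by ring.
  rewrite r_unclamped.
  assert (Eb : b = 1 + lam - eps - lam * c * a) by lra.
  assert (Ee : eps = 2 + 2 * lam - a * (1 + lam * c)) by lra.
  unfold zf. rewrite Eb, Ee. field. lra.
Qed.

(** A lower bound of (c + lam p) z' on the strip |z| <= del. The positive term comes from the first
    summand of [q_bracket]; the others are the losses due to eps, del and e0. *)
Definition strip_gain : R :=
  (c + 1 / lam) / 2 * ((1 - lam * c) * lam * (c * c) / (2 * ((1 + lam * c) * (1 + lam * c)))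
     - c * (c * a) * eps / 2 - del * (c * a * b + Q) - e0 * (P * (b + lam * Q)))
  - P * (2 * del + e0 * (1 / lam + lam * P)).

Hypothesis Hgain : 0 < strip_gain.
Hypotheses (Hd1 : c * eps + 2 * del <= c * lam) (Hd2 : c * eps + 2 * lam * del <= c).
Hypothesis Hd3 : e0 * (1 / lam + lam * P) + eps * P <= del.

Definition dzf (t : R) : R :=
  p t * (1 / lam * (r t - a) + 2 - lam * p t * r t - q t)
  + (c + 1 / lam) / 2 * (q t * (1 - lam * p t * r t - q t) + b * p t * r t).

Lemma derive_zf (t : R) : is_derive zf t (dzf t).
Proof.
  apply (is_derive_ext (fun t => p t - c + (c + 1 / lam) / 2 * q t)); auto.
  unfold dzf. derive_by fail. ring.
Qed.

Lemma den_range (t : R) : c < c + lam * p t <= c + lam * P.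
Proof.
  assert (H := p_le_P t). specialize (Hp0 t).
  assert (0 < lam * p t) by pos.
  assert (lam * p t <= lam * P) by mono. lra.
Qed.

Lemma strip_increasing (t : R) : - del <= zf t <= del -> strip_gain / (c + lam * P) <= dzf t.
Proof.
  intros Hz. assert (Hden := den_range t). assert (HpP := p_le_P t). assert (HqQ := q_le_Q t).
  assert (HqB := q_bracket t). assert (HpB := p_bracket t).
  assert (Hil := il_pos). specialize (Hp0 t). specialize (Hq0 t).
  assert (Eq1 : Rabs (e t * (1 / lam - lam * p t)) <= e0 * (1 / lam + lam * P)).
  { apply err_mul, p_coef_le; auto. lra. }
  assert (Eq2 : Rabs (e t * (p t * (b - lam * q t))) <= e0 * (P * (b + lam * Q))).
  { apply err_mul. rewrite Rabs_mult, (Rabs_right (p t)) by lra.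
    apply Rmult_le_compat; try lra. apply Rabs_pos.
    assert (0 <= lam * q t) by pos.
    assert (lam * q t <= lam * Q) by mono. apply Rabs_le. lra. }
  apply Rabs_le_between in Eq1. apply Rabs_le_between in Eq2.
  set (C2 := (c + 1 / lam) / 2) in *. assert (HC2 : 0 < C2) by pos.
  assert (HC2l : 2 * lam * C2 = 1 + lam * c) by (unfold C2; field; lra).
  assert (Hq1 : C2 * q t <= c + del) by (unfold zf in Hz; fold C2 in Hz; lra).
  set (X := 1 + lam * c) in *. assert (HX : 0 < X) by pos.
  assert (HXq : X * q t <= 2 * lam * (c + del)) by nra.
  (* On the nullcline q <= 2 lam c / (1 + lam c). For eps = 0 the roots lam c a and c a exceed this
     by twice the margins kept in F1 and F2; the other half is spent on eps and del through [Hd1]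
     and [Hd2]. *)
  assert (F1 : lam * (c * lam) / X <= lam * c * a - q t).
  { apply Rle_div_l; auto. replace ((lam * c * a - q t) * X) with (lam * c * (a * X) - X * q t) by ring.
    rewrite HI1. assert (lam * (c * eps + 2 * del) <= lam * (c * lam)) by mono. lra. }
  assert (F2 : c / X <= c * a - q t).
  { apply Rle_div_l; auto. replace ((c * a - q t) * X) with (c * (a * X) - X * q t) by ring.
    rewrite HI1. lra. }
  set (cf := (1 - lam * c) / (2 * lam)) in *.
  assert (Hcf : 0 < cf) by pos.
  assert (F3 : cf * (lam * (c * lam) / X * (c / X)) <= cf * ((lam * c * a - q t) * (c * a - q t))) by mono.
  replace (cf * (lam * (c * lam) / X * (c / X))) with ((1 - lam * c) * lam * (c * c) / (2 * (X * X))) in F3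
    by (unfold cf; field; lra).
  assert (Hcae : 0 <= c * a * eps) by pos.
  assert (F4 : 0 <= cf * (c * a * eps * q t / 2)) by pos.
  assert (F5 : (c - C2 * q t) * (c * a * eps / 2) <= c * (c * a * eps / 2)).
  { apply Rmult_le_compat_r; [lra|]. assert (0 < C2 * q t) by pos. lra. }
  assert (Hcab : 0 < c * a * b) by pos.
  assert (F6 : - (del * (c * a * b + Q)) <= zf t * (c * a * b - q t)).
  { assert (H : Rabs (zf t * (c * a * b - q t)) <= del * (c * a * b + Q)).
    { rewrite Rabs_mult. apply Rmult_le_compat; auto using Rabs_pos. apply Rabs_le; lra. apply Rabs_le; lra. }
    apply Rabs_le_between in H. lra. }
  assert (F7 : 0 <= eps * p t * q t) by pos.
  assert (F8 : - (P * (2 * del + e0 * (1 / lam + lam * P)))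
     <= p t * ((c + lam * p t) * (1 / lam * (r t - a) + 2 - lam * p t * r t - q t))).
  { rewrite HpB. assert (0 <= eps * p t) by pos.
    set (Y := 2 * del + e0 * (1 / lam + lam * P)) in *.
    assert (HY : - Y <= - 2 * zf t + eps * p t + e t * (1 / lam - lam * p t)) by (unfold Y; lra).
    assert (p t * Y <= P * Y) by mono.
    assert (p t * - Y <= p t * (- 2 * zf t + eps * p t + e t * (1 / lam - lam * p t))) by mono.
    lra. }
  apply (Rmult_le_reg_l (c + lam * p t)). lra.
  apply Rle_trans with strip_gain.
  { apply Rle_trans with ((c + lam * P) * (strip_gain / (c + lam * P))).
    apply Rmult_le_compat_r; [|lra]. apply Rdiv_le_0_compat; lra. right; field; lra. }
  unfold dzf. fold C2.
  replace ((c + lam * p t) * (p t * (1 / lam * (r t - a) + 2 - lam * p t * r t - q t) +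
     C2 * (q t * (1 - lam * p t * r t - q t) + b * p t * r t)))
  with (p t * ((c + lam * p t) * (1 / lam * (r t - a) + 2 - lam * p t * r t - q t))
     + C2 * ((c + lam * p t) * (q t * (1 - lam * p t * r t - q t) + b * p t * r t))) by ring.
  rewrite HqB. unfold strip_gain. fold C2 X.
  apply Rle_trans with (C2 * ((1 - lam * c) * lam * (c * c) / (2 * (X * X)) - c * (c * a) * eps / 2 -
    del * (c * a * b + Q) - e0 * (P * (b + lam * Q))) + - (P * (2 * del + e0 * (1 / lam + lam * P)))); [lra|].
  rewrite (Rplus_comm (p t * _)). apply Rplus_le_compat; [|exact F8].
  apply Rmult_le_compat_l; [lra|]. lra.
Qed.

(** By [Hd3] the errors consume at most half of the 2 del provided by - 2 z. *)
Lemma p_growth (t : R) : zf t <= - del -> del / (c + lam * P) * p t <=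
  p t * (1 / lam * (r t - a) + 2 - lam * p t * r t - q t).
Proof.
  intros Hz. assert (Hden := den_range t). assert (HpB := p_bracket t). assert (Hp := Hp0 t).
  assert (Eq1 := err_mul _ _ t (p_coef_le t (p t) (conj (Rlt_le _ _ Hp) (p_le_P t)))).
  apply Rabs_le_between in Eq1.
  assert (0 <= eps * p t) by pos.
  assert (0 <= eps * P) by pos.
  replace (del / (c + lam * P) * p t) with (p t * (del / (c + lam * P))) by ring.
  apply Rmult_le_compat_l; [lra|].
  apply (Rmult_le_reg_l (c + lam * p t)). lra. rewrite HpB.
  apply Rle_trans with del; [|lra].
  apply Rle_trans with ((c + lam * P) * (del / (c + lam * P))).
  apply Rmult_le_compat_r; [|lra]. apply Rdiv_le_0_compat; lra. right; field; lra.
Qed.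

Lemma p_decay (t : R) : del <= zf t ->
  p t * (1 / lam * (r t - a) + 2 - lam * p t * r t - q t) <= - (del / (c + lam * P)) * p t.
Proof.
  intros Hz. assert (Hden := den_range t). assert (HpB := p_bracket t). assert (Hp := Hp0 t).
  assert (Eq1 := err_mul _ _ t (p_coef_le t (p t) (conj (Rlt_le _ _ Hp) (p_le_P t)))).
  apply Rabs_le_between in Eq1.
  assert (eps * p t <= eps * P) by nra.
  replace (- (del / (c + lam * P)) * p t) with (p t * - (del / (c + lam * P))) by ring.
  apply Rmult_le_compat_l; [lra|].
  apply (Rmult_le_reg_l (c + lam * p t)). lra. rewrite HpB.
  apply Rle_trans with (- del); [lra|].
  apply Rle_trans with (- ((c + lam * P) * (del / (c + lam * P)))). right; field; lra.
  assert ((c + lam * p t) * (del / (c + lam * P)) <= (c + lam * P) * (del / (c + lam * P))) by mono.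
  lra.
Qed.

Lemma p_to_zero : forall y, 0 < y -> exists T, forall t, T <= t -> p t <= y.
Proof.
  assert (Hmu : 0 < del / (c + lam * P)) by pos.
  assert (H1 : exists t1, - del < zf t1).
  { apply NNPP. intros Hno.
    assert (p 0 <= 0); [|specialize (Hp0 0); lra].
    apply (bounded_growth_nonpos p (fun t => p t * (1 / lam * (r t - a) + 2 - lam * p t * r t - q t))
      (del / (c + lam * P)) P 0); auto.
    - intros x _. apply p_le_P.
    - intros x _ _. apply p_growth. apply Rnot_lt_le. intros Hlt. apply Hno. now exists x. }
  destruct H1 as [t1 Ht1].
  destruct (cross_strip zf dzf del (strip_gain / (c + lam * P)) t1) as [t2 [_ Ht2]]; auto.
  - apply derive_zf.
  - pos.
  - apply strip_increasing.
  - intros y Hy.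
    destruct (stable_pinf p _ (del / (c + lam * P)) 0 t2 Hpd Hmu) with (eps := y) as [T [_ HT]]; auto.
    + intros x Hx Hp. rewrite Rminus_0_r. apply p_decay, Ht2, Hx.
    + exists T. intros t Ht. specialize (HT t Ht). lra.
Qed.

Variable rh : R.
Hypothesis Hrh : forall t, r t <= rh.

(** As p r tends to 0, the equation of q is a perturbed logistic one. The upper bound is obtained on
    q, the lower one on 1 / q, for which the logistic equation is linear. *)
Lemma q_to_one : forall y, 0 < y -> exists T, forall t, T <= t -> Rabs (q t - 1) <= y.
Proof.
  intros y Hy.
  assert (Hrh0 : 0 < rh) by (specialize (Hr0 0); specialize (Hrh 0); lra).
  set (w := Rmin (1 / 2) (Rmin (y / 2 / lam) (y / 2 / b))).
  set (w' := Rmin (y / 4) (1 / 2) / lam).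
  assert (Hw : 0 < Rmin w' (y / 2 / b)).
  { apply Rmin_pos; [|apply Rdiv_lt_0_compat; lra]. apply Rdiv_lt_0_compat; auto. apply Rmin_pos; lra. }
  destruct (p_to_zero (Rmin w' (y / 2 / b) / rh)) as [T HT]; [pos|].
  assert (Hpr : forall t, T <= t -> 0 < p t * r t /\ lam * p t * r t <= Rmin (y / 4) (1 / 2) /\ b * (p t * r t) <= y / 2).
  { intros t Ht. specialize (HT t Ht). specialize (Hp0 t). specialize (Hr0 t). specialize (Hrh t).
    assert (H : p t * r t <= Rmin w' (y / 2 / b)).
    { apply Rle_trans with (Rmin w' (y / 2 / b) / rh * rh). apply Rmult_le_compat; lra. right; field; lra. }
    min_bounds w' (y / 2 / b).
    split. now apply Rmult_lt_0_compat. split.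
    - rewrite Rmult_assoc. apply Rle_trans with (lam * w').
      apply Rmult_le_compat_l; lra. unfold w'. right; field; lra.
    - apply Rle_trans with (b * (y / 2 / b)). apply Rmult_le_compat_l; lra. right; field; lra. }
  destruct (stable_pinf q _ 1 (1 + y / 2) T Hqd Rlt_0_1) with (eps := y / 2) as [T1 [HT1 Hup]]; [|lra|].
  - intros x Hx Hq. destruct (Hpr x Hx) as [A1 [A2 A3]]. assert (0 < lam * p x * r x) by nra. nra.
  - set (m := Rmin (y / 4) (1 / 2)) in *.
    assert (Hm : 0 < m) by (unfold m; apply Rmin_pos; lra).
    assert (Hm1 : m <= y / 4) by apply Rmin_l. assert (Hm2 : m <= 1 / 2) by apply Rmin_r.
    destruct (stable_pinf (fun t => / q t)
      (fun t => - (q t * (1 - lam * p t * r t - q t) + b * p t * r t) / (q t) ^ 2)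
      (1 - m) (/ (1 - m)) T) with (eps := m) as [T2 [HT2 Hlo]]; try lra.
    + intros x. specialize (Hq0 x). derive_by fail; [lra|reflexivity].
    + intros x Hx Hq. destruct (Hpr x Hx) as [A1 [A2 A3]]. specialize (Hq0 x).
      assert (Hiq := Rinv_0_lt_compat _ Hq0).
      replace (- (q x * (1 - lam * p x * r x - q x) + b * p x * r x) / (q x) ^ 2)
        with (1 - (1 - lam * p x * r x) * / q x - b * (p x * r x) * (/ q x * / q x)) by (field; lra).
      replace (- (1 - m) * (/ q x - / (1 - m))) with (1 - (1 - m) * / q x) by (field; lra).
      assert (0 <= b * (p x * r x) * (/ q x * / q x)) by pos.
      assert ((1 - m) * / q x <= (1 - lam * p x * r x) * / q x) by mono. lra.
    + exists (Rmax T1 T2). intros t Ht. max_bounds T1 T2.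
      specialize (Hup t ltac:(lra)). specialize (Hlo t ltac:(lra)). specialize (Hq0 t).
      apply Rabs_le. split; [|lra].
      (* / q <= 1/(1-m) + m <= 1 + 3m gives q >= 1 - 3m *)
      assert (Him : / (1 - m) <= 1 + 2 * m).
      { apply (Rmult_le_reg_l (1 - m)); [lra|]. rewrite Rinv_r by lra. nra. }
      assert (E : q t * / q t = 1) by (field; lra). nra.
Qed.
End Planar.

(** * Calculus of O(1) and O(e^(2t)) at -oo *)

Definition bdd_minf (f : R -> R) : Prop := exists C T, forall t, t <= T -> Rabs (f t) <= C.
Definition small_minf (f : R -> R) : Prop :=
  exists C T, forall t, t <= T -> Rabs (f t) <= C * exp (2 * t).

Lemma bdd_cst (c : R) : bdd_minf (fun _ => c).
Proof. exists (Rabs c), 0. intros t _. apply Rle_refl. Qed.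

Lemma bdd_add (f h : R -> R) : bdd_minf f -> bdd_minf h -> bdd_minf (fun t => f t + h t).
Proof.
  intros [C [T H]] [C' [T' H']]. exists (C + C'), (Rmin T T'). intros t Ht.
  min_bounds T T'.
  eapply Rle_trans; [apply Rabs_triang|]. apply Rplus_le_compat; [apply H|apply H']; lra.
Qed.

Lemma bdd_mul (f h : R -> R) : bdd_minf f -> bdd_minf h -> bdd_minf (fun t => f t * h t).
Proof.
  intros [C [T H]] [C' [T' H']]. exists (C * C'), (Rmin T T'). intros t Ht.
  min_bounds T T'.
  rewrite Rabs_mult. apply Rmult_le_compat; auto using Rabs_pos; [apply H|apply H']; lra.
Qed.

Lemma small_bdd (f : R -> R) : small_minf f -> bdd_minf f.
Proof.
  intros [C [T H]]. exists (C * exp (2 * T)), T. intros t Ht.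
  eapply Rle_trans; [now apply H|].
  assert (HC : 0 <= C).
  { assert (H1 := Rle_trans _ _ _ (Rabs_pos _) (H t Ht)). assert (E := exp_pos (2 * t)).
    apply (Rmult_le_reg_r (exp (2 * t))); lra. }
  apply Rmult_le_compat_l; auto. apply exp_le; lra.
Qed.

Lemma small_add (f h : R -> R) : small_minf f -> small_minf h -> small_minf (fun t => f t + h t).
Proof.
  intros [C [T H]] [C' [T' H']]. exists (C + C'), (Rmin T T'). intros t Ht.
  min_bounds T T'.
  eapply Rle_trans; [apply Rabs_triang|]. rewrite Rmult_plus_distr_r.
  apply Rplus_le_compat; [apply H|apply H']; lra.
Qed.

Lemma small_mul_bdd (f h : R -> R) : small_minf f -> bdd_minf h -> small_minf (fun t => f t * h t).
Proof.
  intros [C [T H]] [C' [T' H']]. exists (C * C'), (Rmin T T'). intros t Ht.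
  min_bounds T T'.
  rewrite Rabs_mult. replace (C * C' * exp (2 * t)) with (C * exp (2 * t) * C') by ring.
  apply Rmult_le_compat; auto using Rabs_pos; [apply H|apply H']; lra.
Qed.

Lemma small_ext (f h : R -> R) : (forall t, f t = h t) -> small_minf f -> small_minf h.
Proof. intros E [C [T H]]. exists C, T. intros t Ht. rewrite <- E. auto. Qed.

Lemma bdd_ext (f h : R -> R) : (forall t, f t = h t) -> bdd_minf f -> bdd_minf h.
Proof. intros E [C [T H]]. exists C, T. intros t Ht. rewrite <- E. auto. Qed.

Lemma small_eventually (f : R -> R) : small_minf f ->
  forall eps, 0 < eps -> exists T, forall t, t <= T -> Rabs (f t) <= eps.
Proof.
  intros [C [T H]] eps Heps.
  destruct (exp_2t_small (Rmax C 0) eps T Heps) as [x [Hx1 Hx2]].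
  exists x. intros t Ht. eapply Rle_trans; [apply H; lra|].
  max_bounds C 0.
  assert (E : exp (2 * t) <= exp (2 * x)) by (apply exp_le; lra).
  assert (C * exp (2 * t) <= Rmax C 0 * exp (2 * t)) by mono.
  assert (Rmax C 0 * exp (2 * t) <= Rmax C 0 * exp (2 * x)) by mono. lra.
Qed.

Ltac bdd_step :=
  lazymatch goal with
  | |- bdd_minf (fun _ => ?c) => apply (bdd_cst c)
  | |- bdd_minf (fun t => @?f t + @?h t) => apply (bdd_add f h); bdd_step
  | |- bdd_minf (fun t => @?f t * @?h t) => apply (bdd_mul f h); bdd_step
  | |- bdd_minf _ => assumption
  end.

Ltac small_step :=
  lazymatch goal with
  | |- small_minf (fun t => @?f t + @?h t) => apply (small_add f h); small_step
  | |- small_minf (fun t => @?f t * @?h t) => apply (small_mul_bdd f h); [small_step | bdd_step]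
  | |- small_minf _ => assumption
  end.

(** * The clamped orbit is a heteroclinic orbit *)

Section Orbit.
Variables lam be ze P Q rl rh g gh bh La kup n a b k ga Bm kap c eps : R.
Variables p q r s u y : R -> R.
Hypothesis H : clamped_orbit lam be ze P Q rl rh g gh bh La n a b k ga Bm kap p q r s u y.
Hypotheses (Hlam : 0 < lam) (Hbe : 0 < be) (Hze : 0 < ze) (HP : 0 < P) (HQ : 1 <= Q).
Hypotheses (Hrl : 0 < rl) (Hg : 0 < g) (Hn : 0 < n).
Hypotheses (Ha : rl <= a <= rh) (Hb : 0 < b) (Hbh : b <= bh) (Hkap : 0 < kap).
Hypotheses (HkQ : Q + g <= k) (Hkup : k <= kup).
Hypothesis Hc : c = ze * (ga / be) - Bm.
Hypothesis Hk : k = c * a - ze * eps.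
Hypothesis Heps : eps = n / (lam * be).
Hypotheses (Hc0 : 0 < c) (Hlc : lam * c < 1).
Hypothesis HPc : lam * P + c <= g / rl.
Hypothesis HI1 : a * (1 + lam * c) = 2 + 2 * lam - eps.
Hypothesis HI2 : lam * c * a + b = 1 + lam - eps.

Lemma r_range (t : R) : rl <= r t <= rh.
Proof. apply (yd_range (co_y H)). Qed.

(** The sum of crude bounds of |p'| and |q'|. [track_lip] then dominates the Lipschitz constants of
    both k - q and lam p. *)
Definition pq_lip : R :=
  p_max lam rl rh * (rh / lam + 2 + lam * p_max lam rl rh * rh + q_max lam bh)
  + (q_max lam bh * (1 + lam * p_max lam rl rh * rh + q_max lam bh) + bh * p_max lam rl rh * rh).

Definition track_lip : R := (1 + lam) * pq_lip.

Definition track_gain : R :=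
  rh * (kup * ((ze * gain_s lam be rl La gh + (track_lip * / rl + track_lip) / g) / g)) + ze / (lam * be).

(* Deviation of r from the slow manifold r (c + lam p) = c a - q. *)
Definition track_err (t : R) : R := r t * (c + lam * Rmin (p t) P) - (c * a - Rmin (q t) Q).

Lemma pq_lipschitz (x t : R) : x <= t ->
  Rabs (p t - p x) <= pq_lip * (t - x) /\ Rabs (q t - q x) <= pq_lip * (t - x).
Proof.
  intros Hxt. assert (Pd := co_p H). assert (Qd := co_q H). assert (P0 := co_p_pos H). assert (Q0 := co_q_pos H).
  assert (Px := co_p_max H). assert (Qx := co_q_max H).
  assert (Hrg := r_range).
  set (pm := p_max lam rl rh) in *. set (qm := q_max lam bh) in *.
  assert (Hpm : 0 < pm) by pos.
  assert (Hrh : 0 < rh) by lra.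
  assert (Hrl' : 0 < rh / lam) by pos.
  assert (Hbp : 0 < bh * pm * rh) by pos.
  assert (H1 : 0 <= pm * (rh / lam + 2 + lam * pm * rh + qm)) by pos.
  assert (H2 : 0 <= qm * (1 + lam * pm * rh + qm)) by pos.
  assert (Hlpr : forall z, 0 <= lam * p z * r z <= lam * pm * rh).
  { intros z. specialize (Hrg z). specialize (Px z). specialize (P0 z). fold pm in Px.
    split. apply Rmult_le_pos; [apply Rmult_le_pos|]; lra.
    apply Rmult_le_compat; try lra. apply Rmult_le_pos; lra. apply Rmult_le_compat_l; lra. }
  split.
  - apply (lipschitz_of_derive p _ pq_lip Pd); auto.
    intros z. specialize (Hlpr z). specialize (Hrg z).
    assert (Hpz := Px z). assert (Hp0 := P0 z). assert (Hqz := Qx z). assert (Hq0 := Q0 z).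
    fold pm in Hpz. fold qm in Hqz.
    apply Rle_trans with (pm * (rh / lam + 2 + lam * pm * rh + qm)).
    2: { unfold pq_lip. fold pm qm. lra. }
    rewrite Rabs_mult, (Rabs_right (p z)) by lra. apply Rmult_le_compat; try lra. apply Rabs_pos.
    assert (Hra : - (rh / lam) <= 1 / lam * (r z - a) <= rh / lam) by nra.
    apply Rabs_le. lra.
  - apply (lipschitz_of_derive q _ pq_lip Qd); auto.
    intros z. specialize (Hlpr z). specialize (Hrg z).
    assert (Hpz := Px z). assert (Hp0 := P0 z). assert (Hqz := Qx z). assert (Hq0 := Q0 z).
    fold pm in Hpz. fold qm in Hqz.
    apply Rle_trans with (qm * (1 + lam * pm * rh + qm) + bh * pm * rh).
    2: { unfold pq_lip. fold pm qm. lra. }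
    eapply Rle_trans; [apply Rabs_triang|]. apply Rplus_le_compat.
    + rewrite Rabs_mult, (Rabs_right (q z)) by lra. apply Rmult_le_compat; try lra. apply Rabs_pos.
      apply Rabs_le. lra.
    + assert (0 <= b * p z) by pos.
      rewrite Rabs_right by (apply Rle_ge, Rmult_le_pos; lra).
      apply Rmult_le_compat; try lra. apply Rmult_le_compat; lra.
Qed.

Lemma derive_inv_r (t : R) : is_derive (fun t => / r t) t
  ((/ r t * (k - Rmin (q t) Q) - (lam * Rmin (p t) P + ze * s t - Bm)) / n).
Proof.
  assert (Dr := co_r H). assert (Hrg := r_range t).
  derive_by fail. lra. field. lra.
Qed.

(** [slow_tracking] is applied with its barrier started at t itself. It concerns k - q, whereas the
    slow manifold has c a - q; the difference ze eps accounts for the last summand of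
    [track_gain]. *)
Lemma track_err_le (t : R) : Rabs (track_err t) <= n * track_gain.
Proof.
  assert (Hrg := r_range). assert (Hrgt := Hrg t).
  assert (Hpl := fun z Hz => proj1 (pq_lipschitz t z Hz)). assert (Hql := fun z Hz => proj2 (pq_lipschitz t z Hz)).
  assert (Hp0 := co_p_pos H).
  assert (Hq0 := co_q_pos H).
  assert (Hsn := co_s_near H).
  assert (HL0 : 0 <= pq_lip) by pos.
  assert (HL : pq_lip <= track_lip /\ lam * pq_lip <= track_lip).
  { unfold track_lip. assert (0 <= lam * pq_lip) by pos. lra. }
  set (kk := fun t => k - Rmin (q t) Q). set (Np := fun t => lam * Rmin (p t) P + c).
  set (N := fun t => lam * Rmin (p t) P + ze * s t - Bm).
  assert (Hm : forall t, 0 < Rmin (p t) P <= P /\ 0 < Rmin (q t) Q <= Q).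
  { intros z. repeat split; try apply Rmin_r; apply Rmin_pos; auto; lra. }
  assert (Hkk : forall t, g <= kk t) by (intros z; unfold kk; specialize (Hm z); lra).
  assert (Hkk2 : kk t <= kup) by (unfold kk; specialize (Hm t); lra).
  assert (HLk : forall z, t <= z -> Rabs (kk z - kk t) <= track_lip * (z - t)).
  { intros z Hz. unfold kk. replace (k - Rmin (q z) Q - (k - Rmin (q t) Q)) with (- (Rmin (q z) Q - Rmin (q t) Q)) by ring.
    rewrite Rabs_Ropp. eapply Rle_trans; [apply Rmin_sub_le|]. eapply Rle_trans; [now apply Hql|].
    apply Rmult_le_compat_r; lra. }
  assert (HLN : forall z, t <= z -> Rabs (Np z - Np t) <= track_lip * (z - t)).
  { intros z Hz. unfold Np. replace (lam * Rmin (p z) P + c - (lam * Rmin (p t) P + c)) with (lam * (Rmin (p z) P - Rmin (p t) P)) by ring.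
    rewrite Rabs_mult, (Rabs_right lam) by lra.
    apply Rle_trans with (lam * (pq_lip * (z - t))).
    - apply Rmult_le_compat_l; [lra|]. eapply Rle_trans; [apply Rmin_sub_le|]. now apply Hpl.
    - nra. }
  assert (HN : forall z, Rabs (N z - Np z) <= n * (ze * gain_s lam be rl La gh)).
  { intros z. unfold N, Np. rewrite Hc.
    replace (lam * Rmin (p z) P + ze * s z - Bm - (lam * Rmin (p z) P + (ze * (ga / be) - Bm)))
      with (ze * (s z - ga / be)) by ring.
    rewrite Rabs_mult, (Rabs_right ze) by lra.
    replace (n * (ze * gain_s lam be rl La gh)) with (ze * (n * gain_s lam be rl La gh)) by ring.
    apply Rmult_le_compat_l; [lra|apply Hsn]. }
  assert (HNp : 0 <= Np t <= / rl * kk t).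
  { unfold Np. specialize (Hm t). assert (0 < lam * Rmin (p t) P) by pos.
    assert (lam * Rmin (p t) P <= lam * P) by mono.
    assert (Hi := Rinv_0_lt_compat rl Hrl).
    assert (/ rl * g <= / rl * kk t) by (apply Rmult_le_compat_l; [lra|apply Hkk]). lra. }
  assert (Hi : forall z, 0 <= / r z <= / rl).
  { intros z. specialize (Hrg z). split. left; apply Rinv_0_lt_compat; lra. apply Rinv_le_contravar; lra. }
  assert (HLt : 0 <= track_lip) by lra.
  assert (U := slow_tracking (fun t => / r t) kk N Np n g track_lip (/ rl) (/ rl) (ze * gain_s lam be rl La gh) t
    Hn Hg HLt derive_inv_r Hkk Hi HLk HLN HN (proj1 HNp) (proj2 HNp)).
  simpl in U. rewrite Rabs_minus_sym in U.
  set (C0 := (ze * gain_s lam be rl La gh + (track_lip * / rl + track_lip) / g) / g) in *.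
  assert (Hkt := Hkk t).
  replace (track_err t) with (r t * (kk t * (Np t / kk t - / r t)) + - (ze * eps)).
  2: { unfold track_err, Np. replace (kk t) with (c * a - ze * eps - Rmin (q t) Q) in * by (unfold kk; rewrite Hk; ring).
       field. split; lra. }
  eapply Rle_trans; [apply Rabs_triang|]. rewrite Rabs_Ropp.
  assert (He : 0 < ze * eps).
  { rewrite Heps. apply Rmult_lt_0_compat; auto. apply Rdiv_lt_0_compat; auto. now apply Rmult_lt_0_compat. }
  rewrite (Rabs_right (ze * eps)) by lra.
  unfold track_gain. fold C0. rewrite Rmult_plus_distr_l. apply Rplus_le_compat.
  - rewrite !Rabs_mult, (Rabs_right (r t)), (Rabs_right (kk t)) by lra.
    replace (n * (rh * (kup * C0))) with (rh * (kup * (C0 * n))) by ring.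
    apply Rmult_le_compat; try lra. pos.
    apply Rmult_le_compat; try lra. apply Rabs_pos.
  - nra.
Qed.

Variable del : R.
Hypothesis Hdel : 0 < del.
Hypothesis HPcond : 2 * c - (2 - eps) * P + n * track_gain * (1 / lam + lam * P) <= 0.
Hypothesis HQcond : c * a * b - (1 - eps) * Q + n * track_gain * (b + lam * Q) <= 0.
Hypothesis Hgain : 0 < strip_gain lam c a b eps P Q (n * track_gain) del.
Hypotheses (Hd1 : c * eps + 2 * del <= c * lam) (Hd2 : c * eps + 2 * lam * del <= c).
Hypothesis Hd3 : n * track_gain * (1 / lam + lam * P) + eps * P <= del.

Lemma eps_pos : 0 < eps.
Proof. rewrite Heps. apply Rdiv_lt_0_compat; auto. now apply Rmult_lt_0_compat. Qed.

Lemma r_eq (t : R) : r t * (c + lam * Rmin (p t) P) = c * a - Rmin (q t) Q + track_err t.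
Proof. unfold track_err. ring. Qed.

Lemma pq_vanish (z T : R) : 0 < z -> exists x, x <= T /\ p x < z /\ q x < z.
Proof.
  intros Hz.
  destruct (exp_2t_small (kap * pq_slope lam P Q rl rh g bh) z (Rmin T (1 / 2)) Hz) as [x [Hx1 Hx2]].
  min_bounds T (1 / 2).
  exists x. destruct (co_pq_small H (t := x) ltac:(lra)). lra.
Qed.

Lemma p_vanish (z T : R) : 0 < z -> exists x, x <= T /\ p x < z.
Proof. intros Hz. destruct (pq_vanish z T Hz) as [x Hx]. exists x. tauto. Qed.

Lemma q_vanish (z T : R) : 0 < z -> exists x, x <= T /\ q x < z.
Proof. intros Hz. destruct (pq_vanish z T Hz) as [x Hx]. exists x. tauto. Qed.

Lemma r_pos (t : R) : 0 < r t. Proof. assert (X := r_range t). lra. Qed.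

Lemma unclamped (t : R) : Rmin (p t) P = p t /\ Rmin (q t) Q = q t.
Proof.
  assert (Pd := co_p H). assert (Qd := co_q H). assert (P0 := co_p_pos H). assert (Q0 := co_q_pos H).
  split; apply Rmin_left.
  - apply (p_le_P lam c a eps P Q (n * track_gain) p q r track_err); auto using r_pos, r_eq, track_err_le, p_vanish.
  - apply (q_le_Q lam c a b eps P Q (n * track_gain) p q r track_err);
      auto using r_pos, r_eq, track_err_le, p_vanish, q_vanish.
Qed.

Lemma p_tends_0 : forall z, 0 < z -> exists T, forall t, T <= t -> p t <= z.
Proof.
  assert (Pd := co_p H). assert (Qd := co_q H). assert (P0 := co_p_pos H). assert (Q0 := co_q_pos H).
  assert (He := eps_pos).
  apply (p_to_zero lam c a b eps P Q (n * track_gain) del p q r track_err);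
    auto using r_pos, r_eq, track_err_le, p_vanish, q_vanish; lra.
Qed.

Lemma q_tends_1 : forall z, 0 < z -> exists T, forall t, T <= t -> Rabs (q t - 1) <= z.
Proof.
  assert (Pd := co_p H). assert (Qd := co_q H). assert (P0 := co_p_pos H). assert (Q0 := co_q_pos H).
  assert (He := eps_pos).
  apply (q_to_one lam c a b eps P Q (n * track_gain) del p q r track_err)
    with (rh := rh); auto using r_pos, r_eq, track_err_le, p_vanish, q_vanish; try lra.
  intros t. apply r_range.
Qed.

Lemma derive_r_exact (t : R) : is_derive r t
  (r t * (- (k - q t) + r t * (lam * p t + ze * s t - Bm)) / n).
Proof.
  destruct (unclamped t) as [E1 E2].
  assert (D := co_r H t). now rewrite E1, E2 in D.
Qed.

Lemma derive_s_exact (t : R) : is_derive s t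
  (s t * (- (k - q t) + r t * (lam * p t + ze * s t - Bm) - be * r t * s t + ga * r t - n / lam)).
Proof.
  destruct (unclamped t) as [E1 E2].
  assert (D := co_s H t). now rewrite E1, E2 in D.
Qed.

Definition s_eq0 : R := ga / be - n / (lam * be * a).

Variables Rs Ss : R.
Hypothesis Hs0 : 0 < s_eq0.
Hypothesis HRs : a * (k / a * Rs + kap * (b * a) + lam * a * kap + ze * a * Ss) - 2 * n * Rs = 0.
Hypothesis HSs : (be * a * s_eq0 + 2) * (Ss / s_eq0 - n * Rs / a) + n * (be * s_eq0 - 1 / (lam * a)) * Rs = 0.
Hypothesis Hgain_minf : 4 * n * (be * s_eq0 + 1 / (lam * a)) * (ze * (a * a) * s_eq0)
  <= (be * a * s_eq0 + 2) * (k - 2 * n).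
Hypothesis Hkn : 2 * n < k.

Definition R_ (t : R) : R := (r t - a) * exp (- 2 * t).
Definition S_ (t : R) : R := (s t - s_eq0) * exp (- 2 * t).
Definition p_ (t : R) : R := p t * exp (- 2 * t).
Definition q_ (t : R) : R := q t * exp (- 2 * t).

Lemma exp_cancel (t : R) : exp (2 * t) * exp (- 2 * t) = 1.
Proof. rewrite <- exp_plus. replace (2 * t + -2 * t) with 0 by ring. apply exp_0. Qed.

Lemma bdd_of_slope (f : R -> R) (C : R) : (forall t, Rabs (f t) <= C * exp (2 * t)) ->
  small_minf f /\ bdd_minf (fun t => f t * exp (- 2 * t)).
Proof.
  intros Hf. split; [exists C, 0; auto|]. exists C, 0. intros t _.
  assert (E := exp_pos (- 2 * t)). rewrite Rabs_mult, (Rabs_right (exp _)) by lra.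
  rewrite <- (Rmult_1_r C), <- (exp_cancel t), <- Rmult_assoc. apply Rmult_le_compat_r; [lra|apply Hf].
Qed.

Lemma r_small : small_minf (fun t => r t - a) /\ bdd_minf R_.
Proof. exact (bdd_of_slope _ _ (co_r_slope H)). Qed.

Lemma s_small : small_minf (fun t => s t - s_eq0) /\ bdd_minf S_.
Proof.
  apply bdd_of_slope with (C := n * gain_ds lam be rl La gh * r_slope lam P Q rl rh g).
  intros t. rewrite Rmult_assoc. apply (co_s_slope H).
Qed.

Lemma p_small : small_minf (fun t => p_ t - kap) /\ bdd_minf p_.
Proof.
  assert (X : small_minf (fun t => p_ t - kap)) by exact (co_p_lim H). split; auto.
  apply (bdd_ext (fun t => (p_ t - kap) + kap)). intros; ring.
  apply (bdd_add (fun t => p_ t - kap) (fun _ => kap)); [now apply small_bdd | apply bdd_cst].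
Qed.

Lemma q_small : small_minf (fun t => q_ t - kap * (b * a)) /\ bdd_minf q_.
Proof.
  assert (X : small_minf (fun t => q_ t - kap * (b * a))).
  { apply (small_ext (fun t => (u t - b * a) * p_ t + (p_ t - kap) * (b * a))).
    - intros t. unfold q_, p_. rewrite (co_q_def H). ring.
    - destruct p_small. assert (X : small_minf (fun t => u t - b * a)) by exact (co_u_lim H).
      small_step. }
  split; auto.
  apply (bdd_ext (fun t => (q_ t - kap * (b * a)) + kap * (b * a))). intros; ring.
  apply (bdd_add (fun t => q_ t - kap * (b * a)) (fun _ => kap * (b * a))); [now apply small_bdd | apply bdd_cst].
Qed.

Lemma bdd_r : bdd_minf r.
Proof.
  apply (bdd_ext (fun t => (r t - a) + a)). intros; ring.
  apply (bdd_add (fun t => r t - a) (fun _ => a)); [apply small_bdd, r_small | apply bdd_cst].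
Qed.

(** [Gr] and [Gs] are n r' / r and s' / s multiplied by e^(-2t), written in the rescaled deviations
    from M0. *)
Definition Gr (t : R) : R := k / a * R_ t + q_ t + lam * (r t * p_ t) + ze * (r t * S_ t).
Definition Gs (t : R) : R := Gr t + (- be) * (r t * S_ t + (s_eq0 - ga / be) * R_ t).

Lemma bdd_Gr : bdd_minf Gr.
Proof.
  destruct r_small, q_small, p_small, s_small. assert (X := bdd_r). unfold Gr. bdd_step.
Qed.

Lemma bdd_Gs : bdd_minf Gs.
Proof.
  destruct r_small, s_small. assert (X := bdd_r). assert (Y := bdd_Gr). unfold Gs. bdd_step.
Qed.

Lemma k_over_a : k / a = ze * s_eq0 - Bm.
Proof. rewrite Hk, Hc, Heps. unfold s_eq0. field. lra. Qed.

Lemma derive_exp_m2t (t : R) : is_derive (fun t => exp (- 2 * t)) t (- 2 * exp (- 2 * t)).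
Proof. derive_by fail. ring. Qed.

Lemma derive_R_ (t : R) : is_derive R_ t (r t * Gr t / n - 2 * R_ t).
Proof.
  assert (D := derive_r_exact). assert (D2 := derive_exp_m2t).
  apply (is_derive_ext (fun t => (r t - a) * exp (- 2 * t))); auto.
  eapply derive_change.
  - apply (derive_mul (fun t => r t - a) (fun t => exp (- 2 * t))); [|apply D2].
    apply (derive_sub r (fun _ => a)); [apply D|apply derive_cst].
  - unfold Gr, R_, S_, p_, q_. rewrite k_over_a.
    assert (Ek : k = a * (ze * s_eq0 - Bm)) by (rewrite <- k_over_a; field; lra). rewrite Ek.
    field. lra.
Qed.

Lemma derive_S_ (t : R) : is_derive S_ t (s t * Gs t - 2 * S_ t).
Proof.
  assert (D := derive_s_exact). assert (D2 := derive_exp_m2t).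
  apply (is_derive_ext (fun t => (s t - s_eq0) * exp (- 2 * t))); auto.
  eapply derive_change.
  - apply (derive_mul (fun t => s t - s_eq0) (fun t => exp (- 2 * t))); [|apply D2].
    apply (derive_sub s (fun _ => s_eq0)); [apply D|apply derive_cst].
  - unfold Gs, Gr, R_, S_, p_, q_. rewrite k_over_a.
    assert (Ek : k = a * (ze * s_eq0 - Bm)) by (rewrite <- k_over_a; field; lra). rewrite Ek.
    unfold s_eq0. field. lra.
Qed.

(* In the variable S / s0 - n R / a the fast factor 1 / n disappears from the equation. *)
Definition Rdev (t : R) : R := R_ t - Rs.
Definition Zdev (t : R) : R := S_ t / s_eq0 - n * R_ t / a - (Ss / s_eq0 - n * Rs / a).

Definition Rerr (t : R) : R :=
  ((r t - a) * Gr t + (((q_ t - kap * (b * a)) + (p_ t - kap) * (lam * a) + (r t - a) * (lam * p_ t))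
     + (r t - a) * (ze * S_ t)) * a) * / n.
Definition Zerr (t : R) : R :=
  (r t - a) * (- be * S_ t) + (s t - s_eq0) * (/ s_eq0 * Gs t) + (r t - a) * (- / a * Gr t).

Lemma small_Rerr : small_minf Rerr.
Proof.
  destruct r_small, q_small, p_small, s_small. assert (X := bdd_Gr). unfold Rerr. small_step.
Qed.

Lemma small_Zerr : small_minf Zerr.
Proof.
  destruct r_small, s_small. assert (X := bdd_Gr). assert (Y := bdd_Gs). unfold Zerr. small_step.
Qed.

Lemma derive_Rdev (t : R) : is_derive Rdev t
  ((k - 2 * n + ze * a * s_eq0 * n) / n * Rdev t + ze * (a * a) * s_eq0 / n * Zdev t + Rerr t).
Proof.
  apply (is_derive_ext (fun t => R_ t - Rs)); auto.
  eapply derive_change. apply (derive_sub R_ (fun _ => Rs)); [apply derive_R_ | apply derive_cst].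
  unfold Rerr, Rdev, Zdev.
  match goal with |- _ = ?X => replace X with (X
     + (a * (k / a * Rs + kap * (b * a) + lam * a * kap + ze * a * Ss) - 2 * n * Rs) / n) by (rewrite HRs; field; lra) end.
  unfold Gr. field. lra.
Qed.

Lemma derive_Zdev (t : R) : is_derive Zdev t
  (- (be * a * s_eq0 + 2) * Zdev t - n * (be * s_eq0 - 1 / (lam * a)) * Rdev t + Zerr t).
Proof.
  apply (is_derive_ext (fun t => S_ t / s_eq0 - n * R_ t / a - (Ss / s_eq0 - n * Rs / a))); auto.
  assert (D1 := derive_S_). assert (D2 := derive_R_).
  eapply derive_change.
  - apply (derive_sub (fun t => S_ t / s_eq0 - n * R_ t / a) (fun _ => Ss / s_eq0 - n * Rs / a)); [|apply derive_cst].
    apply (derive_sub (fun t => S_ t / s_eq0) (fun t => n * R_ t / a)).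
    + apply (derive_mul S_ (fun _ => / s_eq0)); [apply D1 | apply derive_cst].
    + apply (derive_mul (fun t => n * R_ t) (fun _ => / a)); [|apply derive_cst].
      apply (derive_mul (fun _ => n) R_); [apply derive_cst | apply D2].
  - unfold Zerr, Rdev, Zdev.
    match goal with |- _ = ?X => replace X with (X
     - ((be * a * s_eq0 + 2) * (Ss / s_eq0 - n * Rs / a) + n * (be * s_eq0 - 1 / (lam * a)) * Rs)) by (rewrite HSs; ring) end.
    assert (Eg : ga / be = s_eq0 + n / (lam * be * a)) by (unfold s_eq0; ring).
    unfold Gs. rewrite Eg. clear Eg. set (s0 := s_eq0) in *. field. lra.
Qed.

Lemma dev_bdd : bdd_minf Zdev.
Proof.
  apply (bdd_ext (fun t => (S_ t * / s_eq0 + R_ t * - (n / a)) + - (Ss / s_eq0 - n * Rs / a))).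
  - intros t. unfold Zdev. field. lra.
  - destruct r_small, s_small. bdd_step.
Qed.

(** Small gain in reversed time, where the roles change: toward -oo the fast component [Rdev] is
    attracting and [Zdev] is repelling, but known to be bounded. By [HRs] and [HSs] the pair (Rs,
    Ss) is the rest point of the limiting linear system. *)
Lemma RS_limit : forall z, 0 < z -> exists T, forall t, t <= T -> Rabs (R_ t - Rs) <= z /\ Rabs (S_ t - Ss) <= z.
Proof.
  assert (Ha0 : 0 < a) by lra.
  assert (Hla : 0 < 1 / (lam * a)) by pos.
  assert (Hbs : 0 < be * s_eq0) by pos.
  assert (Hbas : 0 < be * a * s_eq0) by pos.
  assert (Hzas : 0 < ze * a * s_eq0 * n) by pos.
  set (X := be * s_eq0 - 1 / (lam * a)). set (Xa := be * s_eq0 + 1 / (lam * a)).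
  assert (HX : - Xa <= X <= Xa) by (unfold X, Xa; lra).
  set (kf := be * a * s_eq0 + 2). set (kh := (k - 2 * n + ze * a * s_eq0 * n) / n).
  set (Bh := ze * (a * a) * s_eq0 / n).
  assert (HBh : 0 <= Bh) by pos.
  assert (Hkh : 0 < kh) by pos.
  assert (HXmul : forall x, Rabs (n * X * x) <= n * Xa * Rabs x).
  { intros x. rewrite Rabs_mult. apply Rmult_le_compat_r; [apply Rabs_pos|].
    rewrite Rabs_mult, (Rabs_right n) by lra. apply Rmult_le_compat_l; [lra|]. now apply Rabs_le. }
  destruct dev_bdd as [M [T HM]].
  assert (Hlim : forall z, 0 < z -> exists T, forall t, T <= t -> Rabs (Zdev (- t)) <= z /\ Rabs (Rdev (- t)) <= z).
  { apply (small_gain_pinf (fun t => Zdev (- t))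
      (fun t => - (- kf * Zdev (- t) - n * X * Rdev (- t) + Zerr (- t)))
      (fun t => Rdev (- t)) (fun t => - (kh * Rdev (- t) + Bh * Zdev (- t) + Rerr (- t)))
      (fun t => Rabs (Zerr (- t)) + Rabs (Rerr (- t))) kf kh (n * Xa) Bh M (- T)); auto.
    - intros t. apply is_derive_reflect, derive_Zdev.
    - intros t. apply is_derive_reflect, derive_Rdev.
    - pos.
    - pos.
    - apply (Rmult_le_reg_r (4 * n)); [lra|].
      replace (n * Xa * Bh * (4 * n)) with (4 * n * Xa * (ze * (a * a) * s_eq0)) by (unfold Bh; field; lra).
      replace (kf * kh / 4 * (4 * n)) with (kf * (k - 2 * n + ze * a * s_eq0 * n)) by (unfold kh; field; lra).
      eapply Rle_trans; [apply Hgain_minf|]. apply Rmult_le_compat_l; unfold kf; lra.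
    - intros t Ht. apply HM. lra.
    - intros t sg _ Hsg _. assert (H1 := sign_mul_range sg _ _ Hsg (HXmul (Rdev (- t)))).
      assert (H2 := sign_mul_range sg _ _ Hsg (Rle_refl (Rabs (Zerr (- t))))). assert (H3 := Rabs_pos (Rerr (- t))). lra.
    - intros t sg _ Hsg _. assert (H1 := sign_mul_range sg _ _ Hsg (Rle_refl (Rabs (Zdev (- t))))).
      assert (Bh * - (sg * Zdev (- t)) <= Bh * Rabs (Zdev (- t))) by mono.
      assert (H2 := sign_mul_range sg _ _ Hsg (Rle_refl (Rabs (Rerr (- t))))). assert (H3 := Rabs_pos (Zerr (- t))). lra.
    - intros z Hz. destruct (small_eventually _ small_Zerr (z / 2)) as [T1 H1]; [lra|].
      destruct (small_eventually _ small_Rerr (z / 2)) as [T2 H2]; [lra|].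
      exists (- Rmin T1 T2). intros t Ht. min_bounds T1 T2.
      specialize (H1 (- t) ltac:(lra)). specialize (H2 (- t) ltac:(lra)). lra. }
  intros z Hz.
  set (W := 1 + s_eq0 * (1 + n / a)).
  assert (Hna : 0 < n / a) by pos.
  assert (HW : 1 <= W) by (unfold W; assert (0 < s_eq0 * (1 + n / a)) by pos; lra).
  destruct (Hlim (z / W)) as [T' HT']; [apply Rdiv_lt_0_compat; lra|].
  exists (- T'). intros t Ht. destruct (HT' (- t) ltac:(lra)) as [H1 H2].
  rewrite Ropp_involutive in H1, H2.
  assert (HzW : z / W * W = z) by (field; lra).
  assert (HzW0 : 0 < z / W) by pos.
  split.
  - fold (Rdev t). assert (z / W * 1 <= z / W * W) by mono. lra.
  - replace (S_ t - Ss) with (s_eq0 * (Zdev t + n / a * Rdev t)) by (unfold Zdev, Rdev; field; lra).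
    rewrite Rabs_mult, (Rabs_right s_eq0) by lra.
    apply Rle_trans with (s_eq0 * (z / W + n / a * (z / W))).
    + apply Rmult_le_compat_l; [lra|]. eapply Rle_trans; [apply Rabs_triang|].
      rewrite Rabs_mult, (Rabs_right (n / a)) by lra. apply Rplus_le_compat; auto.
      apply Rmult_le_compat_l; lra.
    + replace (s_eq0 * (z / W + n / a * (z / W))) with (z / W * (W - 1)) by (unfold W at 2; ring).
      replace (z / W * (W - 1)) with (z - z / W) by (rewrite <- HzW at 1; ring). lra.
Qed.

Hypothesis HLa : forall x, rl <= x <= rh -> - La <= ln x <= La.
Hypotheses (Hn1 : n <= 1) (HnLa : n * La <= 1 / 4).
Hypotheses (Hga : 0 < ga) (Hgah : ga <= gh) (Hnga : n / (lam * rl) <= ga / 2).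

(** The slow manifold relation at p = 0, q = 1: c r = c a - 1. *)
Definition r_eq1 : R := a - / c.
Definition s_eq1 : R := ga / be - n / (lam * be * r_eq1).
Definition s_cap : R := gh / be + gain_s lam be rl La gh.

Hypothesis Hr1 : rl <= r_eq1 <= rh.
Hypothesis Hfast : ze * s_cap * (n * (rh * rh * / rl)) <= g / 2.
Hypothesis Hgain_pinf : 32 * n * (ze * s_cap) * (gain_y lam be rl La gh * (rh * rh)) <= g * (rl * ga).

Definition y_eq1 : R := be * exp ((1 + n) * ln r_eq1) / (ga * r_eq1 - n / lam).

Lemma y_eq1_driven : y_driven lam be rl rh n ga (fun _ => r_eq1) (fun _ => y_eq1).
Proof. now apply y_driven_const. Qed.

Lemma gain_s_nonneg' : 0 <= gain_s lam be rl La gh.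
Proof. apply (gain_s_nonneg lam be rl rh La gh ga); auto; lra. Qed.

Lemma r_dist (t : R) : Rabs (r t - r_eq1) <= rh * rh * Rabs (/ r t - / r_eq1).
Proof.
  assert (Hrg := r_range t).
  replace (r t - r_eq1) with (r t * r_eq1 * - (/ r t - / r_eq1)) by (field; lra).
  rewrite Rabs_mult, Rabs_Ropp. apply Rmult_le_compat_r; [apply Rabs_pos|].
  assert (0 < r t * r_eq1) by pos.
  rewrite Rabs_right by lra. apply Rmult_le_compat; lra.
Qed.

Lemma s_dist (t : R) : Rabs (s t - s_eq1)
  <= s_cap * (n * (rh * rh * / rl) * Rabs (/ r t - / r_eq1) + Rabs (ln (y t) - ln y_eq1)).
Proof.
  assert (Hy := co_y H).
  assert (Es := co_s_def H t).
  assert (X := s_sub_le lam be rl rh La gh n ga Hlam Hbe Hrl HLa Hn Hn1 HnLa Hga Hgah Hnga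
    r (fun _ => r_eq1) y (fun _ => y_eq1) t Hy y_eq1_driven).
  simpl in X. rewrite (s_const lam be rl rh n ga) in X by auto.
  rewrite <- Es in X. fold s_eq1 s_cap in X.
  eapply Rle_trans; [apply X|]. assert (HG := gain_s_nonneg').
  assert (0 < gh / be) by pos.
  apply Rmult_le_compat_l; [unfold s_cap; lra|]. apply Rplus_le_compat_r.
  rewrite Rmult_assoc. apply Rmult_le_compat_l; [lra|].
  replace (rh * rh * / rl * Rabs (/ r t - / r_eq1)) with (rh * rh * Rabs (/ r t - / r_eq1) / rl) by (unfold Rdiv; ring).
  apply Rmult_le_compat_r; [pos | apply r_dist].
Qed.

(** Small gain with 1 / r repelling and ln y attracting. The response of ln y to r is O(n), which
    makes the product of the coupling constants small against the rates; p and q - 1 enter as a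
    forcing that vanishes at +oo. *)
Lemma rs_tends : forall z, 0 < z -> exists T, forall t, T <= t ->
  Rabs (r t - r_eq1) <= z /\ Rabs (s t - s_eq1) <= z.
Proof.
  assert (Hy := co_y H).
  assert (Hyo := yd_ode Hy). assert (Hy0 := yd_pos Hy).
  assert (HG := gain_s_nonneg'). assert (Hrg := r_range).
  assert (Hgb : 0 < gh / be) by pos.
  assert (Hcap : 0 < s_cap) by (unfold s_cap; lra). assert (Hrh2 : 0 < rh * rh) by pos.
  assert (Hil := Rinv_0_lt_compat rl Hrl).
  assert (Hgy : 0 <= gain_y lam be rl La gh) by pos.
  set (V := ze * s_cap) in *. assert (HV : 0 < V) by pos.
  set (f := fun t => / r t - / r_eq1). set (h := fun t => ln (y t) - ln y_eq1).
  set (eta := fun t => (/ rl * Rabs (q t - 1) + lam * p t) / n).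
  assert (Hp0 := co_p_pos H).
  assert (Heta : forall t, 0 <= eta t).
  { intros t. apply Rdiv_le_0_compat; auto. specialize (Hp0 t).
    assert (0 <= / rl * Rabs (q t - 1)) by pos.
    assert (0 <= lam * p t) by pos. lra. }
  assert (Hkq : forall t, g <= k - q t).
  { intros t. destruct (unclamped t) as [_ E]. assert (X := Rmin_r (q t) Q). lra. }
  assert (Heq1 : / r_eq1 * (k - 1) = ze * s_eq1 - Bm).
  { unfold s_eq1.
    assert (Ek : k - 1 = c * r_eq1 - ze * eps) by (rewrite Hk; unfold r_eq1; field; lra).
    rewrite Ek, Hc, Heps. field. lra. }
  assert (Hi1 : 0 < / r_eq1 <= / rl).
  { split. apply Rinv_0_lt_compat; lra. apply Rinv_le_contravar; lra. }
  (* By [Hfast] the direct effect of r on s costs at most half of the rate g, which leaves g / 2 as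
     the repelling rate. *)
  assert (Hdev : forall t, Rabs (- / r_eq1 * (q t - 1) - lam * p t - ze * (s t - s_eq1))
     <= n * eta t + g / 2 * Rabs (f t) + V * Rabs (h t)).
  { intros t. assert (Hs := s_dist t). fold (f t) (h t) in Hs. specialize (Hp0 t).
    set (A := Rabs (q t - 1)) in *.
    assert (H1 : Rabs (- / r_eq1 * (q t - 1) - lam * p t - ze * (s t - s_eq1))
        <= / rl * A + lam * p t + ze * Rabs (s t - s_eq1)).
    { eapply Rle_trans; [apply Rabs_triang|].
      rewrite Rabs_Ropp, (Rabs_mult ze), (Rabs_right ze) by lra. apply Rplus_le_compat_r. eapply Rle_trans; [apply Rabs_triang|].
      rewrite Rabs_Ropp, (Rabs_mult lam), (Rabs_right lam), (Rabs_right (p t)) by lra.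
      apply Rplus_le_compat_r. rewrite Rabs_mult, Rabs_Ropp, (Rabs_right (/ r_eq1)) by lra.
      apply Rmult_le_compat_r; [apply Rabs_pos|lra]. }
    assert (H2 : ze * Rabs (s t - s_eq1) <= V * (n * (rh * rh * / rl) * Rabs (f t) + Rabs (h t))).
    { unfold V. rewrite Rmult_assoc. apply Rmult_le_compat_l; lra. }
    assert (H3 : V * (n * (rh * rh * / rl)) * Rabs (f t) <= g / 2 * Rabs (f t)) by mono.
    replace (n * eta t) with (/ rl * A + lam * p t) by (unfold eta; fold A; field; lra). lra. }
  assert (Df : forall t, is_derive f t ((/ r t * (k - q t) - (lam * p t + ze * s t - Bm)) / n)).
  { intros t. assert (D := derive_inv_r t). destruct (unclamped t) as [E1 E2]. rewrite E1, E2 in D.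
    apply (is_derive_ext (fun t => / r t - / r_eq1)); auto.
    eapply derive_change. apply (derive_sub (fun t => / r t) (fun _ => / r_eq1)); [apply D|apply derive_cst]. ring. }
  assert (Ef : forall t, n * ((/ r t * (k - q t) - (lam * p t + ze * s t - Bm)) / n)
     = (k - q t) * f t + (- / r_eq1 * (q t - 1) - lam * p t - ze * (s t - s_eq1))).
  { intros t. unfold f. replace (n * ((/ r t * (k - q t) - (lam * p t + ze * s t - Bm)) / n))
      with (/ r t * (k - q t) - (lam * p t + ze * s t - Bm)) by (field; specialize (Hrg t); lra).
    replace Bm with (ze * s_eq1 - / r_eq1 * (k - 1)) by lra. ring. }
  assert (Dh : forall t, is_derive h t ((be * exp ((1 + n) * ln (r t)) - y t * (ga * r t - n / lam)) * / y t)).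
  { intros t. apply (is_derive_ext (fun t => ln (y t) - ln y_eq1)); auto.
    eapply derive_change. apply (derive_sub (fun t => ln (y t)) (fun _ => ln y_eq1)); [|apply derive_cst].
    apply derive_ln_comp; auto. ring. }
  assert (E1 : (be * exp ((1 + n) * ln r_eq1) - y_eq1 * (ga * r_eq1 - n / lam)) * / y_eq1 = 0).
  { assert (Hx := y_coef_pos lam rl n ga Hlam Hrl Hga Hnga r_eq1 (proj1 Hr1)).
    assert (0 < rl * (ga / 2)) by pos.
    replace (y_eq1 * (ga * r_eq1 - n / lam)) with (be * exp ((1 + n) * ln r_eq1)).
    ring. unfold y_eq1. set (x := ga * r_eq1 - n / lam) in *. field. lra. }
  assert (Hlim : forall z, 0 < z -> exists T, forall t, T <= t -> Rabs (f t) <= z /\ Rabs (h t) <= z).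
  { apply (small_gain_pinf f _ h _ eta (g / (2 * n)) (rl * ga / 4) (V / n)
      (n * gain_y lam be rl La gh * (rh * rh)) (/ rl) 0 Df Dh).
    - pos.
    - pos.
    - pos.
    - pos.
    - apply (Rmult_le_reg_r (32 * n)); [lra|].
      replace (V / n * (n * gain_y lam be rl La gh * (rh * rh)) * (32 * n))
        with (32 * n * V * (gain_y lam be rl La gh * (rh * rh))) by (field; lra).
      replace (g / (2 * n) * (rl * ga / 4) / 4 * (32 * n)) with (g * (rl * ga)) by (field; lra). exact Hgain_pinf.
    - intros t _. unfold f. specialize (Hrg t).
      assert (0 < / r t) by pos.
      assert (/ r t <= / rl) by (apply Rinv_le_contravar; lra). apply Rabs_le. lra.
    - intros t sg _ Hsg Hf. specialize (Hdev t). specialize (Hkq t).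
      assert (Eabs : Rabs (f t) = sg * f t).
      { destruct Hsg as [-> | ->]; [rewrite Rabs_right|rewrite Rabs_left]; lra. }
      rewrite Eabs in Hdev. apply (sign_mul_range sg) in Hdev; auto.
      apply (Rmult_le_reg_l n); auto. rewrite <- (Rmult_assoc n sg), (Rmult_comm n sg), Rmult_assoc, Ef.
      replace (n * (g / (2 * n) * (sg * f t) - V / n * Rabs (h t) - eta t))
        with (g / 2 * (sg * f t) - V * Rabs (h t) - n * eta t) by (field; lra).
      assert (g * (sg * f t) <= (k - q t) * (sg * f t)) by mono. lra.
    - intros t sg _ Hsg Hh. specialize (Heta t). assert (Hrd := r_dist t). fold (f t) in Hrd.
      assert (n * gain_y lam be rl La gh * Rabs (r t - r_eq1) <= n * gain_y lam be rl La gh * (rh * rh * Rabs (f t))) by mono.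
      assert (X := ln_y_derivative_le lam be rl rh La gh n ga Hlam Hbe Hrl HLa Hn Hn1 HnLa Hga Hgah Hnga
        r (fun _ => r_eq1) y (fun _ => y_eq1) t Hy y_eq1_driven).
      assert (X' := ln_y_derivative_le lam be rl rh La gh n ga Hlam Hbe Hrl HLa Hn Hn1 HnLa Hga Hgah Hnga
        (fun _ => r_eq1) r (fun _ => y_eq1) y t y_eq1_driven Hy).
      simpl in X, X'. rewrite E1 in X, X'. rewrite (Rabs_minus_sym r_eq1) in X'. fold (h t) in X.
      destruct Hsg as [-> | ->]; [specialize (X ltac:(lra))|specialize (X' ltac:(unfold h in Hh; lra))].
      lra. unfold h. lra.
    - intros z Hz.
      destruct (q_tends_1 (n * z / 2 * rl)) as [T1 HT1].
      { apply Rmult_lt_0_compat; auto. assert (0 < n * z) by pos. lra. }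
      destruct (p_tends_0 (n * z / 2 / lam)) as [T2 HT2].
      { apply Rdiv_lt_0_compat; auto. assert (0 < n * z) by pos. lra. }
      exists (Rmax T1 T2). intros t Ht. max_bounds T1 T2.
      specialize (HT1 t ltac:(lra)). specialize (HT2 t ltac:(lra)).
      apply Rle_div_l; auto.
      assert (/ rl * Rabs (q t - 1) <= / rl * (n * z / 2 * rl)) by mono.
      replace (/ rl * (n * z / 2 * rl)) with (n * z / 2) in * by (field; lra).
      assert (lam * p t <= lam * (n * z / 2 / lam)) by mono.
      replace (lam * (n * z / 2 / lam)) with (n * z / 2) in * by (field; lra). lra. }
  intros z Hz.
  set (W := rh * rh + s_cap * (n * (rh * rh * / rl) + 1)).
  assert (HW2 : 0 < s_cap * (n * (rh * rh * / rl) + 1)) by pos.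
  assert (HW : 0 < W) by pos.
  assert (HzW : 0 < z / W) by pos.
  destruct (Hlim (z / W) HzW) as [T HT]. exists T. intros t Ht. destruct (HT t Ht) as [H1 H2].
  assert (HE : z = W * (z / W)) by (field; lra).
  split.
  - eapply Rle_trans; [apply r_dist|]. fold (f t).
    apply Rle_trans with (rh * rh * (z / W)). apply Rmult_le_compat_l; lra.
    rewrite HE at 2. apply Rmult_le_compat_r; [lra|unfold W; lra].
  - eapply Rle_trans; [apply s_dist|]. fold (f t) (h t).
    apply Rle_trans with (s_cap * ((n * (rh * rh * / rl) + 1) * (z / W))).
    + apply Rmult_le_compat_l; [lra|].
      assert (n * (rh * rh * / rl) * Rabs (f t) <= n * (rh * rh * / rl) * (z / W)) by mono. lra.
    + rewrite HE at 2. rewrite <- Rmult_assoc. apply Rmult_le_compat_r; [lra|unfold W; lra].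
Qed.
End Orbit.

(** * Conditions valid for all small n *)

Definition for_small (X : R -> Prop) : Prop := exists n0, 0 < n0 /\ forall n, 0 < n -> n < n0 -> X n.

Lemma for_small_and (X Y : R -> Prop) : for_small X -> for_small Y -> for_small (fun n => X n /\ Y n).
Proof.
  intros [n0 [H0 H]] [n1 [H1 H']]. exists (Rmin n0 n1). split. now apply Rmin_pos.
  intros n Hn Hn'. assert (M1 := Rmin_l n0 n1). assert (M2 := Rmin_r n0 n1).
  split; [apply H|apply H']; lra.
Qed.

(** Reduces a condition on n to a strict inequality between the values at n = 0. *)
Lemma for_small_lt (F G : R -> R) : continuity_pt F 0 -> continuity_pt G 0 -> F 0 < G 0 ->
  for_small (fun n => F n < G n).
Proof.
  intros HF HG Hlt.
  assert (HC : continuity_pt (fun n => G n - F n) 0) by now apply (continuity_pt_minus G F).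
  destruct (HC (G 0 - F 0) ltac:(lra)) as [d [Hd H]].
  exists d. split; auto. intros n Hn Hn'.
  assert (X : Rabs ((G n - F n) - (G 0 - F 0)) < G 0 - F 0).
  { apply (H n). split. split; [exact I|lra]. simpl. unfold R_dist.
    rewrite Rminus_0_r, Rabs_right; lra. }
  apply Rabs_def2 in X. lra.
Qed.

Lemma for_small_impl (X Y : R -> Prop) : (forall n, 0 < n -> X n -> Y n) -> for_small X -> for_small Y.
Proof. intros H [n0 [H0 H1]]. exists n0. split; auto. Qed.

Lemma for_small_le (F G : R -> R) : continuity_pt F 0 -> continuity_pt G 0 -> F 0 < G 0 ->
  for_small (fun n => F n <= G n).
Proof.
  intros HF HG Hlt. apply (for_small_impl (fun n => F n < G n)). intros; lra.
  now apply for_small_lt.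
Qed.

Ltac small_n :=
  lazymatch goal with
  | |- for_small (fun n => @?F n < @?G n) => apply (for_small_lt F G)
  | |- for_small (fun n => @?F n <= @?G n) => apply (for_small_le F G)
  end;
  [ cont_step fail; try (apply Rgt_not_eq; pos)
  | cont_step fail; try (apply Rgt_not_eq; pos)
  | ].

Lemma exists_scale (A B C x y z : R) : 0 < A -> 0 < B -> 0 < C -> 0 < x -> 0 < y -> 0 < z ->
  exists w, 0 < w /\ w * A <= x /\ w * B <= y /\ w * C <= z.
Proof.
  intros HA HB HC Hx Hy Hz.
  exists (Rmin (x / A) (Rmin (y / B) (z / C))).
  assert (M1 := Rmin_l (x / A) (Rmin (y / B) (z / C))). assert (M2 := Rmin_r (x / A) (Rmin (y / B) (z / C))).
  assert (M3 := Rmin_l (y / B) (z / C)). assert (M4 := Rmin_r (y / B) (z / C)).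
  split. repeat apply Rmin_pos; pos.
  repeat split; apply Rle_div_r; auto; lra.
Qed.

(** * Choice of n0 *)

Definition c_ (al m lam n : R) : R := (al - m - n) / (lam * (1 + al)).
Definition eps_ (al n : R) : R := n / (1 + al).
Definition k_ (al m lam n : R) : R := c_ al m lam n * ap al m n lam - al / lam * eps_ al n.

Section Coefficients.
Variables al m lam : R.
Hypotheses (Hal : 0 < al) (Hm : -1 < m) (Hma : m < al) (Hlam : 0 < lam).

Lemma par_I1 (n : R) : 0 < Dp al m n ->
  ap al m n lam * (1 + lam * c_ al m lam n) = 2 + 2 * lam - eps_ al n.
Proof. unfold ap, c_, eps_, Dp. intros H. field. lra. Qed.

Lemma par_I2 (n : R) : 0 < Dp al m n ->
  lam * c_ al m lam n * ap al m n lam + bp al m n lam = 1 + lam - eps_ al n.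
Proof. unfold ap, bp, c_, eps_, Dp. intros H. field. lra. Qed.

Lemma par_c (n : R) :
  c_ al m lam n = al / lam * ((1 + m + n) / lam / ((1 + al) / lam)) - (m + n) / lam.
Proof. unfold c_. field. lra. Qed.

Lemma par_eps (n : R) : eps_ al n = n / (lam * ((1 + al) / lam)).
Proof. unfold eps_. field. lra. Qed.

Lemma par_s0 (n : R) : r0 al m n lam <> 0 ->
  s0 al m n lam = s_eq0 lam ((1 + al) / lam) n (ap al m n lam) ((1 + m + n) / lam).
Proof. unfold s0, s_eq0, r0. intros H. field. lra. Qed.

(** The formulas for y1 and z1 are Cramer's rule for a 2 by 2 system with determinant [Delta1],
    whose rows are [H1] and [H2]. The first equation is the difference of the two rows, the second
    is the row [H1], both up to factors. *)
Lemma eigenvector_eqs (n kap : R) : 0 < Dp al m n -> 0 < ap al m n lam -> 0 < s0 al m n lam ->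
  Delta1 al m n lam <> 0 ->
  let a := ap al m n lam in let b := bp al m n lam in let be := (1 + al) / lam in
  let s := s0 al m n lam in let ze := al / lam in
  let Rs := kap * y1 al m n lam in let Ss := kap * z1 al m n lam in
  a * (k_ al m lam n / a * Rs + kap * (b * a) + lam * a * kap + ze * a * Ss) - 2 * n * Rs = 0 /\
  (be * a * s + 2) * (Ss / s - n * Rs / a) + n * (be * s - 1 / (lam * a)) * Rs = 0.
Proof.
  intros HD Ha Hs HDe a b be s ze Rs Ss. fold a in Ha. fold s in Hs.
  set (A1 := be * a + 2 / s). set (A2 := n / a * (1 / lam + 2)).
  assert (Ey : y1 al m n lam = - (lam + b) * a * (A1 / Delta1 al m n lam)) by reflexivity.
  assert (Ez : z1 al m n lam = - (lam + b) * a * (A2 / Delta1 al m n lam)) by reflexivity.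
  assert (EDe : Delta1 al m n lam = (1 - s) / lam * A1 - A2 * (a / lam + 2 / s)) by reflexivity.
  set (De := Delta1 al m n lam) in *.
  assert (H1 : y1 al m n lam * A2 = z1 al m n lam * A1) by (rewrite Ey, Ez; field; auto).
  assert (H2 : (1 - s) / lam * y1 al m n lam - (a / lam + 2 / s) * z1 al m n lam = - (lam + b) * a).
  { rewrite Ey, Ez.
    replace ((1 - s) / lam * (- (lam + b) * a * (A1 / De)) - (a / lam + 2 / s) * (- (lam + b) * a * (A2 / De)))
      with (- (lam + b) * a * (((1 - s) / lam * A1 - A2 * (a / lam + 2 / s)) / De)) by (field; repeat split; first [exact HDe | lra]).
    rewrite <- EDe. field. auto. }
  set (Y := y1 al m n lam) in *. set (Z := z1 al m n lam) in *.
  assert (Ek : k_ al m lam n = a * ((1 - s) / lam - n / (a * lam))).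
  { unfold k_, eps_, s, s0, c_, r0. fold a. field. repeat split; lra. }
  split.
  - rewrite Ek. unfold Rs, Ss.
    assert (H3 : ((1 - s) / lam * Y - (a / lam + 2 / s) * Z + (lam + b) * a) - (Y * A2 - Z * A1) = 0) by lra.
    replace (a * (a * ((1 - s) / lam - n / (a * lam)) / a * (kap * Y) + kap * (b * a) + lam * a * kap + ze * a * (kap * Z)) - 2 * n * (kap * Y))
      with (kap * a * (((1 - s) / lam * Y - (a / lam + 2 / s) * Z + (lam + b) * a) - (Y * A2 - Z * A1))).
    rewrite H3. ring. unfold A1, A2, be, ze. field. repeat split; lra.
  - unfold Rs, Ss.
    replace ((be * a * s + 2) * (kap * Z / s - n * (kap * Y) / a) + n * (be * s - 1 / (lam * a)) * (kap * Y))
      with (kap * (Z * A1 - Y * A2)). rewrite H1. ring.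
    unfold A1, A2. field. repeat split; lra.
Qed.
End Coefficients.

Lemma tends_minf_of (f : R -> R) (l : R) :
  (forall z, 0 < z -> exists T, forall t, t <= T -> Rabs (f t - l) <= z) -> tends_minf f l.
Proof.
  intros H e He. destruct (H (e / 2)) as [T HT]; [lra|]. exists T. intros t Ht.
  specialize (HT t ltac:(lra)). lra.
Qed.

Lemma tends_pinf_of (f : R -> R) (l : R) :
  (forall z, 0 < z -> exists T, forall t, T <= t -> Rabs (f t - l) <= z) -> tends_pinf f l.
Proof.
  intros H e He. destruct (H (e / 2)) as [T HT]; [lra|]. exists T. intros t Ht.
  specialize (HT t ltac:(lra)). lra.
Qed.

Lemma tends_minf_of_scaled (f : R -> R) (l L : R) :
  tends_minf (fun t => exp (-2 * t) * (f t - l)) L -> tends_minf f l.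
Proof.
  intros H e He. destruct (H 1 Rlt_0_1) as [T HT].
  destruct (exp_2t_small (Rabs L + 1) e T He) as [x [Hx1 Hx2]].
  exists x. intros t Ht. specialize (HT t ltac:(lra)).
  assert (E : exp (2 * t) <= exp (2 * x)) by (apply exp_le; lra).
  assert (E1 := exp_pos (2 * t)). assert (HL := Rabs_pos L).
  replace (f t - l) with (exp (-2 * t) * (f t - l) * exp (2 * t)).
  2: { rewrite (Rmult_comm (exp (-2 * t))), Rmult_assoc, (Rmult_comm (exp (-2 * t))), exp_cancel. ring. }
  rewrite Rabs_mult, (Rabs_right (exp _)) by lra.
  assert (X : Rabs (exp (-2 * t) * (f t - l)) <= Rabs L + 1).
  { assert (Y := Rabs_triang (exp (-2 * t) * (f t - l) - L) L).
    replace (exp (-2 * t) * (f t - l) - L + L) with (exp (-2 * t) * (f t - l)) in Y by ring. lra. }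
  apply Rle_lt_trans with ((Rabs L + 1) * exp (2 * x)); auto.
  apply Rmult_le_compat; auto using Rabs_pos. lra.
Qed.

(** Each smallness condition of the preceding sections compares functions of n continuous at 0 and
    is strict at n = 0; finitely many of them hold below a common n0. *)
Theorem theorem1 :
  forall al m lam : R,
    0 < al -> -1 < m -> m < al ->
    0 < lam -> lam < 2 * (al - m) / (1 + m) ->
    exists n0 : R, 0 < n0 /\
      forall n : R, 0 < n -> n < n0 ->
        - al + m + n < 0 /\
        (0 < lam /\ lam < 2 * (al - m - n) * (1 + m) / (1 + m + n) ^ 2) /\
        exists p q r s : R -> R,
          solves_S al m n lam p q r s /\
          tends_minf p 0 /\ tends_minf q 0 /\
          tends_minf r (r0 al m n lam) /\ tends_minf s (s0 al m n lam) /\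
          tends_pinf p 0 /\ tends_pinf q 1 /\
          tends_pinf r (r1 al m n lam) /\ tends_pinf s (s1 al m n lam) /\
          exists kappa : R, kappa <> 0 /\
            tends_minf (fun eta => exp (-2*eta) * (p eta - 0)) (kappa * 1) /\
            tends_minf (fun eta => exp (-2*eta) * (q eta - 0))
                       (kappa * (bp al m n lam * r0 al m n lam)) /\
            tends_minf (fun eta => exp (-2*eta) * (r eta - r0 al m n lam))
                       (kappa * y1 al m n lam) /\
            tends_minf (fun eta => exp (-2*eta) * (s eta - s0 al m n lam))
                       (kappa * z1 al m n lam).
Proof.
  intros al m lam Hal Hm Hma Hlam Hlm.
  set (be := (1 + al) / lam). set (ze := al / lam).
  set (fa := fun n => ap al m n lam). set (fb := fun n => bp al m n lam).
  set (fc := fun n => c_ al m lam n). set (fk := fun n => k_ al m lam n).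
  set (fe := fun n => eps_ al n).
  set (fg := fun n => (1 + m + n) / lam). set (fB := fun n => (m + n) / lam).
  assert (Hbe : 0 < be) by (unfold be; pos). assert (Hze : 0 < ze) by (unfold ze; pos).
  assert (Ca : continuity_pt fa 0) by (unfold fa, ap, Dp; cont_step fail; lra).
  assert (Cb : continuity_pt fb 0) by (unfold fb, bp, Dp; cont_step fail; lra).
  assert (Cc : continuity_pt fc 0) by (unfold fc, c_; cont_step fail; apply Rgt_not_eq; pos).
  assert (Ce : continuity_pt fe 0) by (unfold fe, eps_; cont_step fail; lra).
  assert (Ck : continuity_pt fk 0) by (unfold fk, k_; fold ze; cont_step fail).
  assert (Cg : continuity_pt fg 0) by (unfold fg; cont_step fail; lra).
  assert (CB : continuity_pt fB 0) by (unfold fB; cont_step fail; lra).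
  set (a0 := fa 0). set (b0 := fb 0). set (c0 := fc 0). set (g0 := fg 0). set (B0 := fB 0).
  assert (He0 : fe 0 = 0) by (unfold fe, eps_; field; lra).
  assert (HD0 : 0 < Dp al m 0) by (unfold Dp; lra).
  assert (I1 : a0 * (1 + lam * c0) = 2 + 2 * lam).
  { assert (X := par_I1 al m lam Hal Hlam 0 HD0). fold (fa 0) (fc 0) (fe 0) in X. rewrite He0 in X. fold a0 c0 in X. lra. }
  assert (I2 : lam * c0 * a0 + b0 = 1 + lam).
  { assert (X := par_I2 al m lam Hal Hlam 0 HD0). fold (fa 0) (fb 0) (fc 0) (fe 0) in X. rewrite He0 in X. fold a0 b0 c0 in X. lra. }
  assert (Hk0 : fk 0 = c0 * a0).
  { unfold fk, k_. fold (fa 0) (fc 0) (fe 0). rewrite He0. fold a0 c0. ring. }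
  assert (Hc0 : 0 < c0) by (unfold c0, fc, c_; pos).
  assert (Hlc0 : lam * c0 < 1).
  { unfold c0, fc, c_. replace (lam * ((al - m - 0) / (lam * (1 + al)))) with ((al - m) / (1 + al)) by (field; lra).
    apply Rlt_div_l; lra. }
  assert (Ha0 : 0 < a0).
  { apply (Rmult_lt_reg_r (1 + lam * c0)). assert (0 < lam * c0) by pos. lra. rewrite I1. lra. }
  (* The upper bound on lam is equivalent to b0 < 1. *)
  assert (Hb0 : 0 < b0 < 1).
  { assert (X : lam * (1 + m) < 2 * (al - m)) by (apply Rlt_div_r; lra).
    assert (E : b0 = (1 + m) * (1 + lam) / (1 + 2 * al - m)) by (unfold b0, fb, bp, Dp; field; lra).
    rewrite E. split. pos. apply Rlt_div_l; lra. }
  (* From lam c0 a0 = 1 + lam - b0 > lam. This also makes the limit r10 of r at +oo, for n = 0,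
     positive. *)
  assert (Hca : 1 < c0 * a0).
  { apply (Rmult_lt_reg_l lam); auto. lra. }
  assert (Hcag : c0 = ze * (g0 / be) - B0).
  { unfold c0, g0, B0, fc, fg, fB. rewrite par_c; auto. }
  assert (Hg0 : 0 < g0) by (unfold g0, fg; pos).
  set (kk0 := c0 * a0). set (K0 := c0 * a0 * b0).
  assert (HK0 : 0 < K0 < kk0).
  { assert (0 < b0) by lra. unfold K0, kk0. split. pos.
    rewrite <- (Rmult_1_r (c0 * a0)) at 2. apply Rmult_lt_compat_l; lra. }
  (* P exceeds c0, as [HPcond] requires at n = 0. Q lies halfway between max (1, c0 a0 b0) and c0
     a0, and g keeps half of the remaining gap. *)
  set (P := c0 + 1). set (Q := (Rmax 1 K0 + kk0) / 2).
  assert (HQ : 1 < Q /\ K0 < Q /\ Q < kk0).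
  { assert (M1 := Rmax_l 1 K0). assert (M2 := Rmax_r 1 K0).
    assert (M3 : Rmax 1 K0 < kk0) by (apply Rmax_lub_lt; unfold kk0 in *; lra). unfold Q; unfold kk0 in *; lra. }
  set (g := (kk0 - Q) / 2). assert (Hg : 0 < g) by (unfold g; lra).
  assert (HP : 0 < P) by (unfold P; lra).
  set (r10 := a0 - / c0).
  assert (Hr10 : 0 < r10).
  { unfold r10. apply (Rmult_lt_reg_l c0); auto. replace (c0 * (a0 - / c0)) with (c0 * a0 - 1) by (field; lra). lra. }
  (* The first bound gives [N_of] <= g / rl, the second keeps the limit of r at +oo above rl. *)
  set (rl := Rmin (g / (lam * P + c0 + 1)) (r10 / 2)).
  assert (Hlp : 0 < lam * P) by pos.
  assert (Hrl : 0 < rl) by (unfold rl; apply Rmin_pos; pos).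
  assert (Hrl1 : rl <= r10 / 2) by apply Rmin_r.
  assert (Hrl2 : lam * P + c0 + 1 <= g / rl).
  { apply Rle_div_r; auto. assert (X : rl <= g / (lam * P + c0 + 1)) by apply Rmin_l.
    apply Rle_trans with ((lam * P + c0 + 1) * (g / (lam * P + c0 + 1))).
    apply Rmult_le_compat_l; lra. right; field; lra. }
  (* Twice a0 makes k / rh equal to c0 / 2 at n = 0, below the value c0 of ze s - Bm there. *)
  set (rh := 2 * a0).
  assert (Hic : 0 < / c0) by pos.
  assert (Hr10a : r10 < a0) by (unfold r10; lra).
  assert (Hrh : 0 < rh) by (unfold rh; lra).
  set (gh := g0 + 1). set (bh := b0 + 1). set (kup := kk0 + 1).
  set (La := Rabs (ln rl) + Rabs (ln rh)).
  assert (HLa : forall x, rl <= x <= rh -> - La <= ln x <= La).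
  { intros x Hx. assert (X1 := ln_le_compat rl x Hrl (proj1 Hx)).
    assert (X2 := ln_le_compat x rh ltac:(lra) (proj2 Hx)).
    assert (Y1 := Rle_abs (- ln rl)). rewrite Rabs_Ropp in Y1. assert (Y2 := Rle_abs (ln rh)).
    assert (Y3 := Rabs_pos (ln rl)). assert (Y4 := Rabs_pos (ln rh)). unfold La. lra. }
  set (gds := gain_ds lam be rl La gh). set (gs := gain_s lam be rl La gh).
  set (sl := r_slope lam P Q rl rh g). set (pqs := pq_slope lam P Q rl rh g bh).
  set (pm := p_max lam rl rh). set (qm := q_max lam bh). set (gpq := gain_pq lam rl rh bh).
  assert (Hpm : 0 < pm) by (unfold pm, p_max; pos).
  assert (Hqm : 0 < qm) by (unfold qm, q_max, bh; pos).
  assert (Hbh0 : 0 < bh) by (unfold bh; lra).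
  assert (Hgpq : 0 < gpq) by (unfold gpq, gain_pq, gain_v, gain_u; fold pm qm; pos).
  assert (Hsl : 0 < sl) by (unfold sl, r_slope; pos).
  assert (Hpqs : 0 < pqs) by (unfold pqs, pq_slope; pos).
  (* A quarter of the contraction threshold g / (4 rh^2): K and kap use one quarter each, and the
     rest covers the terms in n. *)
  set (lim := g / (16 * (rh * rh))). assert (Hlim : 0 < lim) by (unfold lim; pos).
  set (K := 4 + gpq * (2 * (pm + qm)) / lim).
  assert (HK1 : 0 < gpq * (2 * (pm + qm)) / lim) by pos.
  assert (HK : 4 <= K) by (unfold K; lra).
  assert (HK2 : gpq * (2 * (pm + qm) / K) <= lim).
  { replace (gpq * (2 * (pm + qm) / K)) with (gpq * (2 * (pm + qm)) / K) by (field; lra).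
    apply Rle_div_l; [lra|]. unfold K.
    replace (lim * (4 + gpq * (2 * (pm + qm)) / lim)) with (4 * lim + gpq * (2 * (pm + qm))) by (field; lra). lra. }
  (* The first two bounds keep the small-time slopes of p and q below the clamps; the third is the
     share of kap in the contraction. *)
  destruct (exists_scale pqs pqs (gpq * (3 * pqs / 2)) P Q lim) as [kap [Hkap [Hkap1 [Hkap2 Hkap3]]]]; try pos.
  set (C2 := (c0 + 1 / lam) / 2). assert (HC2 : 0 < C2) by (unfold C2; pos).
  set (gam := (1 - lam * c0) * lam * (c0 * c0) / (2 * ((1 + lam * c0) * (1 + lam * c0)))).
  assert (Hlc0' : 0 < 1 - lam * c0) by lra.
  assert (Hgam : 0 < gam) by (unfold gam; pos).
  (* The first bound spends at most half of the leading term C2 gam of [strip_gain]; the other two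
     spend half of the margins in [Hd1] and [Hd2] at n = 0. *)
  destruct (exists_scale (2 * (C2 * (K0 + Q) + 2 * P)) 4 (4 * lam) (C2 * gam) (c0 * lam) c0)
    as [del [Hdel [Hdel1 [Hdel2 Hdel3]]]]; try pos.
  set (tg := track_gain lam be ze rl rh g gh bh La kup).
  set (sc := s_cap lam be rl gh La). set (gy := gain_y lam be rl La gh).
  set (fs0 := fun n => fg n / be - n / (lam * be * fa n)).
  assert (Cs0 : continuity_pt fs0 0) by (unfold fs0; cont_step fail; apply Rgt_not_eq; fold a0; pos).
  assert (Es00 : fs0 0 = g0 / be) by (unfold fs0; fold g0 a0; field; lra).
  assert (Hs00 : 0 < g0 / be) by pos.
  assert (Hs01 : g0 / be < 1).
  { unfold g0, fg, be. replace ((1 + m + 0) / lam / ((1 + al) / lam)) with ((1 + m) / (1 + al)) by (field; lra).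
    apply Rlt_div_l; lra. }
  assert (S1 : for_small (fun n => n < al - m)) by (small_n; lra).
  assert (S2 : for_small (fun n => lam < 2 * (al - m - n) * (1 + m) / (1 + m + n) ^ 2)).
  { apply (for_small_impl (fun n => lam < 2 * (al - m - n) * (1 + m) / ((1 + m + n) * (1 + m + n)))).
    - intros n Hn X. replace ((1 + m + n) ^ 2) with ((1 + m + n) * (1 + m + n)) by ring. exact X.
    - small_n. replace (2 * (al - m - 0) * (1 + m) / ((1 + m + 0) * (1 + m + 0))) with (2 * (al - m) / (1 + m)) by (field; lra). auto. }
  assert (S3 : for_small (fun n => n <= 1)) by (small_n; lra).
  assert (S4 : for_small (fun n => n * La <= 1 / 4)) by (small_n; lra).
  assert (S5 : for_small (fun n => fg n <= gh)) by (small_n; fold g0; unfold gh; lra).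
  assert (S6 : for_small (fun n => n / (lam * rl) <= fg n / 2)).
  { small_n. fold g0. unfold Rdiv. rewrite Rmult_0_l. lra. }
  assert (S7 : for_small (fun n => rl <= fa n)) by (small_n; fold a0; lra).
  assert (S8 : for_small (fun n => fa n <= rh)) by (small_n; fold a0; unfold rh; lra).
  assert (S9 : for_small (fun n => 0 < fb n)) by (small_n; fold b0; lra).
  assert (S10 : for_small (fun n => fb n <= bh)) by (small_n; fold b0; unfold bh; lra).
  assert (S11 : for_small (fun n => n * K <= g / 2)) by (small_n; lra).
  assert (S12 : for_small (fun n => Q + g <= fk n)).
  { small_n. rewrite Hk0. fold kk0. unfold g. lra. }
  assert (S13 : for_small (fun n => fk n <= kup)).
  { small_n. rewrite Hk0. fold kk0. unfold kup. lra. }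
  assert (S14 : for_small (fun n => lam * P + ze * (fg n / be + n * gs) - fB n <= g / rl)).
  { small_n. fold g0 B0. lra. }
  assert (S15 : for_small (fun n => fk n / rh <= ze * (fg n / be - n * gs) - fB n)).
  { small_n. rewrite Hk0. fold g0 B0. replace (c0 * a0 / rh) with (c0 / 2) by (unfold rh; field; lra). lra. }
  assert (S16 : for_small (fun n => ze * (n * gds * sl) <= 1)) by (small_n; lra).
  assert (S17 : for_small (fun n => gpq * pq_factor lam P Q rl rh g bh kap K + ze * (n * gds) <= g / (4 * (rh * rh)))).
  { small_n. unfold pq_factor. fold pqs pm qm.
    replace (g / (4 * (rh * rh))) with (4 * lim) by (unfold lim; field; lra). lra. }
  assert (S18 : for_small (fun n => 0 < fc n)) by (small_n; fold c0; lra).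
  assert (S19 : for_small (fun n => lam * fc n < 1)) by (small_n; fold c0; lra).
  assert (S20 : for_small (fun n => lam * P + fc n <= g / rl)) by (small_n; fold c0; lra).
  assert (S21 : for_small (fun n => 2 * fc n - (2 - fe n) * P + n * tg * (1 / lam + lam * P) <= 0)).
  { small_n. rewrite He0. fold c0. unfold P. lra. }
  assert (S22 : for_small (fun n => fc n * fa n * fb n - (1 - fe n) * Q + n * tg * (fb n + lam * Q) <= 0)).
  { small_n. rewrite He0. fold c0 a0 b0. fold K0. lra. }
  assert (S23 : for_small (fun n => 0 < strip_gain lam (fc n) (fa n) (fb n) (fe n) P Q (n * tg) del)).
  { unfold strip_gain. small_n. rewrite He0. fold c0 a0 b0. fold K0 C2 gam.
    assert (0 < C2 * gam) by pos. lra. }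
  assert (S24 : for_small (fun n => fc n * fe n + 2 * del <= fc n * lam)).
  { small_n. rewrite He0. fold c0. lra. }
  assert (S25 : for_small (fun n => fc n * fe n + 2 * lam * del <= fc n)).
  { small_n. rewrite He0. fold c0. lra. }
  assert (S26 : for_small (fun n => n * tg * (1 / lam + lam * P) + fe n * P <= del)).
  { small_n. rewrite He0. lra. }
  assert (S27 : for_small (fun n => 0 < fs0 n)) by (small_n; rewrite Es00; auto).
  assert (S28 : for_small (fun n => 4 * n * (be * fs0 n + 1 / (lam * fa n)) * (ze * (fa n * fa n) * fs0 n)
     <= (be * fa n * fs0 n + 2) * (fk n - 2 * n))).
  { small_n. rewrite Es00, Hk0. fold a0.
    assert (0 < (be * a0 * (g0 / be) + 2) * (c0 * a0 - 2 * 0)).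
    { apply Rmult_lt_0_compat; [|lra]. assert (0 < be * a0 * (g0 / be)) by pos. lra. }
    lra. }
  assert (S29 : for_small (fun n => 2 * n < fk n)) by (small_n; rewrite Hk0; lra).
  assert (S30 : for_small (fun n => rl <= fa n - / fc n)).
  { small_n. fold a0 c0. fold r10. lra. }
  assert (S31 : for_small (fun n => fa n - / fc n <= rh)).
  { small_n. fold a0 c0. fold r10. unfold rh. lra. }
  assert (S32 : for_small (fun n => ze * sc * (n * (rh * rh * / rl)) <= g / 2)) by (small_n; lra).
  assert (S33 : for_small (fun n => 32 * n * (ze * sc) * (gy * (rh * rh)) <= g * (rl * fg n))).
  { small_n. fold g0. assert (0 < g * (rl * g0)) by pos. lra. }
  (* Nonvanishing of [Delta1]: at n = 0 only the first product remains, and it is positive because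
     s0 < 1. *)
  assert (S34 : for_small (fun n => 0 < (1 - fs0 n) / lam * (be * fa n + 2 / fs0 n)
      - n / fa n * (1 / lam + 2) * (fa n / lam + 2 / fs0 n))).
  { assert (0 < fs0 0) by (rewrite Es00; lra). small_n. rewrite Es00. fold a0.
    assert (0 < 1 - g0 / be) by lra.
    assert (0 < (1 - g0 / be) / lam * (be * a0 + 2 / (g0 / be))) by (set (x := g0 / be) in *; pos).
    unfold Rdiv at 5. lra. }
  destruct (for_small_and _ _ S1 (for_small_and _ _ S2 (for_small_and _ _ S3 (for_small_and _ _ S4
    (for_small_and _ _ S5 (for_small_and _ _ S6 (for_small_and _ _ S7 (for_small_and _ _ S8
    (for_small_and _ _ S9 (for_small_and _ _ S10 (for_small_and _ _ S11 (for_small_and _ _ S12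
    (for_small_and _ _ S13 (for_small_and _ _ S14 (for_small_and _ _ S15 (for_small_and _ _ S16
    (for_small_and _ _ S17 (for_small_and _ _ S18 (for_small_and _ _ S19 (for_small_and _ _ S20
    (for_small_and _ _ S21 (for_small_and _ _ S22 (for_small_and _ _ S23 (for_small_and _ _ S24
    (for_small_and _ _ S25 (for_small_and _ _ S26 (for_small_and _ _ S27 (for_small_and _ _ S28
    (for_small_and _ _ S29 (for_small_and _ _ S30 (for_small_and _ _ S31 (for_small_and _ _ S32
    (for_small_and _ _ S33 S34))))))))))))))))))))))))))))))))) as [n0 [Hn0 HS]].
  clear S1 S2 S3 S4 S5 S6 S7 S8 S9 S10 S11 S12 S13 S14 S15 S16 S17 S18 S19 S20 S21 S22 S23 S24 S25 S26 S27
    S28 S29 S30 S31 S32 S33 S34.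
  exists n0. split; auto. intros n Hn Hnn0. specialize (HS n Hn Hnn0).
  destruct HS as (S1 & S2 & S3 & S4 & S5 & S6 & S7 & S8 & S9 & S10 & S11 & S12 & S13 & S14 & S15 & S16 & S17
    & S18 & S19 & S20 & S21 & S22 & S23 & S24 & S25 & S26 & S27 & S28 & S29 & S30 & S31 & S32 & S33 & S34).
  split; [lra|]. split; [auto|].
  assert (HD : 0 < Dp al m n) by (unfold Dp; lra).
  assert (J1 := par_I1 al m lam Hal Hlam n HD). assert (J2 := par_I2 al m lam Hal Hlam n HD).
  assert (Jc := par_c al m lam Hal Hlam n). assert (Je := par_eps al lam Hal Hlam n).
  assert (Hfa : 0 < fa n) by lra.
  assert (Hfg : 0 < fg n) by (unfold fg; pos).
  assert (Hs0 : s0 al m n lam = fs0 n) by (apply par_s0; auto; unfold r0; fold (fa n); lra).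
  assert (Jk : fk n = fc n * fa n - ze * fe n) by reflexivity.
  assert (Hka : fk n = fa n * (ze * (fg n / be - n / (lam * be * fa n)) - fB n)).
  { rewrite Jk. unfold fc, fe. rewrite Jc, Je. fold be ze (fg n) (fB n). field. lra. }
  assert (HDel : Delta1 al m n lam <> 0).
  { apply Rgt_not_eq. unfold Delta1. rewrite Hs0. exact S34. }
  destruct (eigenvector_eqs al m lam Hal Hlam n kap HD Hfa ltac:(rewrite Hs0; exact S27) HDel) as [Hev1 Hev2].
  cbv zeta in Hev1, Hev2. rewrite Hs0 in Hev2.
  fold (fa n) (fb n) (fk n) be ze in Hev1, Hev2.
  set (Rs := kap * y1 al m n lam) in *. set (Ss := kap * z1 al m n lam) in *.
  destruct (clamped_orbit_exists lam be ze P Q rl rh g gh bh La n (fa n) (fb n) (fk n) (fg n) (fB n) kap K)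
    as [p [q [r [s [u [y Horb]]]]]]; try assumption; try lra; try (split; assumption).
  assert (Hc : fc n = ze * (fg n / be) - fB n) by exact Jc.
  assert (He : fe n = n / (lam * be)) by exact Je.
  assert (Har : rl <= fa n <= rh) by (split; assumption).
  assert (HQ1 : 1 <= Q) by lra.
  assert (Dr := derive_r_exact lam be ze P Q rl rh g gh bh La kup n (fa n) (fb n) (fk n) (fg n) (fB n) kap (fc n) (fe n)
    p q r s u y Horb Hlam Hbe Hze HP HQ1 Hrl Hg Hn Har S9 S10 S12 S13 Hc Jk He S18 S20 J1 J2 S21 S22).
  assert (Ds := derive_s_exact lam be ze P Q rl rh g gh bh La kup n (fa n) (fb n) (fk n) (fg n) (fB n) kap (fc n) (fe n)
    p q r s u y Horb Hlam Hbe Hze HP HQ1 Hrl Hg Hn Har S9 S10 S12 S13 Hc Jk He S18 S20 J1 J2 S21 S22).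
  assert (Lp := p_tends_0 lam be ze P Q rl rh g gh bh La kup n (fa n) (fb n) (fk n) (fg n) (fB n) kap (fc n) (fe n)
    p q r s u y Horb Hlam Hbe Hze HP HQ1 Hrl Hg Hn Har S9 S10 S12 S13 Hc Jk He S18 S19 S20 J1 J2 del Hdel S21 S22 S23 S24 S25 S26).
  assert (Lq := q_tends_1 lam be ze P Q rl rh g gh bh La kup n (fa n) (fb n) (fk n) (fg n) (fB n) kap (fc n) (fe n)
    p q r s u y Horb Hlam Hbe Hze HP HQ1 Hrl Hg Hn Har S9 S10 S12 S13 Hc Jk He S18 S19 S20 J1 J2 del Hdel S21 S22 S23 S24 S25 S26).
  assert (Lrs := rs_tends lam be ze P Q rl rh g gh bh La kup n (fa n) (fb n) (fk n) (fg n) (fB n) kap (fc n) (fe n)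
    p q r s u y Horb Hlam Hbe Hze HP HQ1 Hrl Hg Hn Har S9 S10 S12 S13 Hc Jk He S18 S19 S20 J1 J2 del Hdel S21 S22 S23 S24 S25 S26
    HLa S3 S4 Hfg S5 S6 (conj S30 S31) S32 S33).
  assert (LRS := RS_limit lam be ze P Q rl rh g gh bh La kup n (fa n) (fb n) (fk n) (fg n) (fB n) kap (fc n) (fe n)
    p q r s u y Horb Hlam Hbe Hze HP HQ1 Hrl Hg Hn Har S9 S10 S12 S13 Hc Jk He S18 S20 J1 J2 S21 S22
    Rs Ss S27 Hev1 Hev2 S28 S29).
  assert (Kp : tends_minf (fun eta => exp (-2 * eta) * (p eta - 0)) (kap * 1)).
  { apply tends_minf_of. intros z Hz.
    destruct (small_eventually _ (proj1 (p_small lam be ze P Q rl rh g gh bh La n (fa n) (fb n) (fk n) (fg n) (fB n)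
      kap p q r s u y Horb)) z Hz) as [T HT].
    exists T. intros t Ht. specialize (HT t Ht). unfold p_ in HT.
    replace (exp (-2 * t) * (p t - 0) - kap * 1) with (p t * exp (-2 * t) - kap) by ring. exact HT. }
  assert (Kq : tends_minf (fun eta => exp (-2 * eta) * (q eta - 0)) (kap * (bp al m n lam * r0 al m n lam))).
  { apply tends_minf_of. intros z Hz.
    destruct (small_eventually _ (proj1 (q_small lam be ze P Q rl rh g gh bh La n (fa n) (fb n) (fk n) (fg n) (fB n)
      kap p q r s u y Horb)) z Hz) as [T HT].
    exists T. intros t Ht. specialize (HT t Ht). unfold q_ in HT.
    replace (exp (-2 * t) * (q t - 0) - kap * (bp al m n lam * r0 al m n lam))
      with (q t * exp (-2 * t) - kap * (fb n * fa n)) by (unfold r0, fa, fb; ring). exact HT. }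
  assert (Kr : tends_minf (fun eta => exp (-2 * eta) * (r eta - r0 al m n lam)) Rs).
  { apply tends_minf_of. intros z Hz. destruct (LRS z Hz) as [T HT]. exists T. intros t Ht.
    destruct (HT t Ht) as [X _]. unfold R_ in X. rewrite Rmult_comm. exact X. }
  assert (Ks : tends_minf (fun eta => exp (-2 * eta) * (s eta - s0 al m n lam)) Ss).
  { apply tends_minf_of. intros z Hz. destruct (LRS z Hz) as [T HT]. exists T. intros t Ht.
    destruct (HT t Ht) as [_ X]. unfold S_ in X. rewrite Rmult_comm, Hs0. exact X. }
  exists p, q, r, s. split.
  { intros t. repeat split; apply is_derive_Reals.
    - apply (co_p Horb).
    - apply (co_q Horb).
    - eapply derive_change; [apply Dr|].
      unfold fr, fk, k_, c_, eps_, ze, fB. field. lra.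
    - eapply derive_change; [apply Ds|].
      unfold fs, fk, k_, c_, eps_, ze, fB, fg, be. field. lra. }
  split; [exact (tends_minf_of_scaled _ _ _ Kp)|].
  split; [exact (tends_minf_of_scaled _ _ _ Kq)|].
  split; [exact (tends_minf_of_scaled _ _ _ Kr)|].
  split; [exact (tends_minf_of_scaled _ _ _ Ks)|].
  assert (Er1 : r1 al m n lam = r_eq1 (fa n) (fc n)).
  { unfold r1, r_eq1, fc, c_, fa. field. lra. }
  assert (Es1 : s1 al m n lam = s_eq1 lam be n (fa n) (fg n) (fc n)).
  { unfold s1, s_eq1. rewrite Er1. unfold be, fg.
    assert (X : 0 < r_eq1 (fa n) (fc n)) by (unfold r_eq1; lra).
    set (x := r_eq1 (fa n) (fc n)) in *. field. lra. }
  split; [|split; [|split; [|split]]].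
  - apply tends_pinf_of. intros z Hz. destruct (Lp z Hz) as [T HT]. exists T. intros t Ht.
    specialize (HT t Ht).
    assert (X := co_p_pos Horb t).
    rewrite Rminus_0_r, Rabs_right; lra.
  - now apply tends_pinf_of.
  - apply tends_pinf_of. intros z Hz. destruct (Lrs z Hz) as [T HT]. exists T. intros t Ht.
    rewrite Er1. now apply HT.
  - apply tends_pinf_of. intros z Hz. destruct (Lrs z Hz) as [T HT]. exists T. intros t Ht.
    rewrite Es1. now apply HT.
  - exists kap. split; [lra|]. auto.
Qed.
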